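(* For every $p\in\{0,1,2,\dots\}$ there is an isomorphism $\Phi:C^{p+1}(\mathbb T)\to C^p(\mathbb T)$ that restricts to isomorphisms $A^{p+1}(D)\to A^p(D)$ and $A^{p+1}_0(\hat{\mathbb C}\setminus \overline D)\to A^p_0(\hat{\mathbb C}\setminus \overline D)$. It follows that the spaces $C^0(\mathbb T), C^1(\mathbb T), C^2(\mathbb T),\dots$ are (pairwise) isomorphic Banach spaces, and the same is true for the spaces $A^0(D), A^1(D),A^2(D),\dots$.
   Context: $D$ is the open unit disc in $\mathbb C$, $\mathbb T=\partial D$, $\hat{\mathbb C}=\mathbb C\cup\{\infty\}$. For $p\in\{0,1,2,\dots\}$: $C^{p}(\mathbb T)$ is the space of $f:\mathbb T\to\mathbb C$ such that $\theta\mapsto f(e^{i\theta})$ is $p$ times continuously differentiable, topologized by the semi-norms $\|d^lf/d\theta^l\|_\infty$, $0\le l\le p$. $A^{p}(D)$ is the space of holomorphic functions on $D$ whose derivatives $f^{(l)}$, $0\le l\le p$, extend continuously to $\overline D$, topologized by $\sup_{\overline D}|f^{(l)}|$, $0\le l\le p$. $A_0^{p}(\hat{\mathbb C}\setminus\overline D)$ is the space of functions $f$ holomorphic on $\mathbb C\setminus\overline D$ whose derivatives $f^{(l)}$, $0\le l\le p$, extend continuously to $\mathbb C\setminus D$, with $\lim_{z\to\infty}f(z)=0$, topologized by $\sup_{\mathbb C\setminus D}|f^{(l)}|$, $0\le l\le p$. These are Banach spaces, and $A^p(D)$ and $A_0^p(\hat{\mathbb C}\setminus\overline D)$ are regarded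 as closed subspaces of $C^p(\mathbb T)$ via restriction of the continuous extension to $\mathbb T$. ''Isomorphism'' means linear homeomorphism. *)

(* Defs.v *)
From Stdlib Require Import Reals Lra Lia ZArith.
From Stdlib Require Import ClassicalEpsilon FunctionalExtensionality ProofIrrelevance.
From Coquelicot Require Import Coquelicot.
Open Scope R_scope.

(* Coquelicot offers several structures on C.  Complex differentiability is
   [is_derive] over [C_AbsRing] with values in [C_NormedModule]; derivatives of
   functions R -> C are taken in [C_R_NormedModule]; continuity refers to
   [C_UniformSpace], whose topology is the one of [Cmod]. *)

Lemma C_derive_R_filterdiff (q : C -> C) (z d : C) :
  is_derive (K := C_AbsRing) (V := C_NormedModule) q z d ->
  filterdiff (K := R_AbsRing) (U := C_R_NormedModule) (V := C_R_NormedModule)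
    q (locally z) (fun w => Cmult w d).
Proof.
intros [_ H]; split.
- split.
  + intros x y; exact (Cmult_plus_distr_r x y d).
  + intros k x. rewrite !scal_R_Cmult. symmetry. apply Cmult_assoc.
  + exists (Cmod d + 1); split.
    generalize (Cmod_ge_0 d); lra.
    intros x. rewrite <- !Cmod_norm, Cmod_mult.
    generalize (Cmod_ge_0 d) (Cmod_ge_0 x); nra.
- intros x Hx.
  assert (E : z = x) by exact (is_filter_lim_locally_unique (V := C_R_NormedModule) z x Hx).
  subst x. intros eps. specialize (H z (fun P HP => HP) eps).
  apply locally_C.
  revert H. apply filter_imp. intros w Hw. rewrite <- !Cmod_norm. exact Hw.
Qed.

Lemma C_derive_comp_R (q : C -> C) (g : R -> C) (t : R) (d v : C) :
  is_derive (K := C_AbsRing) (V := C_NormedModule) q (g t) d ->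
  is_derive (K := R_AbsRing) (V := C_R_NormedModule) g t v ->
  is_derive (K := R_AbsRing) (V := C_R_NormedModule) (fun u => q (g u)) t (Cmult v d).
Proof.
intros Hq Hg. apply C_derive_R_filterdiff in Hq.
generalize (filterdiff_comp' (V := C_R_NormedModule) (W := C_R_NormedModule) g q t _ _ Hg Hq).
intros H. eapply filterdiff_ext_lin. exact H.
intros y. simpl. rewrite !scal_R_Cmult. symmetry. apply Cmult_assoc.
Qed.

Lemma is_derive_C_R (g : R -> C) (t : R) (v : C) :
  is_derive (K := R_AbsRing) (V := C_R_NormedModule) g t v <->
  is_derive (fun u => fst (g u)) t (fst v) /\ is_derive (fun u => snd (g u)) t (snd v).
Proof.
split.
- intros H; split.
  + apply (filterdiff_comp' (V := C_R_NormedModule) (W := R_NormedModule) g (@fst R R) t _ (@fst R R) H).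
    apply filterdiff_linear. apply (is_linear_fst (U := R_NormedModule) (V := R_NormedModule)).
  + apply (filterdiff_comp' (V := C_R_NormedModule) (W := R_NormedModule) g (@snd R R) t _ (@snd R R) H).
    apply filterdiff_linear. apply (is_linear_snd (U := R_NormedModule) (V := R_NormedModule)).
- intros [[_ H1] [_ H2]]. split. apply is_linear_scal_l.
  intros x Hx eps.
  assert (he : 0 < eps / 2) by (destruct eps; simpl; lra).
  generalize (filter_and _ _ (H1 x Hx (mkposreal _ he)) (H2 x Hx (mkposreal _ he))).
  apply filter_imp. intros y [A B]. simpl in A, B.
  set (n := norm (minus y x)) in *.
  rewrite <- Cmod_norm.
  match goal with |- Cmod ?u <= _ => set (w := u) end.
  assert (HW : Cmod w <= Rabs (fst w) + Rabs (snd w)).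
  { destruct w as [a b]. replace (a, b) with (Cplus (RtoC a) (Cmult Ci (RtoC b))).
    2:{ apply injective_projections; simpl; ring. }
    eapply Rle_trans. apply Cmod_triangle.
    rewrite Cmod_mult, !Cmod_R, Cmod_Ci. simpl. apply Req_le.
    f_equal. f_equal; ring. rewrite Rmult_1_l. f_equal. ring. }
  change (Rabs (fst w) <= eps / 2 * n) in A.
  change (Rabs (snd w) <= eps / 2 * n) in B. set (nn := eps / 2 * n) in *. change (Cmod w <= eps * n). replace (eps * n) with (nn + nn) by (unfold nn; field). lra.
Qed.

Lemma continuous_fst_C {U : UniformSpace} (f : U -> C) (x : U) :
  continuous (U := C_UniformSpace) f x ->
  continuous (U := R_UniformSpace) (fun u => fst (f u)) x.
Proof.
intros H. apply (continuous_comp (V := C_UniformSpace) f (fun z : C => fst z)); auto.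
destruct (f x); apply (continuous_fst (U := R_UniformSpace) (V := R_UniformSpace)).
Qed.

Lemma continuous_snd_C {U : UniformSpace} (f : U -> C) (x : U) :
  continuous (U := C_UniformSpace) f x ->
  continuous (U := R_UniformSpace) (fun u => snd (f u)) x.
Proof.
intros H. apply (continuous_comp (V := C_UniformSpace) f (fun z : C => snd z)); auto.
destruct (f x); apply (continuous_snd (U := R_UniformSpace) (V := R_UniformSpace)).
Qed.

Lemma continuous_C {U : UniformSpace} (f : U -> C) (x : U) :
  continuous (U := R_UniformSpace) (fun u => fst (f u)) x ->
  continuous (U := R_UniformSpace) (fun u => snd (f u)) x ->
  continuous (U := C_UniformSpace) f x.
Proof.
intros H1 H2.
apply (continuous_ext (U := C_UniformSpace) (fun u => (fst (f u), snd (f u)))).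
intros u; symmetry; apply surjective_pairing.
apply (continuous_comp_2 (V := R_UniformSpace) (W := R_UniformSpace) (X := C_UniformSpace)
   (fun u => fst (f u)) (fun u => snd (f u)) pair x H1 H2).
apply continuous_ext with (fun z => z). intros []; reflexivity.
apply continuous_id.
Qed.

Lemma continuous_is_derive_C (f : C -> C) (z l : C) :
  is_derive (K := C_AbsRing) (V := C_NormedModule) f z l ->
  continuous (T := C_UniformSpace) (U := C_UniformSpace) f z.
Proof.
intros H. apply C_derive_R_filterdiff in H.
apply (filterdiff_continuous (U := C_R_NormedModule) (V := C_R_NormedModule)).
eexists; exact H.
Qed.

Lemma is_derive_C_eps (f : C -> C) (z l : C) :
  is_derive (K := C_AbsRing) (V := C_NormedModule) f z l ->
  forall eps : posreal, exists delta : posreal, forall w,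
    Cmod (w - z)%C < delta ->
    Cmod ((f w - f z) - (w - z) * l)%C <= eps * Cmod (w - z)%C.
Proof.
intros [_ H] eps.
destruct (H z (fun P HP => HP) eps) as [d Hd].
exists d. intros w Hw. exact (Hd w Hw).
Qed.

Lemma is_derive_scal_r {K : AbsRing} {V : NormedModule K} (f : K -> V) (c x : K) (l : V) :
  (forall n m : K, mult n m = mult m n) ->
  is_derive f x l -> is_derive (fun y => scal c (f y)) x (scal c l).
Proof.
intros Hc H. unfold is_derive.
eapply filterdiff_ext_lin.
exact (filterdiff_scal_r_fct c f _ Hc H).
intros y. simpl. rewrite !scal_assoc. f_equal. apply Hc.
Qed.

(* Cauchy's estimate is needed for the derivatives in A_0^p to be bounded near
   infinity.  The integral of [k s] below does not depend on s. *)
Section MeanValue.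
Context (f h : C -> C) (a : C) (M : R).
Context (Hf : forall z, Cmod (z - a)%C < 2 ->
  is_derive (K := C_AbsRing) (V := C_NormedModule) f z (h z)).
Context (Hh : forall z, Cmod (z - a)%C < 2 ->
  continuous (T := C_UniformSpace) (U := C_UniformSpace) h z).

Let e (t : R) : C := (cos t, sin t).
Let g (s t : R) : C := (a + RtoC s * e t)%C.
Let k (s t : R) : R := (fst (f (g s t)) * cos t + snd (f (g s t)) * sin t) / s.
Let P (s t : R) : R := fst (e t * h (g s t))%C.
Let Q (s t : R) : R := snd (e t * h (g s t))%C.
Let dk (s t : R) : R := (P s t * cos t + Q s t * sin t) / s
  - (fst (f (g s t)) * cos t + snd (f (g s t)) * sin t) / s ^ 2.

Lemma Cmod_e t : Cmod (e t) = 1.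
Proof.
unfold Cmod, e; simpl. transitivity (sqrt 1); [f_equal | apply sqrt_1].
generalize (sin2_cos2 t). unfold Rsqr. lra.
Qed.

Lemma Cmod_g s t : 0 < s -> Cmod (g s t - a)%C = s.
Proof.
intros Hs. unfold g. replace (a + RtoC s * e t - a)%C with (RtoC s * e t)%C by ring.
rewrite Cmod_mult, Cmod_e, Cmod_R, Rabs_pos_eq; lra.
Qed.

Lemma g_derive_s s t :
  is_derive (K := R_AbsRing) (V := C_R_NormedModule) (fun s => g s t) s (e t).
Proof.
apply is_derive_C_R; unfold g, e; split; simpl; auto_derive; auto; ring.
Qed.

Lemma g_derive_t s t :
  is_derive (K := R_AbsRing) (V := C_R_NormedModule) (fun t => g s t) t (Ci * RtoC s * e t)%C.
Proof.
apply is_derive_C_R; unfold g, e; split; simpl; auto_derive; auto; ring.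
Qed.

Lemma f_derive_s s t : 0 < s < 2 ->
  is_derive (fun s => fst (f (g s t))) s (P s t) /\
  is_derive (fun s => snd (f (g s t))) s (Q s t).
Proof.
intros Hs. apply (is_derive_C_R (fun s => f (g s t)) s (e t * h (g s t))%C).
apply C_derive_comp_R. apply Hf. rewrite Cmod_g; lra. apply g_derive_s.
Qed.

Lemma f_derive_t s t : 0 < s < 2 ->
  is_derive (fun t => fst (f (g s t))) t (- s * Q s t) /\
  is_derive (fun t => snd (f (g s t))) t (s * P s t).
Proof.
intros Hs.
assert (H : is_derive (K := R_AbsRing) (V := C_R_NormedModule) (fun t => f (g s t)) t
   (Ci * RtoC s * e t * h (g s t))%C).
{ apply C_derive_comp_R. apply Hf. rewrite Cmod_g; lra. apply g_derive_t. }
apply is_derive_C_R in H. destruct H as [H1 H2].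
split; [eapply is_derive_ext_loc in H1 | eapply is_derive_ext_loc in H2].
all: try (apply filter_forall; intros; reflexivity).
- replace (- s * Q s t) with (fst (Ci * RtoC s * e t * h (g s t))%C). exact H1.
  unfold Q; simpl; ring.
- replace (s * P s t) with (snd (Ci * RtoC s * e t * h (g s t))%C). exact H2.
  unfold P; simpl; ring.
Qed.

Lemma k_derive_s s t : 0 < s < 2 -> is_derive (fun s => k s t) s (dk s t).
Proof.
intros Hs. destruct (f_derive_s s t Hs) as [H1 H2].
unfold k, dk.
set (A := fun s => fst (f (g s t))) in *. set (B := fun s => snd (f (g s t))) in *.
change (is_derive (fun s => (A s * cos t + B s * sin t) / s) s
  ((P s t * cos t + Q s t * sin t) / s - (A s * cos t + B s * sin t) / s ^ 2)).
auto_derive. repeat split. eexists; exact H1. eexists; exact H2. lra.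
assert (E1 : Derive A s = P s t) by exact (is_derive_unique _ _ _ H1).
assert (E2 : Derive B s = Q s t) by exact (is_derive_unique _ _ _ H2).
change (fun x : R => A x) with A; change (fun x : R => B x) with B. rewrite E1, E2. field. lra.
Qed.

Lemma k_derive_t s t : 0 < s < 2 ->
  is_derive (fun t => (snd (f (g s t)) * cos t - fst (f (g s t)) * sin t) / s ^ 2) t (dk s t).
Proof.
intros Hs. destruct (f_derive_t s t Hs) as [H1 H2].
unfold dk.
set (A := fun t => fst (f (g s t))) in *. set (B := fun t => snd (f (g s t))) in *.
change (is_derive (fun t => (B t * cos t - A t * sin t) / s ^ 2) t
  ((P s t * cos t + Q s t * sin t) / s - (A t * cos t + B t * sin t) / s ^ 2)).
auto_derive. repeat split. eexists; exact H2. eexists; exact H1.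
assert (E1 : Derive A t = - s * Q s t) by exact (is_derive_unique _ _ _ H1).
assert (E2 : Derive B t = s * P s t) by exact (is_derive_unique _ _ _ H2).
change (fun x : R => A x) with A; change (fun x : R => B x) with B. rewrite E1, E2. field. lra.
Qed.

Lemma g_cont (z : R * R) :
  continuous (T := prod_UniformSpace R_UniformSpace R_UniformSpace) (U := C_UniformSpace)
   (fun z => g (fst z) (snd z)) z.
Proof.
apply continuous_C; unfold g, e; simpl;
 apply (continuous_plus (V := R_NormedModule) (fun _ => _) (fun _ => _)); try apply continuous_const;
 [apply (continuous_minus (V := R_NormedModule) (fun _ => _) (fun _ => _))
 |apply (continuous_plus (V := R_NormedModule) (fun _ => _) (fun _ => _))];
 apply (continuous_mult (K := R_AbsRing) (fun _ => _) (fun _ => _)); try apply continuous_const.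
all: try (destruct z; apply continuous_fst).
all: [> apply (continuous_comp snd cos) | apply (continuous_comp snd sin) | apply (continuous_comp snd sin) | apply (continuous_comp snd cos)].
all: try (destruct z; apply continuous_snd).
all: first [apply continuous_cos | apply continuous_sin].
Qed.

Lemma comp_cont (q : C -> C) s t :
  continuous (T := C_UniformSpace) (U := C_UniformSpace) q (g s t) ->
  continuity_2d_pt (fun s t => fst (q (g s t))) s t /\
  continuity_2d_pt (fun s t => snd (q (g s t))) s t.
Proof.
intros Hq.
assert (H : continuous (T := prod_UniformSpace R_UniformSpace R_UniformSpace) (U := C_UniformSpace)
   (fun z => q (g (fst z) (snd z))) (s, t)).
{ apply (continuous_comp (V := C_UniformSpace) (fun z => g (fst z) (snd z)) q).
  apply g_cont. exact Hq. }
split; apply continuity_2d_pt_filterlim.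
exact (continuous_fst_C _ _ H). exact (continuous_snd_C _ _ H).
Qed.

Lemma dk_cont s t : 0 < s < 2 -> continuity_2d_pt dk s t.
Proof.
intros Hs.
assert (Hg : Cmod (g s t - a)%C < 2) by (rewrite Cmod_g; lra).
destruct (comp_cont f s t (continuous_is_derive_C _ _ _ (Hf _ Hg))) as [A1 A2].
destruct (comp_cont h s t (Hh _ Hg)) as [B1 B2].
assert (Cc : continuity_2d_pt (fun _ t => cos t) s t).
{ apply (continuity_1d_2d_pt_comp cos (fun _ t => t)). apply continuity_cos. apply continuity_2d_pt_id2. }
assert (Cs : continuity_2d_pt (fun _ t => sin t) s t).
{ apply (continuity_1d_2d_pt_comp sin (fun _ t => t)). apply continuity_sin. apply continuity_2d_pt_id2. }
assert (Ci' : continuity_2d_pt (fun s _ => / s) s t).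
{ apply continuity_2d_pt_inv. apply continuity_2d_pt_id1. lra. }
assert (Ci2 : continuity_2d_pt (fun s _ => / s ^ 2) s t).
{ apply continuity_2d_pt_inv. 2:{ apply pow_nonzero; lra. }
  apply (continuity_2d_pt_ext (fun s _ => s * s)). intros; ring.
  apply continuity_2d_pt_mult; apply continuity_2d_pt_id1. }
unfold dk, P, Q, Rdiv; simpl.
repeat first [ assumption | apply continuity_2d_pt_minus | apply continuity_2d_pt_mult | apply continuity_2d_pt_plus ].
Qed.

Lemma slice_cont (F : R -> R -> R) s t : continuity_2d_pt F s t -> continuous (F s) t.
Proof.
intros H. apply continuity_2d_pt_filterlim in H.
apply (continuous_comp_2 (fun _ => s) (fun t => t) F t).
apply continuous_const. apply continuous_id. exact H.
Qed.

Lemma k_ex_RInt s : 0 < s < 2 -> ex_RInt (k s) 0 (2 * PI).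
Proof.
intros Hs. apply (ex_RInt_continuous (V := R_CompleteNormedModule)).
intros t _.
assert (Hg : Cmod (g s t - a)%C < 2) by (rewrite Cmod_g; lra).
destruct (comp_cont f s t (continuous_is_derive_C _ _ _ (Hf _ Hg))) as [A1 A2].
apply slice_cont in A1. apply slice_cont in A2.
unfold k, Rdiv.
repeat first [apply (continuous_mult (K := R_AbsRing) (fun _ => _) (fun _ => _)) | apply (continuous_plus (V := R_NormedModule) (fun _ => _) (fun _ => _))
 | assumption | apply continuous_cos | apply continuous_sin | apply continuous_const].
Qed.

Lemma g_2PI s : g s (2 * PI) = g s 0.
Proof. unfold g, e. rewrite cos_2PI, sin_2PI, cos_0, sin_0. reflexivity. Qed.

Lemma loc02 s : 0 < s < 2 -> locally s (fun u => 0 < u < 2).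
Proof.
intros Hs. apply (open_and (T := R_UniformSpace) (fun u => 0 < u) (fun u => u < 2)).
apply open_gt. apply open_lt. exact Hs.
Qed.

Lemma m_derive s : 0 < s < 2 -> is_derive (fun s => RInt (k s) 0 (2 * PI)) s 0.
Proof.
intros Hs.
assert (E : RInt (fun t => Derive (fun u => k u t) s) 0 (2 * PI) = 0).
{ apply is_RInt_unique.
  apply is_RInt_ext with (dk s).
  intros t _. symmetry. apply is_derive_unique. now apply k_derive_s.
  generalize (is_RInt_derive (V := R_CompleteNormedModule) (fun t => (snd (f (g s t)) * cos t - fst (f (g s t)) * sin t) / s ^ 2)
    (dk s) 0 (2 * PI) (fun t _ => k_derive_t s t Hs) (fun t _ => slice_cont dk s t (dk_cont s t Hs))).
  cbv beta. rewrite g_2PI, cos_2PI, sin_2PI, cos_0, sin_0, minus_eq_zero. auto. }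
assert (D : is_derive (fun s => RInt (k s) 0 (2 * PI)) s
  (RInt (fun t => Derive (fun u => k u t) s) 0 (2 * PI))).
2: now rewrite E in D.
apply is_derive_RInt_param.
- generalize (loc02 s Hs). apply filter_imp. intros u Hu t _. exists (dk u t). now apply k_derive_s.
- intros t _. apply continuity_2d_pt_ext_loc with dk. 2: now apply dk_cont.
  apply locally_2d_locally.
  destruct (loc02 s Hs) as [d Hd]. exists d. intros [u v] [Hu _]. simpl.
  symmetry. apply is_derive_unique. apply k_derive_s. apply Hd. exact Hu.
- generalize (loc02 s Hs). apply filter_imp. intros u Hu. now apply k_ex_RInt.
Qed.

Lemma m_const s : 0 < s < 1 -> RInt (k s) 0 (2 * PI) = RInt (k 1) 0 (2 * PI).
Proof.
intros Hs. apply (eq_is_derive (V := R_NormedModule) (fun s => RInt (k s) 0 (2 * PI)) s 1).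
intros t Ht. apply m_derive. lra. lra.
Qed.

Lemma derive_bound_fst :
  f a = RtoC 0 -> (forall z, Cmod (z - a)%C <= 1 -> Cmod (f z) <= M) -> fst (h a) <= M.
Proof.
intros Ha HM. apply Rnot_lt_le; intros Hlt.
assert (he : 0 < (fst (h a) - M) / 2) by lra.
destruct (is_derive_C_eps f a (h a) (Hf a ltac:(replace (a - a)%C with (RtoC 0) by ring; rewrite Cmod_0; lra)) (mkposreal _ he)) as [d Hd].
simpl in Hd.
set (s := Rmin (d / 2) (1 / 2)).
assert (Hs : 0 < s < 1 /\ s < d).
{ unfold s. destruct d as [d d0]; simpl. unfold Rmin; destruct Rle_dec; lra. }
destruct Hs as [Hs Hsd].
assert (P0 := PI_RGT_0).
assert (fstbound : forall z : C, Rabs (fst z) <= Cmod z).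
{ intros z. eapply Rle_trans. 2: apply Rmax_Cmod. apply Rmax_l. }
assert (kE : forall s t, k s t = fst ((f (g s t)) * Cconj (e t))%C / s).
{ intros; unfold k; simpl. f_equal. ring. }
assert (ce : forall t, Cmod (Cconj (e t)) = 1).
{ intros t. rewrite Cmod_conj. apply Cmod_e. }
assert (U : RInt (k 1) 0 (2 * PI) <= 2 * PI * M).
{ replace (2 * PI * M) with (RInt (fun _ => M) 0 (2 * PI)).
  2:{ rewrite RInt_const. unfold scal; simpl; unfold mult; simpl. ring. }
  apply RInt_le. lra. apply k_ex_RInt; lra. apply ex_RInt_const.
  intros t _. rewrite kE. unfold Rdiv. rewrite Rinv_1, Rmult_1_r.
  eapply Rle_trans. apply Rle_abs. eapply Rle_trans. apply fstbound.
  rewrite Cmod_mult, ce, Rmult_1_r. apply HM. rewrite Cmod_g; lra. }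
assert (L : 2 * PI * ((fst (h a) + M) / 2) <= RInt (k s) 0 (2 * PI)).
{ replace (2 * PI * ((fst (h a) + M) / 2)) with (RInt (fun _ => (fst (h a) + M) / 2) 0 (2 * PI)).
  2:{ rewrite RInt_const. unfold scal; simpl; unfold mult; simpl. ring. }
  apply RInt_le. lra. apply ex_RInt_const. apply k_ex_RInt; lra.
  intros t _. rewrite kE.
  specialize (Hd (g s t)). rewrite Cmod_g in Hd by lra. specialize (Hd Hsd).
  rewrite Ha in Hd.
  set (r := (f (g s t) - RtoC 0 - (g s t - a) * h a)%C) in Hd.
  assert (E : (f (g s t) * Cconj (e t) = RtoC s * h a + r * Cconj (e t))%C).
  { unfold r, g. replace (f (a + RtoC s * e t) - RtoC 0 - (a + RtoC s * e t - a) * h a)%C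
      with (f (a + RtoC s * e t) - RtoC s * e t * h a)%C by ring.
    rewrite Cmult_comm, (Cmult_comm (_ - _)%C).
    assert (X : (Cconj (e t) * e t = RtoC 1)%C).
    { unfold Cconj, e, RtoC, Cmult; simpl. generalize (sin2_cos2 t); unfold Rsqr; intros X. f_equal; lra. }
    transitivity (RtoC s * (Cconj (e t) * e t) * h a + Cconj (e t) * (f (a + RtoC s * e t) - RtoC s * e t * h a))%C.
    ring. rewrite X. ring. }
  rewrite E.
  assert (Y : Rabs (fst (r * Cconj (e t))%C) <= (fst (h a) - M) / 2 * s).
  { eapply Rle_trans. apply fstbound. rewrite Cmod_mult, ce, Rmult_1_r. exact Hd. }
  apply Rabs_le_between in Y.
  change (fst (RtoC s * h a + r * Cconj (e t))%C) with (fst (RtoC s * h a)%C + fst (r * Cconj (e t))%C).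
  replace (fst (RtoC s * h a)%C) with (s * fst (h a)) by (simpl; ring).
  apply Rmult_le_reg_r with s. lra.
  unfold Rdiv at 2. rewrite Rmult_assoc, Rinv_l, Rmult_1_r by lra. lra. }
rewrite (m_const s Hs) in L. nra.
Qed.

End MeanValue.

Lemma cauchy_estimate (f h : C -> C) (a : C) (M : R) :
  (forall z, Cmod (z - a)%C < 2 ->
    is_derive (K := C_AbsRing) (V := C_NormedModule) f z (h z)) ->
  (forall z, Cmod (z - a)%C < 2 ->
    continuous (T := C_UniformSpace) (U := C_UniformSpace) h z) ->
  (forall z, Cmod (z - a)%C <= 1 -> Cmod (f z) <= M) ->
  Cmod (h a) <= 2 * M.
Proof.
intros Hf Hh HM.
destruct (Ceq_dec (h a) 0) as [H0|H0].
{ rewrite H0, Cmod_0. generalize (HM a). replace (a - a)%C with (RtoC 0) by ring. rewrite Cmod_0.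
  intros X; specialize (X Rle_0_1). generalize (Cmod_ge_0 (f a)). lra. }
assert (Hn : 0 < Cmod (h a)) by now apply Cmod_gt_0.
set (c := (Cconj (h a) / RtoC (Cmod (h a)))%C).
assert (c1 : Cmod c = 1).
{ unfold c. rewrite Cmod_div, Cmod_conj, Cmod_R, Rabs_pos_eq. field. lra. lra.
  intros X. apply RtoC_inj in X. lra. }
assert (ch : (c * h a)%C = RtoC (Cmod (h a))).
{ unfold c. assert (Y : RtoC (Cmod (h a)) <> 0%C). { intros X. apply RtoC_inj in X. lra. }
  transitivity ((h a * Cconj (h a)) / RtoC (Cmod (h a)))%C. field; exact Y.
  rewrite <- Cmod2_conj, RtoC_pow. field. exact Y. }
replace (Cmod (h a)) with (fst (c * h a)%C) by (rewrite ch; reflexivity).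
apply (derive_bound_fst (fun z => c * (f z - f a))%C (fun z => c * h z)%C a (2 * M)).
- intros z Hz.
  apply (is_derive_scal_r (K := C_AbsRing) (V := C_NormedModule) (fun z => f z - f a)%C c z (h z) Cmult_comm).
  assert (X := is_derive_minus (K := C_AbsRing) (V := C_NormedModule) f (fun _ => f a) z _ _ (Hf z Hz)
    (is_derive_const (K := C_AbsRing) (V := C_NormedModule) (f a) z)).
  rewrite (minus_zero_r (G := C_AbelianGroup)) in X. exact X.
- intros z Hz. apply (continuous_scal_r (K := C_AbsRing) (V := C_NormedModule)). now apply Hh.
- ring.
- intros z Hz. rewrite Cmod_mult, c1, Rmult_1_l.
  eapply Rle_trans. apply Cmod_triangle. rewrite Cmod_opp.
  generalize (HM z Hz) (HM a). replace (a - a)%C with (RtoC 0) by ring. rewrite Cmod_0.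
  intros X Y; specialize (Y Rle_0_1). lra.
Qed.

(* The common pattern of C^p(T), A^p(D) and A_0^p.  [jet f l g] reads "g is the
   (continuously extended) l-th derivative of f"; only the values of g on [jset]
   matter, and the semi-norms are suprema over [jset].  [jadm] collects the
   conditions on f itself. *)
Record jet_system := {
  jdom : Type;
  jpt : Type;
  jset : jpt -> Prop;
  jadm : (jdom -> C) -> Prop;
  jet : (jdom -> C) -> nat -> (jpt -> C) -> Prop;
  jset_inhab : exists y, jset y;
  jadm_zero : jadm (fun _ => RtoC 0);
  jadm_plus : forall f1 f2, jadm f1 -> jadm f2 -> jadm (fun x => Cplus (f1 x) (f2 x));
  jadm_scal : forall c f, jadm f -> jadm (fun x => Cmult c (f x));
  jet_zero : forall l, jet (fun _ => RtoC 0) l (fun _ => RtoC 0);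
  jet_plus : forall f1 f2 l g1 g2, jet f1 l g1 -> jet f2 l g2 ->
    jet (fun x => Cplus (f1 x) (f2 x)) l (fun y => Cplus (g1 y) (g2 y));
  jet_scal : forall c f l g, jet f l g ->
    jet (fun x => Cmult c (f x)) l (fun y => Cmult c (g y));
  jet_unique : forall f l g1 g2, jet f l g1 -> jet f l g2 ->
    forall y, jset y -> g1 y = g2 y;
  jet_bounded : forall f l, jadm f ->
    (forall k, (k <= l)%nat -> exists g, jet f k g) ->
    forall g, jet f l g -> exists M, forall y, jset y -> Cmod (g y) <= M;
  jet_faithful : forall f g, jet f 0 g -> (forall y, jset y -> g y = RtoC 0) ->
    forall x, f x = RtoC 0
}.

Section JetSpace.
Context (J : jet_system) (p : nat).

Definition jmem (f : jdom J -> C) : Prop :=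
  jadm J f /\ forall l, (l <= p)%nat -> exists g, jet J f l g.

Definition jcarrier : Type := {f : jdom J -> C | jmem f}.

(* The numbers |f^(l)(y)| with l <= p; their supremum is the maximum of the p+1
   semi-norms, hence a norm defining the same topology. *)
Definition jvalues (f : jdom J -> C) (r : R) : Prop :=
  exists l g y, (l <= p)%nat /\ jet J f l g /\ jset J y /\ r = Cmod (g y).

Definition jnorm (f : jcarrier) : R := real (Lub_Rbar (jvalues (proj1_sig f))).

Lemma jcarrier_eq (f1 f2 : jcarrier) :
  (forall x, proj1_sig f1 x = proj1_sig f2 x) -> f1 = f2.
Proof.
destruct f1 as [f1 H1], f2 as [f2 H2]; simpl; intros E.
apply functional_extensionality in E. subst f2. f_equal. apply proof_irrelevance.
Qed.

Lemma jmem_zero : jmem (fun _ => RtoC 0).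
Proof. split. apply jadm_zero. intros l _. eexists. apply jet_zero. Qed.

Lemma jmem_plus f1 f2 : jmem f1 -> jmem f2 -> jmem (fun x => Cplus (f1 x) (f2 x)).
Proof.
intros [A1 B1] [A2 B2]; split. now apply jadm_plus.
intros l Hl. destruct (B1 l Hl) as [g1 G1], (B2 l Hl) as [g2 G2].
eexists. apply jet_plus; eassumption.
Qed.

Lemma jmem_scal c f : jmem f -> jmem (fun x => Cmult c (f x)).
Proof.
intros [A B]; split. now apply jadm_scal.
intros l Hl. destruct (B l Hl) as [g G]. eexists. apply jet_scal; eassumption.
Qed.

Definition jzero : jcarrier := exist _ _ jmem_zero.
Definition jplus (f1 f2 : jcarrier) : jcarrier :=
  exist _ _ (jmem_plus _ _ (proj2_sig f1) (proj2_sig f2)).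
Definition jscal (c : C) (f : jcarrier) : jcarrier :=
  exist _ _ (jmem_scal c _ (proj2_sig f)).
Definition jopp (f : jcarrier) : jcarrier := jscal (Copp 1) f.
Definition jball (f : jcarrier) (eps : R) (g : jcarrier) : Prop :=
  jnorm (jplus g (jopp f)) < eps.

Lemma jvalues_bounded f : jmem f -> exists M, forall r, jvalues f r -> r <= M.
Proof.
intros [A B].
assert (H : forall n, (n <= p)%nat -> exists M, forall l g y, (l <= n)%nat ->
  jet J f l g -> jset J y -> Cmod (g y) <= M).
{ induction n as [|n IH]; intros Hn.
  - destruct (B O Hn) as [g0 G0].
    destruct (jet_bounded J f 0 A) with (g := g0) as [M HM]; auto.
    { intros k Hk. apply B. lia. }
    exists M. intros l g y Hl G Hy. replace l with O in G by lia.
    rewrite (jet_unique J _ _ _ _ G G0 y Hy). now apply HM.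
  - destruct IH as [M1 H1]. lia.
    destruct (B (S n) Hn) as [g0 G0].
    destruct (jet_bounded J f (S n) A) with (g := g0) as [M HM]; auto.
    { intros k Hk. apply B. lia. }
    exists (Rmax M1 M). intros l g y Hl G Hy.
    destruct (Nat.eq_dec l (S n)) as [->|Hne].
    + rewrite (jet_unique J _ _ _ _ G G0 y Hy).
      eapply Rle_trans. now apply HM. apply Rmax_r.
    + eapply Rle_trans. apply (H1 l g y); auto. lia. apply Rmax_l. }
destruct (H p (Nat.le_refl p)) as [M HM].
exists M. intros r (l & g & y & Hl & G & Hy & ->). now apply HM with l.
Qed.

Lemma jvalues_inhab f : jmem f -> exists r, jvalues f r /\ 0 <= r.
Proof.
intros [_ B]. destruct (jset_inhab J) as [y Hy].
destruct (B O (Nat.le_0_l p)) as [g G].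
exists (Cmod (g y)). split. exists O, g, y. repeat split; auto. lia. apply Cmod_ge_0.
Qed.

Lemma jnorm_ub (f : jcarrier) r : jvalues (proj1_sig f) r -> r <= jnorm f.
Proof.
intros Hr. unfold jnorm, Lub_Rbar.
destruct ex_lub_Rbar as [s [U L]]; simpl.
destruct (jvalues_bounded _ (proj2_sig f)) as [M HM].
specialize (L (Finite M) HM). specialize (U r Hr).
destruct s; simpl in *; tauto.
Qed.

Lemma jnorm_lub (f : jcarrier) M :
  (forall r, jvalues (proj1_sig f) r -> r <= M) -> jnorm f <= M.
Proof.
intros HM. unfold jnorm, Lub_Rbar.
destruct ex_lub_Rbar as [s [U L]]; simpl.
specialize (L (Finite M) HM).
destruct (jvalues_inhab _ (proj2_sig f)) as [r [Hr _]]. specialize (U r Hr).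
destruct s; simpl in *; tauto.
Qed.

Lemma jnorm_ge_0 f : 0 <= jnorm f.
Proof.
destruct (jvalues_inhab _ (proj2_sig f)) as [r [Hr H0]].
apply Rle_trans with r; auto. now apply jnorm_ub.
Qed.

Lemma jnorm_plus f1 f2 : jnorm (jplus f1 f2) <= jnorm f1 + jnorm f2.
Proof.
apply jnorm_lub. intros r (l & g & y & Hl & G & Hy & ->).
destruct (proj2 (proj2_sig f1) l Hl) as [g1 G1].
destruct (proj2 (proj2_sig f2) l Hl) as [g2 G2].
rewrite (jet_unique J _ _ _ _ G (jet_plus J _ _ _ _ _ G1 G2) y Hy).
eapply Rle_trans. apply Cmod_triangle.
apply Rplus_le_compat; apply jnorm_ub.
exists l, g1, y; auto. exists l, g2, y; auto.
Qed.

Lemma jnorm_scal c f : jnorm (jscal c f) <= Cmod c * jnorm f.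
Proof.
apply jnorm_lub. intros r (l & g & y & Hl & G & Hy & ->).
destruct (proj2 (proj2_sig f) l Hl) as [g1 G1].
rewrite (jet_unique J _ _ _ _ G (jet_scal J c _ _ _ G1) y Hy).
rewrite Cmod_mult. apply Rmult_le_compat_l. apply Cmod_ge_0.
apply jnorm_ub. exists l, g1, y; auto.
Qed.

Lemma jnorm_eq_0 f : jnorm f = 0 -> f = jzero.
Proof.
intros H0. apply jcarrier_eq; simpl.
destruct (proj2 (proj2_sig f) O (Nat.le_0_l p)) as [g G].
apply (jet_faithful J _ _ G). intros y Hy. apply Cmod_eq_0.
apply Rle_antisym. 2: apply Cmod_ge_0.
rewrite <- H0. apply jnorm_ub. exists O, g, y. repeat split; auto. lia.
Qed.

Lemma jplus_comm f1 f2 : jplus f1 f2 = jplus f2 f1.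
Proof. apply jcarrier_eq; intros x; simpl. ring. Qed.
Lemma jplus_assoc f1 f2 f3 : jplus f1 (jplus f2 f3) = jplus (jplus f1 f2) f3.
Proof. apply jcarrier_eq; intros x; simpl. ring. Qed.
Lemma jplus_zero_r f : jplus f jzero = f.
Proof. apply jcarrier_eq; intros x; simpl. ring. Qed.
Lemma jplus_opp_r f : jplus f (jopp f) = jzero.
Proof. apply jcarrier_eq; intros x; simpl. ring. Qed.
Lemma jscal_assoc c1 c2 f : jscal c1 (jscal c2 f) = jscal (Cmult c1 c2) f.
Proof. apply jcarrier_eq; intros x; simpl. ring. Qed.
Lemma jscal_one f : jscal (RtoC 1) f = f.
Proof. apply jcarrier_eq; intros x; simpl. ring. Qed.
Lemma jscal_distr_l c f1 f2 : jscal c (jplus f1 f2) = jplus (jscal c f1) (jscal c f2).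
Proof. apply jcarrier_eq; intros x; simpl. ring. Qed.
Lemma jscal_distr_r c1 c2 f : jscal (Cplus c1 c2) f = jplus (jscal c1 f) (jscal c2 f).
Proof. apply jcarrier_eq; intros x; simpl. ring. Qed.

Lemma jball_center f (eps : posreal) : jball f eps f.
Proof.
unfold jball. rewrite jplus_opp_r. apply Rle_lt_trans with 0. 2: apply cond_pos.
replace jzero with (jscal (RtoC 0) f).
2:{ apply jcarrier_eq; intros x; simpl. ring. }
eapply Rle_trans. apply jnorm_scal. rewrite Cmod_0. lra.
Qed.

Lemma jball_sym f g eps : jball f eps g -> jball g eps f.
Proof.
unfold jball. intros H. eapply Rle_lt_trans. 2: exact H.
replace (jplus f (jopp g)) with (jscal (Copp 1) (jplus g (jopp f))).
2:{ apply jcarrier_eq; intros x; simpl. ring. }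
eapply Rle_trans. apply jnorm_scal. rewrite Cmod_opp, Cmod_1. lra.
Qed.

Lemma jball_triangle f g h e1 e2 : jball f e1 g -> jball g e2 h -> jball f (e1 + e2) h.
Proof.
unfold jball. intros H1 H2.
replace (jplus h (jopp f)) with (jplus (jplus g (jopp f)) (jplus h (jopp g))).
2:{ apply jcarrier_eq; intros x; simpl. ring. }
eapply Rle_lt_trans. apply jnorm_plus. lra.
Qed.

Definition jAbelianMonoid_mixin : AbelianMonoid.mixin_of jcarrier :=
  AbelianMonoid.Mixin _ jplus jzero jplus_comm jplus_assoc jplus_zero_r.
Definition jAbelianMonoid : AbelianMonoid :=
  AbelianMonoid.Pack jcarrier jAbelianMonoid_mixin jcarrier.
Definition jAbelianGroup_mixin : AbelianGroup.mixin_of jAbelianMonoid :=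
  AbelianGroup.Mixin jAbelianMonoid jopp jplus_opp_r.
Definition jAbelianGroup : AbelianGroup :=
  AbelianGroup.Pack jcarrier
    (AbelianGroup.Class _ jAbelianMonoid_mixin jAbelianGroup_mixin) jcarrier.
Definition jModuleSpace_mixin : ModuleSpace.mixin_of C_Ring jAbelianGroup :=
  ModuleSpace.Mixin C_Ring jAbelianGroup jscal
    jscal_assoc jscal_one jscal_distr_l jscal_distr_r.
Definition jModuleSpace_class : ModuleSpace.class_of C_Ring jcarrier :=
  ModuleSpace.Class C_Ring _ (AbelianGroup.class jAbelianGroup) jModuleSpace_mixin.
Definition jUniformSpace_mixin : UniformSpace.mixin_of jcarrier :=
  UniformSpace.Mixin _ jzero jball jball_center jball_sym jball_triangle.
Definition jNormedModuleAux : NormedModuleAux C_AbsRing :=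
  NormedModuleAux.Pack C_AbsRing jcarrier
    (NormedModuleAux.Class C_AbsRing _ jModuleSpace_class jUniformSpace_mixin) jcarrier.

Lemma jnorm_compat1 (f g : jNormedModuleAux) (eps : R) :
  jnorm (minus g f) < eps -> ball f eps g.
Proof. exact (fun H => H). Qed.

Lemma jnorm_compat2 (f g : jNormedModuleAux) (eps : posreal) :
  ball f eps g -> jnorm (minus g f) < 1 * eps.
Proof. rewrite Rmult_1_l. exact (fun H => H). Qed.

Definition jNormedModule_mixin : NormedModule.mixin_of C_AbsRing jNormedModuleAux :=
  NormedModule.Mixin C_AbsRing jNormedModuleAux jnorm 1
    jnorm_plus jnorm_scal jnorm_compat1 jnorm_compat2 jnorm_eq_0.
Definition jet_space : NormedModule C_AbsRing :=
  NormedModule.Pack C_AbsRing jcarrier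
    (NormedModule.Class C_AbsRing _ (NormedModuleAux.class C_AbsRing jNormedModuleAux)
       jNormedModule_mixin) jcarrier.

Definition fn (f : jet_space) : jdom J -> C := proj1_sig f.

End JetSpace.
Arguments fn {J p} f _.

(* g is an n-th derivative of f at the points of U (meant to be open). *)
Fixpoint is_nderive {K : AbsRing} {V : NormedModule K} (U : K -> Prop)
    (f : K -> V) (n : nat) (g : K -> V) : Prop :=
  match n with
  | O => forall x, U x -> g x = f x
  | S m => exists h, is_nderive U f m h /\ forall x, U x -> is_derive h x (g x)
  end.

Section NDerive.
Context {K : AbsRing} {V : NormedModule K} (U : K -> Prop).
Context (mulC : forall n m : K, mult n m = mult m n).

Lemma is_nderive_zero n : is_nderive U (fun _ => zero : V) n (fun _ => zero).
Proof.
induction n as [|n IH]; simpl; auto.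
exists (fun _ => zero); split; auto. intros x _. apply (is_derive_const (V := V)).
Qed.

Lemma is_nderive_plus f1 f2 n (g1 g2 : K -> V) :
  is_nderive U f1 n g1 -> is_nderive U f2 n g2 ->
  is_nderive U (fun x => plus (f1 x) (f2 x)) n (fun x => plus (g1 x) (g2 x)).
Proof.
revert g1 g2; induction n as [|n IH]; simpl; intros g1 g2.
- intros H1 H2 x Hx. now rewrite H1, H2.
- intros (h1 & A1 & B1) (h2 & A2 & B2).
  exists (fun x => plus (h1 x) (h2 x)). split. now apply IH.
  intros x Hx. apply (is_derive_plus (V := V)); auto.
Qed.

Lemma is_nderive_scal c f n (g : K -> V) :
  is_nderive U f n g ->
  is_nderive U (fun x => scal c (f x)) n (fun x => scal c (g x)).
Proof.
revert g; induction n as [|n IH]; simpl; intros g.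
- intros H x Hx. now rewrite H.
- intros (h & A & B). exists (fun x => scal c (h x)). split. now apply IH.
  intros x Hx. apply is_derive_scal_r; auto.
Qed.

Lemma is_nderive_ext f1 f2 n (g : K -> V) :
  (forall x, U x -> f1 x = f2 x) -> is_nderive U f1 n g -> is_nderive U f2 n g.
Proof.
intros E. revert g; induction n as [|n IH]; simpl; intros g.
- intros H x Hx. now rewrite H, E.
- intros (h & A & B). exists h; split; auto.
Qed.

Lemma is_nderive_unique f n (g1 g2 : K -> V) :
  (forall x, U x -> locally x U) ->
  (forall (h : K -> V) x l1 l2, is_derive h x l1 -> is_derive h x l2 -> l1 = l2) ->
  is_nderive U f n g1 -> is_nderive U f n g2 -> forall x, U x -> g1 x = g2 x.
Proof.
intros Uo Du. revert g1 g2; induction n as [|n IH]; simpl; intros g1 g2.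
- intros H1 H2 x Hx. now rewrite H1, H2.
- intros (h1 & A1 & B1) (h2 & A2 & B2) x Hx.
  apply (Du h1 x). now apply B1.
  apply (is_derive_ext_loc h2). 2: now apply B2.
  generalize (Uo x Hx). apply filter_imp. intros y Hy. symmetry. now apply IH.
Qed.
End NDerive.

Lemma is_derive_C_unique (h : C -> C) z l1 l2 :
  is_derive (K := C_AbsRing) (V := C_NormedModule) h z l1 ->
  is_derive (K := C_AbsRing) (V := C_NormedModule) h z l2 -> l1 = l2.
Proof. intros H1 H2. now rewrite <- (is_C_derive_unique _ _ _ H1), <- (is_C_derive_unique _ _ _ H2). Qed.

Lemma is_derive_CR_unique (h : R -> C) t l1 l2 :
  is_derive (K := R_AbsRing) (V := C_R_NormedModule) h t l1 ->
  is_derive (K := R_AbsRing) (V := C_R_NormedModule) h t l2 -> l1 = l2.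
Proof.
intros H1 H2. apply is_derive_C_R in H1, H2. destruct H1 as [A1 B1], H2 as [A2 B2].
apply injective_projections.
rewrite <- (is_derive_unique _ _ _ A1). exact (is_derive_unique _ _ _ A2).
rewrite <- (is_derive_unique _ _ _ B1). exact (is_derive_unique _ _ _ B2).
Qed.

Definition circle (z : C) : Prop := Cmod z = 1.

Lemma circle_cis (t : R) : circle (cos t, sin t).
Proof.
unfold circle, Cmod; simpl. transitivity (sqrt 1); [f_equal | apply sqrt_1].
generalize (sin2_cos2 t). unfold Rsqr. lra.
Qed.

Definition cis (t : R) : {z : C | circle z} := exist _ (cos t, sin t) (circle_cis t).

(* g = d^l/dt^l f(e^{it}), as a function of the angle t, is continuous. *)
Definition circle_jet (f : {z : C | circle z} -> C) (l : nat) (g : R -> C) : Prop :=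
  is_nderive (K := R_AbsRing) (V := C_R_NormedModule) (fun _ => True)
    (fun t => f (cis t)) l g /\
  forall t, continuous (T := R_UniformSpace) (U := C_UniformSpace) g t.

Lemma cis_surj (z : {z : C | circle z}) : exists t, z = cis t.
Proof.
destruct z as [[x y] Hz]. unfold circle in Hz.
assert (E : x * x + y * y = 1).
{ unfold Cmod in Hz; simpl in Hz. rewrite <- (sqrt_sqrt (x * x + y * y)).
  2: nra. replace (x * x + y * y) with (x * (x * 1) + y * (y * 1)) by ring.
  rewrite Hz. ring. }
assert (X : -1 <= x <= 1) by nra.
assert (exists t, cos t = x /\ sin t = y) as (t & E1 & E2).
{ destruct (Rle_dec 0 y).
  - exists (acos x). split. now apply cos_acos. rewrite sin_acos by auto.
    apply Rsqr_inj; auto. apply sqrt_pos. rewrite Rsqr_sqrt; unfold Rsqr; nra.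
  - exists (- acos x). rewrite cos_neg, sin_neg. split. now apply cos_acos.
    rewrite sin_acos by auto.
    assert (sqrt (1 - x²) = - y); [|lra].
    apply Rsqr_inj. apply sqrt_pos. lra. rewrite Rsqr_sqrt; unfold Rsqr; nra. }
exists t. subst x y. unfold cis. f_equal. apply proof_irrelevance.
Qed.

Lemma cis_period t : cis (t + 2 * PI) = cis t.
Proof.
unfold cis. apply eq_sig_hprop. intros; apply proof_irrelevance. simpl.
now rewrite cos_plus, sin_plus, cos_2PI, sin_2PI, !Rmult_0_r, !Rmult_1_r, Rminus_0_r, Rplus_0_r.
Qed.

Lemma circle_jet_period f l g : circle_jet f l g -> forall t, g (t + 2 * PI) = g t.
Proof.
intros [H _]. revert g H; induction l as [|l IH]; simpl; intros g.
- intros H t. now rewrite !H, cis_period by auto.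
- intros (h & A & B) t. apply (is_derive_CR_unique h t).
  2: now apply B.
  apply (is_derive_ext (V := C_R_NormedModule) (fun u => h (u + 2 * PI))). intros; now apply IH.
  generalize (is_derive_comp (V := C_R_NormedModule) h (fun u => u + 2 * PI) t _ 1 (B _ I)).
  rewrite (scal_one (V := C_R_ModuleSpace)). intros X. apply X. auto_derive; auto.
Qed.

Lemma periodic_reduce (g : R -> C) : (forall t, g (t + 2 * PI) = g t) ->
  forall t, exists s, 0 <= s <= 2 * PI /\ g t = g s.
Proof.
intros Hg.
assert (P0 := PI_RGT_0).
assert (N : forall (n : nat) t, g (t + INR n * (2 * PI)) = g t).
{ induction n as [|n IH]; intros t. simpl. f_equal. ring.
  rewrite S_INR. replace (t + (INR n + 1) * (2 * PI)) with ((t + INR n * (2 * PI)) + 2 * PI) by ring.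
  now rewrite Hg. }
assert (Z' : forall (n : Z) t, g (t + IZR n * (2 * PI)) = g t).
{ intros n t. destruct (Z_le_gt_dec 0 n) as [Hn|Hn].
  - rewrite <- (Z2Nat.id n Hn), <- INR_IZR_INZ. apply N.
  - rewrite <- (N (Z.to_nat (- n)) (t + IZR n * (2 * PI))).
    rewrite INR_IZR_INZ, Z2Nat.id by lia. rewrite opp_IZR. f_equal. ring. }
intros t. exists (t + IZR (1 - up (t / (2 * PI))) * (2 * PI)). split.
2: now rewrite Z'.
rewrite minus_IZR. destruct (archimed (t / (2 * PI))) as [A B].
set (u := t / (2 * PI)) in *.
replace t with (u * (2 * PI)) by (unfold u; field; lra).
replace (u * (2 * PI) + (1 - IZR (up u)) * (2 * PI)) with ((u + 1 - IZR (up u)) * (2 * PI)) by ring.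
split; nra.
Qed.

Lemma continuous_Cmod {T : UniformSpace} (g : T -> C) (x : T) :
  continuous (U := C_UniformSpace) g x -> continuous (U := R_UniformSpace) (fun t => Cmod (g t)) x.
Proof.
intros H. apply (continuous_comp (V := C_UniformSpace) g Cmod x H).
apply (filterlim_norm (K := C_AbsRing) (V := C_NormedModule)).
Qed.

Definition circle_jets : jet_system.
Proof.
refine {| jdom := {z : C | circle z}; jpt := R; jset := fun _ => True;
  jadm := fun _ => True; jet := circle_jet |}; auto.
- exists 0; exact I.
- intros l. split. apply (is_nderive_zero (V := C_R_NormedModule)).
  intros t. apply continuous_const.
- intros f1 f2 l g1 g2 [A1 B1] [A2 B2]. split.
  + exact (is_nderive_plus (V := C_R_NormedModule) _ _ _ _ _ _ A1 A2).
  + intros t. exact (continuous_plus (V := C_R_NormedModule) g1 g2 t (B1 t) (B2 t)).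
- intros c f l g [A B]. split.
  + clear B. revert g A. induction l as [|l IH]; simpl; intros g.
    * intros H t Ht. now rewrite H.
    * intros (h & A & B). exists (fun t => Cmult c (h t)). split. now apply IH.
      intros t Ht. specialize (B t Ht). apply is_derive_C_R in B. destruct B as [B1 B2].
      apply is_derive_C_R. simpl. split.
      -- apply (is_derive_minus (V := R_NormedModule)); now apply is_derive_scal.
      -- apply (is_derive_plus (V := R_NormedModule)); now apply is_derive_scal.
  + intros t. exact (continuous_scal_r (V := C_NormedModule) c g t (B t)).
- intros f l g1 g2 [A1 _] [A2 _] t _.
  refine (is_nderive_unique (V := C_R_NormedModule) _ _ _ _ _ _ is_derive_CR_unique A1 A2 t I).
  intros; apply filter_forall; auto.
- intros f l _ _ g G. assert (Per := periodic_reduce g (circle_jet_period _ _ _ G)).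
  destruct (continuity_ab_maj (fun t => Cmod (g t)) 0 (2 * PI)) as [m Hm].
  { generalize PI_RGT_0; lra. }
  { intros c _. apply continuity_pt_filterlim. apply (continuous_Cmod g c). apply G. }
  exists (Cmod (g m)). intros t _. destruct (Per t) as [s [Hs ->]]. now apply Hm.
- intros f g [A _] H x. destruct (cis_surj x) as [t ->].
  simpl in A. rewrite <- A by auto. now apply H.
Defined.

Section Holomorphic.
Context (U : C -> Prop).

Definition ext0 (f : {z : C | U z} -> C) (z : C) : C :=
  match excluded_middle_informative (U z) with
  | left h => f (exist _ z h)
  | right _ => RtoC 0
  end.

(* U being open, the value of the extension [ext0 f] outside U is irrelevant to
   its differentiability at the points of U. *)
Definition holomorphic (f : {z : C | U z} -> C) : Prop :=
  forall z, U z -> ex_derive (K := C_AbsRing) (V := C_NormedModule) (ext0 f) z.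

(* g is the continuous extension to K of the l-th derivative of f, when U is
   dense in K. *)
Definition holo_jet (K : C -> Prop) (f : {z : C | U z} -> C) (l : nat) (g : C -> C) : Prop :=
  is_nderive (K := C_AbsRing) (V := C_NormedModule) U (ext0 f) l g /\
  continuous_on (T := C_UniformSpace) (U := C_UniformSpace) K g.

Lemma ext0_in f z (h : U z) : ext0 f z = f (exist _ z h).
Proof.
unfold ext0. destruct excluded_middle_informative; [|tauto].
do 2 f_equal. apply proof_irrelevance.
Qed.

Lemma ext0_zero z : ext0 (fun _ => RtoC 0) z = RtoC 0.
Proof. unfold ext0; now destruct excluded_middle_informative. Qed.

Lemma ext0_plus f1 f2 z : ext0 (fun x => Cplus (f1 x) (f2 x)) z = Cplus (ext0 f1 z) (ext0 f2 z).
Proof. unfold ext0; destruct excluded_middle_informative; auto. ring. Qed.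

Lemma ext0_scal c f z : ext0 (fun x => Cmult c (f x)) z = Cmult c (ext0 f z).
Proof. unfold ext0; destruct excluded_middle_informative; auto. ring. Qed.

Lemma holomorphic_zero : holomorphic (fun _ => RtoC 0).
Proof.
intros z _. exists zero. apply (is_derive_ext (V := C_NormedModule) (fun _ => RtoC 0)).
intros; symmetry; apply ext0_zero. apply (is_derive_const (V := C_NormedModule)).
Qed.

Lemma holomorphic_plus f1 f2 :
  holomorphic f1 -> holomorphic f2 -> holomorphic (fun x => Cplus (f1 x) (f2 x)).
Proof.
intros H1 H2 z Hz. destruct (H1 z Hz) as [l1 L1], (H2 z Hz) as [l2 L2].
eexists. eapply (is_derive_ext (V := C_NormedModule)).
intros; symmetry; apply ext0_plus. apply (is_derive_plus (V := C_NormedModule)); eassumption.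
Qed.

Lemma holomorphic_scal c f : holomorphic f -> holomorphic (fun x => Cmult c (f x)).
Proof.
intros H z Hz. destruct (H z Hz) as [l L].
eexists. eapply (is_derive_ext (V := C_NormedModule)).
intros; symmetry; apply ext0_scal.
apply (is_derive_scal_r (K := C_AbsRing) (V := C_NormedModule)). exact Cmult_comm. exact L.
Qed.

Context (K : C -> Prop).
Context (Uopen : forall z, U z -> locally (T := C_UniformSpace) z U).
Context (UK : forall z, U z -> K z).
Context (Udense : forall z, K z -> forall eps : posreal, exists w, U w /\ ball (M := C_UniformSpace) z eps w).

Lemma holo_jet_zero l : holo_jet K (fun _ => RtoC 0) l (fun _ => RtoC 0).
Proof.
split. 2: intros z _; apply filterlim_const.
apply (is_nderive_ext (V := C_NormedModule) U (fun _ => RtoC 0)).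
intros; symmetry; apply ext0_zero. apply (is_nderive_zero (V := C_NormedModule)).
Qed.

Lemma holo_jet_plus f1 f2 l g1 g2 : holo_jet K f1 l g1 -> holo_jet K f2 l g2 ->
  holo_jet K (fun x => Cplus (f1 x) (f2 x)) l (fun y => Cplus (g1 y) (g2 y)).
Proof.
intros [A1 B1] [A2 B2]. split.
- eapply (is_nderive_ext (V := C_NormedModule)). intros; symmetry; apply ext0_plus.
  exact (is_nderive_plus (V := C_NormedModule) U _ _ _ _ _ A1 A2).
- intros z Hz. eapply filterlim_comp_2. apply (B1 z Hz). apply (B2 z Hz).
  apply (filterlim_plus (V := C_NormedModule)).
Qed.

Lemma holo_jet_scal c f l g : holo_jet K f l g ->
  holo_jet K (fun x => Cmult c (f x)) l (fun y => Cmult c (g y)).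
Proof.
intros [A B]. split.
- eapply (is_nderive_ext (V := C_NormedModule)). intros; symmetry; apply ext0_scal.
  exact (is_nderive_scal (V := C_NormedModule) U Cmult_comm _ _ _ _ A).
- intros z Hz. eapply filterlim_comp. apply (B z Hz).
  apply (filterlim_scal_r (V := C_NormedModule) c (g z)).
Qed.

Lemma Uopen_abs z : U z -> locally (T := AbsRing_UniformSpace C_AbsRing) z U.
Proof. intros Hz. apply locally_C. now apply Uopen. Qed.

Lemma holo_jet_unique_in f l g1 g2 :
  holo_jet K f l g1 -> holo_jet K f l g2 -> forall z, U z -> g1 z = g2 z.
Proof.
intros [A1 _] [A2 _].
exact (is_nderive_unique (V := C_NormedModule) U _ _ _ _ Uopen_abs is_derive_C_unique A1 A2).
Qed.

Lemma within_proper z : K z -> ProperFilter (within U (locally (T := C_UniformSpace) z)).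
Proof.
intros Hz. constructor. 2: apply within_filter, locally_filter.
intros P [d Hd]. destruct (Udense z Hz d) as [w [Hw Bw]]. exists w. now apply Hd.
Qed.

Lemma cont_dense_eq (g1 g2 : C -> C) :
  continuous_on (T := C_UniformSpace) (U := C_UniformSpace) K g1 ->
  continuous_on (T := C_UniformSpace) (U := C_UniformSpace) K g2 ->
  (forall z, U z -> g1 z = g2 z) -> forall z, K z -> g1 z = g2 z.
Proof.
intros C1 C2 E z Hz.
assert (W : filter_le (within U (locally (T := C_UniformSpace) z)) (within K (locally (T := C_UniformSpace) z))).
{ intros P. unfold within. apply filter_imp. auto. }
apply (filterlim_locally_unique (K := C_AbsRing) (V := C_NormedModule) (FF := Proper_StrongProper _ (within_proper z Hz)) g1).
- eapply filterlim_filter_le_1. exact W. now apply C1.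
- apply (filterlim_within_ext (U := C) U g2).
  intros; symmetry; now apply E.
  eapply filterlim_filter_le_1. exact W. now apply C2.
Qed.

Lemma holo_jet_unique f l g1 g2 :
  holo_jet K f l g1 -> holo_jet K f l g2 -> forall z, K z -> g1 z = g2 z.
Proof.
intros H1 H2. apply cont_dense_eq. apply H1. apply H2.
exact (holo_jet_unique_in f l g1 g2 H1 H2).
Qed.

Lemma holo_jet_faithful f g : holo_jet K f 0 g ->
  (forall z, K z -> g z = RtoC 0) -> forall x, f x = RtoC 0.
Proof.
intros [A _] H [z Hz]. rewrite <- (ext0_in f z Hz). simpl in A.
rewrite <- A by auto. auto.
Qed.
End Holomorphic.
Arguments ext0 {U} f z.
Arguments holomorphic {U} f.
Arguments holo_jet {U} K f l g.

Lemma bounded_on_compact (K : C -> Prop) (g : C -> C) (B : R) :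
  (forall z, ~ K z -> locally (T := C_UniformSpace) z (fun w => ~ K w)) ->
  (forall z, K z -> Cmod z <= B) ->
  continuous_on (T := C_UniformSpace) (U := C_UniformSpace) K g ->
  exists M, forall z, K z -> Cmod (g z) <= M.
Proof.
intros Kc Kb Hg.
assert (Q : forall z, exists d : posreal,
  (K z -> d * (Cmod (g z) + 1) <= 1) /\
  forall w, ball (M := C_UniformSpace) z d w -> K w -> K z /\ Cmod (g w) <= Cmod (g z) + 1).
{ intros z. destruct (classic (K z)) as [Hz|Hz].
  - assert (X : within K (locally (T := C_UniformSpace) z) (fun w => Cmod (g w) <= Cmod (g z) + 1)).
    { apply (Hg z Hz (fun v => Cmod v <= Cmod (g z) + 1)).
      destruct (filterlim_norm (K := C_AbsRing) (V := C_NormedModule) (g z)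
        (fun r => r < Cmod (g z) + 1)) as [d Hd].
      { apply (open_lt (Cmod (g z) + 1)). change (Cmod (g z) < Cmod (g z) + 1). lra. }
      exists d. intros v Hv. apply Rlt_le. now apply Hd. }
    destruct X as [d Hd].
    assert (c0 : 0 < / (Cmod (g z) + 1)).
    { apply Rinv_0_lt_compat. generalize (Cmod_ge_0 (g z)); lra. }
    exists (mkposreal _ (Rmin_stable_in_posreal d (mkposreal _ c0))). simpl. split.
    + intros _. apply Rle_trans with (/ (Cmod (g z) + 1) * (Cmod (g z) + 1)).
      apply Rmult_le_compat_r. generalize (Cmod_ge_0 (g z)); lra. apply Rmin_r.
      rewrite Rinv_l. lra. generalize (Cmod_ge_0 (g z)); lra.
    + intros w Hw Kw. split; auto. apply Hd; auto.
      eapply ball_le. 2: exact Hw. apply Rmin_l.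
  - destruct (Kc z Hz) as [d Hd]. exists d. split. tauto.
    intros w Hw Kw. elim (Hd w Hw Kw). }
set (delta := fun x y : R => proj1_sig (constructive_indefinite_description _ (Q (x, y)))).
assert (Hdelta : forall x y : R, (K (x, y) -> delta x y * (Cmod (g (x, y)) + 1) <= 1) /\
  forall w, ball (M := C_UniformSpace) (x, y) (delta x y) w -> K w ->
    K (x, y) /\ Cmod (g w) <= Cmod (g (x, y)) + 1).
{ intros x y. unfold delta. now destruct constructive_indefinite_description. }
destruct (compactness_value_2d (- B) B (- B) B delta) as [d Hd].
exists (/ d). intros [x y] Hz.
assert (Bz := Kb _ Hz). assert (Rz := Rmax_Cmod (x, y)). simpl in Rz.
assert (B1 : - B <= x <= B).
{ apply Rabs_le_between. eapply Rle_trans. 2: exact Bz. eapply Rle_trans. 2: exact Rz. apply Rmax_l. }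
assert (B2 : - B <= y <= B).
{ apply Rabs_le_between. eapply Rle_trans. 2: exact Bz. eapply Rle_trans. 2: exact Rz. apply Rmax_r. }
apply NNPP. intros N. apply (Hd x y B1 B2). intros (u & v & _ & _ & U1 & U2 & D).
apply N. destruct (Hdelta u v) as [E1 E2].
destruct (E2 (x, y)) as [F1 F2]; auto.
{ split; assumption. }
eapply Rle_trans. exact F2.
specialize (E1 F1).
assert (d0 := cond_pos d). assert (c0 := Cmod_ge_0 (g (u, v))).
apply Rmult_le_reg_l with d. exact d0. rewrite Rinv_r by lra.
eapply Rle_trans. 2: exact E1. apply Rmult_le_compat_r; lra.
Qed.

Lemma Cmod_lt_locally (z : C) (r : R) : Cmod z < r ->
  locally (T := C_UniformSpace) z (fun w => Cmod w < r).
Proof.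
intros H. apply (filterlim_norm (K := C_AbsRing) (V := C_NormedModule) z (fun s => s < r)).
now apply (open_lt r).
Qed.

Lemma Cmod_gt_locally (z : C) (r : R) : r < Cmod z ->
  locally (T := C_UniformSpace) z (fun w => r < Cmod w).
Proof.
intros H. apply (filterlim_norm (K := C_AbsRing) (V := C_NormedModule) z (fun s => r < s)).
now apply (open_gt r).
Qed.

Lemma dilate_close (z : C) (eps : posreal) : exists d, 0 < d < 1 /\
  ball (M := C_UniformSpace) z eps ((1 - d) * z)%C /\
  ball (M := C_UniformSpace) z eps ((1 + d) * z)%C.
Proof.
assert (c0 := Cmod_ge_0 z). assert (e0 := cond_pos eps).
set (d := Rmin (1 / 2) (eps / 2 / (Cmod z + 1))).
assert (q0 : 0 < eps / 2 / (Cmod z + 1)) by (apply Rdiv_lt_0_compat; lra).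
assert (H : 0 < d < 1 /\ d * Cmod z < eps).
{ assert (d <= eps / 2 / (Cmod z + 1)) by apply Rmin_r.
  assert (d <= 1 / 2) by apply Rmin_l.
  assert (0 < d) by (apply Rmin_glb_lt; lra).
  repeat split; try lra.
  apply Rle_lt_trans with (eps / 2 / (Cmod z + 1) * (Cmod z + 1)). nra.
  unfold Rdiv at 1. rewrite Rmult_assoc, Rinv_l; lra. }
destruct H as [Hd He]. exists d. split; auto.
assert (X : forall c : R, Rabs c = d -> ball (M := C_UniformSpace) z eps ((1 + c) * z)%C).
{ intros c Hc. apply C_NormedModule_mixin_compat1.
  replace (minus ((1 + c) * z)%C z) with (RtoC c * z)%C.
  rewrite Cmod_mult, Cmod_R, Hc. exact He.
  change (RtoC c * z = (1 + c) * z - z)%C. ring. }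
split.
- replace (1 - d)%C with (1 + RtoC (- d))%C by (rewrite RtoC_opp; ring).
  apply X. rewrite Rabs_Ropp, Rabs_pos_eq; lra.
- apply X. rewrite Rabs_pos_eq; lra.
Qed.

Definition disc (z : C) : Prop := Cmod z < 1.
Definition closed_disc (z : C) : Prop := Cmod z <= 1.
Definition exterior (z : C) : Prop := 1 < Cmod z.
Definition closed_exterior (z : C) : Prop := 1 <= Cmod z.

Definition vanishes_at_infinity (f : {z : C | exterior z} -> C) : Prop :=
  forall eps : posreal, exists M : R, forall z : {z : C | exterior z},
    M < Cmod (proj1_sig z) -> Cmod (f z) < eps.

Lemma disc_open z : disc z -> locally (T := C_UniformSpace) z disc.
Proof. apply Cmod_lt_locally. Qed.

Lemma disc_closed_disc z : disc z -> closed_disc z.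
Proof. apply Rlt_le. Qed.

Lemma disc_dense z : closed_disc z -> forall eps : posreal,
  exists w, disc w /\ ball (M := C_UniformSpace) z eps w.
Proof.
intros Hz eps. destruct (dilate_close z eps) as (d & Hd & B & _).
exists ((1 - d) * z)%C. split; auto. unfold disc, closed_disc in *.
rewrite Cmod_mult, <- RtoC_minus, Cmod_R, Rabs_pos_eq by lra.
generalize (Cmod_ge_0 z); nra.
Qed.

Lemma exterior_open z : exterior z -> locally (T := C_UniformSpace) z exterior.
Proof. apply Cmod_gt_locally. Qed.

Lemma exterior_closed_exterior z : exterior z -> closed_exterior z.
Proof. apply Rlt_le. Qed.

Lemma exterior_dense z : closed_exterior z -> forall eps : posreal,
  exists w, exterior w /\ ball (M := C_UniformSpace) z eps w.
Proof.
intros Hz eps. destruct (dilate_close z eps) as (d & Hd & _ & B).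
exists ((1 + d) * z)%C. split; auto. unfold exterior, closed_exterior in *.
rewrite Cmod_mult, <- RtoC_plus, Cmod_R, Rabs_pos_eq by lra. nra.
Qed.

Definition disc_jets : jet_system.
Proof.
refine {| jdom := {z : C | disc z}; jpt := C; jset := closed_disc;
  jadm := holomorphic; jet := holo_jet closed_disc |}.
- exists (RtoC 0). unfold closed_disc. rewrite Cmod_0. lra.
- apply holomorphic_zero.
- apply holomorphic_plus.
- apply holomorphic_scal.
- apply holo_jet_zero.
- apply holo_jet_plus.
- apply holo_jet_scal.
- apply (holo_jet_unique _ _ disc_open disc_closed_disc disc_dense).
- intros f l _ _ g [_ G].
  apply (bounded_on_compact closed_disc g 1); auto.
  intros z Hz. apply Rnot_le_lt in Hz. generalize (Cmod_gt_locally z 1 Hz).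
  apply filter_imp. intros w Hw H. unfold closed_disc in H. lra.
- apply (holo_jet_faithful _ _ disc_closed_disc).
Defined.

Lemma annulus_bounded (g : C -> C) (B : R) :
  continuous_on (T := C_UniformSpace) (U := C_UniformSpace) closed_exterior g ->
  exists M, forall z, closed_exterior z -> Cmod z <= B -> Cmod (g z) <= M.
Proof.
intros G.
destruct (bounded_on_compact (fun z => closed_exterior z /\ Cmod z <= B) g B) as [M HM].
- intros z Hz. unfold closed_exterior in Hz.
  destruct (Rle_lt_dec 1 (Cmod z)) as [H1|H1].
  + assert (H2 : B < Cmod z) by (apply Rnot_le_lt; tauto).
    generalize (Cmod_gt_locally z B H2). apply filter_imp. intros w Hw [_ H]. lra.
  + generalize (Cmod_lt_locally z 1 H1). apply filter_imp.
    intros w Hw [H _]. unfold closed_exterior in H. lra.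
- tauto.
- apply (continuous_on_subset (T := C_UniformSpace) (U := C_UniformSpace)) with (2 := G). tauto.
- exists M. auto.
Qed.

Lemma exterior_jet_bounded (f : {z : C | exterior z} -> C) (l : nat) :
  vanishes_at_infinity f ->
  (forall k, (k <= l)%nat -> exists g, holo_jet closed_exterior f k g) ->
  forall g, holo_jet closed_exterior f l g ->
  exists M, forall z, closed_exterior z -> Cmod (g z) <= M.
Proof.
intros Hv. induction l as [|l IH]; intros Hk g G.
- destruct (Hv (mkposreal 1 Rlt_0_1)) as [B HB]. simpl in HB.
  destruct (annulus_bounded g (Rmax B 1) (proj2 G)) as [M HM].
  exists (Rmax M 1). intros z Hz.
  destruct (Rle_lt_dec (Cmod z) (Rmax B 1)) as [H|H].
  + eapply Rle_trans. now apply HM. apply Rmax_l.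
  + assert (H1 : exterior z). { unfold exterior. eapply Rle_lt_trans. 2: exact H. apply Rmax_r. }
    destruct G as [G _]. simpl in G. rewrite G, (ext0_in _ f z H1) by auto.
    eapply Rle_trans. 2: apply Rmax_r. apply Rlt_le, HB. simpl.
    eapply Rle_lt_trans. 2: exact H. apply Rmax_l.
- destruct (Hk l) as [g0 G0]. lia.
  destruct IH with (g := g0) as [M HM]; auto.
  destruct (annulus_bounded g 4 (proj2 G)) as [M' HM'].
  exists (Rmax M' (2 * M)). intros z Hz.
  destruct (Rle_lt_dec (Cmod z) 4) as [H|H].
  { eapply Rle_trans. now apply HM'. apply Rmax_l. }
  eapply Rle_trans. 2: apply Rmax_r.
  assert (near : forall w, Cmod (w - z)%C < 2 -> exterior w).
  { intros w Hw. unfold exterior.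
    assert (X := Cmod_triangle w (z - w)%C). replace (w + (z - w))%C with z in X by ring.
    rewrite <- Cmod_opp in Hw. replace (- (w - z))%C with (z - w)%C in Hw by ring. lra. }
  apply (cauchy_estimate g0 g z M).
  + intros w Hw. destruct G as [(h & A & D) _].
    apply (is_derive_ext_loc (V := C_NormedModule) h). 2: now apply D, near.
    generalize (Uopen_abs _ exterior_open w (near w Hw)). apply filter_imp.
    intros v Hv'. 
    exact (is_nderive_unique (V := C_NormedModule) exterior _ _ _ _
      (Uopen_abs _ exterior_open) is_derive_C_unique A (proj1 G0) v Hv').
  + intros w Hw. apply (continuous_continuous_on (T := C_UniformSpace) (U := C_UniformSpace) closed_exterior g).
    2: apply G.
    generalize (exterior_open w (near w Hw)). apply filter_imp. apply exterior_closed_exterior.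
  + intros w Hw. apply HM. apply exterior_closed_exterior, near. lra.
Qed.

Definition exterior_jets : jet_system.
Proof.
refine {| jdom := {z : C | exterior z}; jpt := C; jset := closed_exterior;
  jadm := fun f => holomorphic f /\ vanishes_at_infinity f;
  jet := holo_jet closed_exterior |}.
- exists (RtoC 1). unfold closed_exterior. rewrite Cmod_1. lra.
- split. apply holomorphic_zero.
  intros eps. exists 0. intros z _. rewrite Cmod_0. apply cond_pos.
- intros f1 f2 [A1 B1] [A2 B2]. split. now apply holomorphic_plus.
  intros eps. destruct (B1 (pos_div_2 eps)) as [M1 H1], (B2 (pos_div_2 eps)) as [M2 H2].
  exists (Rmax M1 M2). intros z Hz. eapply Rle_lt_trans. apply Cmod_triangle.
  rewrite <- (Rplus_half_diag eps). apply Rplus_lt_compat.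
  apply H1. eapply Rle_lt_trans. apply Rmax_l. exact Hz.
  apply H2. eapply Rle_lt_trans. apply Rmax_r. exact Hz.
- intros c f [A B]. split. now apply holomorphic_scal.
  intros eps. assert (c0 := Cmod_ge_0 c).
  assert (e0 : 0 < eps / (Cmod c + 1)). { apply Rdiv_lt_0_compat. apply cond_pos. lra. }
  destruct (B (mkposreal _ e0)) as [M H]. exists M. intros z Hz. specialize (H z Hz). simpl in H.
  rewrite Cmod_mult. assert (f0 := Cmod_ge_0 (f z)).
  replace (pos eps) with ((Cmod c + 1) * (eps / (Cmod c + 1))) by (field; lra). nra.
- apply holo_jet_zero.
- apply holo_jet_plus.
- apply holo_jet_scal.
- apply (holo_jet_unique _ _ exterior_open exterior_closed_exterior exterior_dense).
- intros f l [_ Hv]. exact (exterior_jet_bounded f l Hv).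
- apply (holo_jet_faithful _ _ exterior_closed_exterior).
Defined.

(* ApE p is A_0^p of the exterior of the closed disc. *)
Definition CpT (p : nat) : NormedModule C_AbsRing := jet_space circle_jets p.
Definition ApD (p : nat) : NormedModule C_AbsRing := jet_space disc_jets p.
Definition ApE (p : nat) : NormedModule C_AbsRing := jet_space exterior_jets p.

(* h is the restriction to the circle of the continuous extension of f to K.  This
   is the identification under which A^p(D) and A_0^p are subspaces of C^p(T). *)
Definition boundary_value {U : C -> Prop} (K : C -> Prop)
    (f : {z : C | U z} -> C) (h : {z : C | circle z} -> C) : Prop :=
  exists g : C -> C,
    continuous_on (T := C_UniformSpace) (U := C_UniformSpace) K g /\
    (forall z : {z : C | U z}, g (proj1_sig z) = f z) /\
    (forall z : {z : C | circle z}, g (proj1_sig z) = h z).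

Definition isomorphism {E F : NormedModule C_AbsRing} (Phi : E -> F) : Prop :=
  (forall x y, Phi (plus x y) = plus (Phi x) (Phi y)) /\
  (forall (c : C) x, Phi (scal c x) = scal c (Phi x)) /\
  (forall x, continuous Phi x) /\
  exists Psi : F -> E,
    (forall x, Psi (Phi x) = x) /\ (forall y, Phi (Psi y) = y) /\
    (forall y, continuous Psi y).

Definition isomorphic (E F : NormedModule C_AbsRing) : Prop :=
  exists Phi : E -> F, isomorphism Phi.

Definition Banach (E : NormedModule C_AbsRing) : Prop :=
  forall F : (E -> Prop) -> Prop, ProperFilter F -> cauchy F ->
    exists x : E, filter_le F (locally x).

(* Main.v *)
(* Phi is z d/dz + 1/2, which on the circle is -i d/dtheta + 1/2.  It multiplies the n-th Fourier
   coefficient by n + 1/2, which is never 0, so no constant has to be split off, and being a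
   differential operator it respects boundary values.  On the circle it is inverted by the
   2 pi-periodic solution of y' = i (g - y / 2); on the disc by f(z) = 2 int_0^1 g(t^2 z) dt; on the
   exterior by the substitution f(z) = m(1/z) / z, g(z) = k(1/z) / z, which turns the equation into
   z m' + m / 2 = - k on the disc.  A bound for sup |f| propagates to the derivatives because
   z f^(l+1) = g^(l) - (l + 1/2) f^(l), with Cauchy's estimate near 0 and near infinity.
   Completeness is checked for p = 0 (uniform limits of holomorphic functions are holomorphic) and
   transported by Phi.  Only complex differentiability is given in the interior, so Goursat's
   lemma is needed to know that the derivative of a holomorphic function is continuous. *)
Require Import Defs.
From Stdlib Require Import Reals.
From Coquelicot Require Import Coquelicot.
From Stdlib Require Import Lra Lia Classical ClassicalEpsilon.
From Stdlib Require Import FunctionalExtensionality ProofIrrelevance.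
(* [Reals] has its own [disc]. *)
Import Defs.
Set Bullet Behavior "Strict Subproofs".

(** Plain d/dz would not do on the exterior: the derivative of a function vanishing at infinity is
    of order z^(-2), so 1/z is never reached. The factor z restores the order. The constant 1/2 is
    chosen for symmetry: the substitution m(1/z) / z turns z d/dz + a into -(z d/dz + (1 - a)), so
    at a = 1/2 the disc and the exterior lead to the same operator, whose inverse has the integrable
    weight s^(-1/2). On the circle exp(i t / 2) changes sign over a period, so the homogeneous
    equation has no periodic solution but 0.

    Differentiating Cauchy's integral along a homotopy requires a continuous derivative, which is
    the very thing to be proved. The formula is therefore applied to a local primitive F of f, whose
    derivative f is known to be continuous; f and f' are then Cauchy integrals as well.

    Continuity in both directions comes from explicit inequalities between the norms of f and of its
    image, not from the open mapping theorem. The three isomorphisms are built separately, each from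
    its own equation, and matched afterwards through boundary values. *)

Definition C_R_CompleteNormedModule : CompleteNormedModule R_AbsRing :=
  CompleteNormedModule.Pack R_AbsRing C
    (CompleteNormedModule.Class R_AbsRing C
      (NormedModule.class R_AbsRing C_R_NormedModule) C_CompleteSpace_mixin) C.

(** * Limits, continuity and derivatives of complex-valued functions *)

Notation clim F f a := (filterlim f F (locally (T := C_UniformSpace) a)).
Notation ccont f z := (continuous (T := C_UniformSpace) (U := C_UniformSpace) f z).
Notation rcont f t := (continuous (T := R_UniformSpace) (U := C_UniformSpace) f t).
Notation cder f z l := (is_derive (K := C_AbsRing) (V := C_NormedModule) f z l).
Notation rder f t l := (is_derive (K := R_AbsRing) (V := C_R_NormedModule) f t l).
Notation is_cint f a b l := (is_RInt (V := C_R_NormedModule) f a b l).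

Lemma Cmod_minus_sym (z w : C) : Cmod (z - w)%C = Cmod (w - z)%C.
Proof. rewrite <- Cmod_opp. f_equal. ring. Qed.

Lemma Cmod_triangle_minus (a b c : C) : Cmod (a - c)%C <= Cmod (a - b)%C + Cmod (b - c)%C.
Proof. replace (a - c)%C with ((a - b) + (b - c))%C by ring. apply Cmod_triangle. Qed.

Lemma Cmod_le_plus_minus (a b : C) : Cmod a <= Cmod b + Cmod (a - b)%C.
Proof. replace a with (b + (a - b))%C at 1 by ring. apply Cmod_triangle. Qed.

Lemma locally_Cmod (z : C) (P : C -> Prop) :
  locally (T := C_UniformSpace) z P <->
  exists d : posreal, forall w, Cmod (w - z)%C < d -> P w.
Proof. rewrite locally_C. split; intros [d Hd]; exists d; exact Hd. Qed.

Lemma clim_eps {T} (F : (T -> Prop) -> Prop) {FF : Filter F} (f : T -> C) (a : C) :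
  clim F f a <-> forall eps, 0 < eps -> F (fun x => Cmod (f x - a)%C < eps).
Proof.
split.
- intros H eps he. apply (H (fun w => Cmod (w - a)%C < eps)).
  apply locally_Cmod. exists (mkposreal eps he). auto.
- intros H P HP. apply locally_Cmod in HP. destruct HP as [d Hd].
  unfold filtermap. generalize (H d (cond_pos d)). apply filter_imp. intros x. apply Hd.
Qed.

Section Limits.
Context {T : Type} (F : (T -> Prop) -> Prop) {FF : Filter F}.

Lemma clim_plus (f g : T -> C) a b : clim F f a -> clim F g b ->
  clim F (fun x => f x + g x)%C (a + b)%C.
Proof.
intros Hf Hg. eapply filterlim_comp_2. exact Hf. exact Hg.
apply (filterlim_plus (V := C_NormedModule)).
Qed.

Lemma clim_scal c (f : T -> C) a : clim F f a -> clim F (fun x => c * f x)%C (c * a)%C.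
Proof. intros Hf. eapply filterlim_comp. exact Hf. apply (filterlim_scal_r (V := C_NormedModule) c a). Qed.

Lemma clim_const c : clim F (fun _ => c) c.
Proof. apply filterlim_const. Qed.

Lemma clim_minus (f g : T -> C) a b : clim F f a -> clim F g b ->
  clim F (fun x => f x - g x)%C (a - b)%C.
Proof.
intros Hf Hg. eapply filterlim_ext. 2:{ replace (a - b)%C with (a + (- 1) * b)%C by ring.
  apply clim_plus. exact Hf. apply (clim_scal (- 1)%C). exact Hg. }
intros x. simpl. ring.
Qed.

Lemma clim_mult (f g : T -> C) a b : clim F f a -> clim F g b ->
  clim F (fun x => f x * g x)%C (a * b)%C.
Proof.
intros Hf Hg. apply clim_eps; auto. intros eps he.
assert (A := Cmod_ge_0 a). assert (B := Cmod_ge_0 b).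
set (e := Rmin 1 (eps / (Cmod a + Cmod b + 2))).
assert (he' : 0 < e). { apply Rmin_glb_lt. lra. apply Rdiv_lt_0_compat; lra. }
generalize (filter_and _ _ (proj1 (clim_eps F f a) Hf e he') (proj1 (clim_eps F g b) Hg e he')).
apply filter_imp. intros x [X Y].
replace (f x * g x - a * b)%C with ((f x - a) * (g x - b) + (a * (g x - b) + (f x - a) * b))%C by ring.
eapply Rle_lt_trans. apply Cmod_triangle. eapply Rle_lt_trans. apply Rplus_le_compat_l, Cmod_triangle.
rewrite !Cmod_mult.
assert (e1 : e <= 1) by apply Rmin_l.
assert (e2 : e * (Cmod a + Cmod b + 2) <= eps).
{ apply Rle_trans with (eps / (Cmod a + Cmod b + 2) * (Cmod a + Cmod b + 2)).
  apply Rmult_le_compat_r. lra. apply Rmin_r. unfold Rdiv. rewrite Rmult_assoc, Rinv_l; lra. }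
generalize (Cmod_ge_0 (f x - a)) (Cmod_ge_0 (g x - b)). nra.
Qed.

Lemma clim_inv (f : T -> C) a : clim F f a -> a <> RtoC 0 -> clim F (fun x => / f x)%C (/ a)%C.
Proof.
intros Hf Ha. apply clim_eps; auto. intros eps he.
apply Cmod_gt_0 in Ha.
set (A := Cmod a) in *.
set (e := Rmin (A / 2) (eps * A * A / 4)).
assert (he' : 0 < e). { apply Rmin_glb_lt. lra. repeat apply Rmult_lt_0_compat; lra. }
generalize (proj1 (clim_eps F f a) Hf e he').
apply filter_imp. intros x X.
assert (e1 : e <= A / 2) by apply Rmin_l.
assert (e2 : e <= eps * A * A / 4) by apply Rmin_r.
assert (B : A / 2 < Cmod (f x)).
{ generalize (Cmod_le_plus_minus a (f x)). rewrite Cmod_minus_sym. fold A. lra. }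
assert (N1 : f x <> RtoC 0). { apply Cmod_gt_0. lra. }
assert (N2 : a <> RtoC 0). { apply Cmod_gt_0. fold A; lra. }
replace (/ f x - / a)%C with ((a - f x) / (f x * a))%C by (field; auto).
rewrite Cmod_div. 2: now apply Cmult_neq_0.
rewrite Cmod_mult, Cmod_minus_sym. fold A.
apply Rmult_lt_reg_r with (Cmod (f x) * A). nra.
unfold Rdiv. rewrite Rmult_assoc, Rinv_l by nra.
assert (eps * A * (A / 2) < eps * A * Cmod (f x)). { apply Rmult_lt_compat_l; nra. }
nra.
Qed.

Lemma clim_div (f g : T -> C) a b : clim F f a -> clim F g b -> b <> RtoC 0 ->
  clim F (fun x => f x / g x)%C (a / b)%C.
Proof. intros Hf Hg Hb. apply clim_mult; auto. now apply clim_inv. Qed.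

Lemma clim_RtoC (f : T -> R) (a : R) : filterlim f F (locally a) -> clim F (fun x => RtoC (f x)) (RtoC a).
Proof.
intros Hf. apply clim_eps; auto. intros eps he.
generalize (proj1 (filterlim_locally f a) Hf (mkposreal eps he)). apply filter_imp.
intros x Hx. rewrite <- RtoC_minus, Cmod_R. exact Hx.
Qed.
End Limits.

Lemma clim_cis {T} (F : (T -> Prop) -> Prop) {FF : Filter F} (f : T -> R) a :
  filterlim f F (locally a) -> clim F (fun x => (cos (f x), sin (f x))) (cos a, sin a).
Proof.
intros Hf.
assert (X : rcont (fun u => (cos u, sin u)) a).
{ apply continuous_C; simpl. apply continuous_cos. apply continuous_sin. }
exact (filterlim_comp _ _ _ f (fun u => (cos u, sin u) : C) _ _ _ Hf X).
Qed.

Section Continuity.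
Context {T : UniformSpace} (f g : T -> C) (x : T).
Notation cont f := (continuous (U := C_UniformSpace) f x).

Lemma Ccont_plus : cont f -> cont g -> cont (fun y => f y + g y)%C.
Proof. apply (clim_plus (locally x)). Qed.
Lemma Ccont_minus : cont f -> cont g -> cont (fun y => f y - g y)%C.
Proof. apply (clim_minus (locally x)). Qed.
Lemma Ccont_mult : cont f -> cont g -> cont (fun y => f y * g y)%C.
Proof. apply (clim_mult (locally x)). Qed.
Lemma Ccont_scal c : cont f -> cont (fun y => c * f y)%C.
Proof. apply (clim_scal (locally x)). Qed.
Lemma Ccont_div : cont f -> cont g -> g x <> RtoC 0 -> cont (fun y => f y / g y)%C.
Proof. apply (clim_div (locally x)). Qed.
Lemma Ccont_inv : cont f -> f x <> RtoC 0 -> cont (fun y => / f y)%C.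
Proof. apply (clim_inv (locally x)). Qed.
Lemma Ccont_const c : cont (fun _ => c).
Proof. apply continuous_const. Qed.
Lemma Ccont_comp (h : C -> C) : cont f -> ccont h (f x) -> cont (fun y => h (f y)).
Proof. apply (continuous_comp f h x). Qed.
Lemma Ccont_RtoC (h : T -> R) : continuous h x -> cont (fun y => RtoC (h y)).
Proof. apply (clim_RtoC (locally x)). Qed.
Lemma Ccont_cis (h : T -> R) : continuous h x -> cont (fun y => (cos (h y), sin (h y))).
Proof. apply (clim_cis (locally x)). Qed.
End Continuity.

(* Caratheodory's form of differentiability, from which the product and chain rules are algebra. *)
Lemma cder_slope (f : C -> C) (z l : C) :
  cder f z l <-> exists q, ccont q z /\ q z = l /\ forall w, (f w = f z + (w - z) * q w)%C.
Proof.
split.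
- intros H.
  exists (fun w => if Ceq_dec w z then l else ((f w - f z) / (w - z))%C).
  split; [|split].
  + destruct (Ceq_dec z z) as [_|N]; [|now elim N].
    unfold continuous. destruct (Ceq_dec z z) as [_|N]; [|now elim N].
    apply clim_eps. apply locally_filter. intros eps he.
    destruct (is_derive_C_eps f z l H (pos_div_2 (mkposreal eps he))) as [d Hd].
    apply locally_Cmod. exists d. intros w Hw. specialize (Hd w Hw). simpl in Hd.
    destruct (Ceq_dec w z) as [E|E].
    { replace (l - l)%C with (RtoC 0) by ring. now rewrite Cmod_0. }
    assert (N : (w - z)%C <> RtoC 0). { intros X. apply E. replace w with (w - z + z)%C by ring. rewrite X. ring. }
    replace ((f w - f z) / (w - z) - l)%C with ((f w - f z - (w - z) * l) / (w - z))%C by (field; auto).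
    rewrite Cmod_div by auto. apply Cmod_gt_0 in N.
    apply Rmult_lt_reg_r with (Cmod (w - z)); auto.
    unfold Rdiv. rewrite Rmult_assoc, Rinv_l by lra. nra.
  + now destruct (Ceq_dec z z).
  + intros w. destruct (Ceq_dec w z) as [->|E]. ring.
    field. intros X. apply E. replace w with (w - z + z)%C by ring. rewrite X. ring.
- intros (q & Hq & <- & E). split. apply (is_linear_scal_l (K := C_AbsRing) (V := C_NormedModule)).
  intros x Hx.
  assert (Ex : z = x) by exact (is_filter_lim_locally_unique (V := AbsRing_NormedModule C_AbsRing) z x Hx).
  subst x. intros eps.
  apply (locally_C z). unfold continuous in Hq.
  generalize (proj1 (clim_eps _ _ _) Hq eps (cond_pos eps)).
  apply filter_imp. intros w Hw.
  change (Cmod (f w - f z - (w - z) * q z)%C <= eps * Cmod (w - z)%C).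
  rewrite (E w). replace (f z + (w - z) * q w - f z - (w - z) * q z)%C with ((w - z) * (q w - q z))%C by ring.
  rewrite Cmod_mult. generalize (Cmod_ge_0 (w - z)). nra.
Qed.

Lemma cder_eps (f : C -> C) (z l : C) :
  (forall eps, 0 < eps -> exists d : posreal, forall w, Cmod (w - z)%C < d ->
    Cmod (f w - f z - (w - z) * l)%C <= eps * Cmod (w - z)%C) -> cder f z l.
Proof.
intros H. split. apply (is_linear_scal_l (K := C_AbsRing) (V := C_NormedModule)).
intros x Hx.
assert (Ex : z = x) by exact (is_filter_lim_locally_unique (V := AbsRing_NormedModule C_AbsRing) z x Hx).
subst x. intros eps. destruct (H eps (cond_pos eps)) as [d Hd].
exists d. intros w Hw. exact (Hd w Hw).
Qed.

Lemma cder_cont f z l : cder f z l -> ccont f z.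
Proof. apply continuous_is_derive_C. Qed.

Lemma cder_eq (f : C -> C) (z l l' : C) : cder f z l -> l = l' -> cder f z l'.
Proof. now intros H <-. Qed.

Lemma cder_ext_loc (f g : C -> C) (z l : C) : locally (T := C_UniformSpace) z (fun w => f w = g w) -> cder f z l -> cder g z l.
Proof. intros E. apply (is_derive_ext_loc (V := C_NormedModule)). now apply locally_C. Qed.

Lemma cder_const c z : cder (fun _ => c) z (RtoC 0).
Proof. apply (is_derive_const (V := C_NormedModule)). Qed.

Lemma cder_id z : cder (fun w => w) z (RtoC 1).
Proof.
apply cder_slope. exists (fun _ => RtoC 1). repeat split. apply continuous_const.
intros w; ring.
Qed.

Lemma cder_plus f g z a b : cder f z a -> cder g z b -> cder (fun w => f w + g w)%C z (a + b)%C.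
Proof. apply (is_derive_plus (V := C_NormedModule)). Qed.

Lemma cder_minus f g z a b : cder f z a -> cder g z b -> cder (fun w => f w - g w)%C z (a - b)%C.
Proof. apply (is_derive_minus (V := C_NormedModule)). Qed.

Lemma cder_scal c f z a : cder f z a -> cder (fun w => c * f w)%C z (c * a)%C.
Proof. apply (is_derive_scal_r (V := C_NormedModule)). exact Cmult_comm. Qed.

Lemma cder_mult f g z a b : cder f z a -> cder g z b ->
  cder (fun w => f w * g w)%C z (a * g z + f z * b)%C.
Proof.
intros Hf Hg. assert (Cg := cder_cont _ _ _ Hg).
apply cder_slope in Hf, Hg. destruct Hf as (p & P1 & P2 & P3), Hg as (q & Q1 & Q2 & Q3).
apply cder_slope. exists (fun w => p w * g w + f z * q w)%C. split; [|split].
- apply clim_plus. apply locally_filter. apply clim_mult; auto; apply locally_filter.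
  apply clim_scal; auto; apply locally_filter.
- now rewrite P2, Q2.
- intros w. rewrite (P3 w). transitivity (f z * g w + (w - z) * p w * g w)%C. ring.
  rewrite (Q3 w) at 1. ring.
Qed.

Lemma cder_comp f g z a b : cder f z a -> cder g (f z) b -> cder (fun w => g (f w)) z (a * b)%C.
Proof.
intros Hf Hg. assert (Cf := cder_cont _ _ _ Hf).
apply cder_slope in Hf, Hg. destruct Hf as (p & P1 & P2 & P3), Hg as (q & Q1 & Q2 & Q3).
apply cder_slope. exists (fun w => p w * q (f w))%C. split; [|split].
- apply clim_mult; auto. apply locally_filter.
  eapply filterlim_comp. exact Cf. exact Q1.
- now rewrite P2, Q2.
- intros w. rewrite (Q3 (f w)). rewrite (P3 w) at 1. ring.
Qed.

Lemma cder_inv z : z <> RtoC 0 -> cder (fun w => / w)%C z (- / (z * z))%C.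
Proof.
(* Caratheodory's identity has to hold for every [w], also for [w = 0], where [/ w] is only a
   default value. Replacing that value by an affine one does not change the function near [z] and
   makes the identity a matter of [field]. *)
intros Hz. apply (cder_ext_loc (fun w => if Ceq_dec w 0 then (/ z - (w - z) / (z * z))%C else (/ w)%C)).
{ apply Cmod_gt_0 in Hz. generalize (Cmod_gt_locally z 0 Hz). apply filter_imp.
  intros w Hw. destruct (Ceq_dec w 0); auto. apply Cmod_gt_0 in Hw. tauto. }
apply cder_slope. exists (fun w => if Ceq_dec w 0 then (- / (z * z))%C else (- / (w * z))%C).
destruct (Ceq_dec z 0) as [|_]; [tauto|].
split; [|split; auto].
- unfold continuous. destruct (Ceq_dec z 0) as [|_]; [tauto|].
  apply filterlim_ext_loc with (fun w => - 1 * / (w * z))%C.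
  { assert (N := Hz). apply Cmod_gt_0 in N. generalize (Cmod_gt_locally z 0 N). apply filter_imp.
    intros w Hw. apply Cmod_gt_0 in Hw. destruct (Ceq_dec w 0). tauto. ring. }
  replace (- / (z * z))%C with (- 1 * / (z * z))%C by ring.
  apply (clim_scal _ (- 1)%C). apply clim_inv. apply locally_filter.
  apply (clim_mult _ (fun w : C => w)). apply filterlim_id. apply clim_const. apply locally_filter.
  now apply Cmult_neq_0.
- intros w. destruct (Ceq_dec w 0) as [->|]; field; auto.
Qed.

Lemma rder_eq (f : R -> C) t (l l' : C) : rder f t l -> l = l' -> rder f t l'.
Proof. now intros H <-. Qed.

Lemma rder_cder f t l : cder f (RtoC t) l -> rder (fun u => f (RtoC u)) t l.
Proof.
intros H. eapply rder_eq. apply (C_derive_comp_R f RtoC t l 1). exact H.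
apply is_derive_C_R; split; simpl. apply (is_derive_id (K := R_AbsRing)). apply (is_derive_const (V := R_NormedModule)).
apply Cmult_1_l.
Qed.

Lemma rder_cont f t l : rder f t l -> rcont f t.
Proof. intros H. apply (ex_derive_continuous (V := C_R_NormedModule)). eexists; exact H. Qed.

Lemma rder_ext (f g : R -> C) t (l : C) : (forall w, f w = g w) -> rder f t l -> rder g t l.
Proof. intros E. exact (is_derive_ext (V := C_R_NormedModule) f g t l E). Qed.

Lemma rder_const c t : rder (fun _ => c) t (RtoC 0).
Proof. apply (is_derive_const (V := C_R_NormedModule)). Qed.

Lemma rder_plus f g z a b : rder f z a -> rder g z b -> rder (fun w => f w + g w)%C z (a + b)%C.
Proof. apply (is_derive_plus (V := C_R_NormedModule)). Qed.

Lemma rder_minus f g z a b : rder f z a -> rder g z b -> rder (fun w => f w - g w)%C z (a - b)%C.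
Proof. apply (is_derive_minus (V := C_R_NormedModule)). Qed.

Lemma rder_mult f g t a b : rder f t a -> rder g t b ->
  rder (fun w => f w * g w)%C t (a * g t + f t * b)%C.
Proof.
intros Hf Hg. apply is_derive_C_R in Hf, Hg. destruct Hf as [F1 F2], Hg as [G1 G2].
apply is_derive_C_R. simpl. split.
- replace (fst a * fst (g t) - snd a * snd (g t) + (fst (f t) * fst b - snd (f t) * snd b))
    with ((fst a * fst (g t) + fst (f t) * fst b) - (snd a * snd (g t) + snd (f t) * snd b)) by ring.
  apply (is_derive_minus (V := R_NormedModule)); apply (is_derive_mult (K := R_AbsRing)); auto; intros; apply Rmult_comm.
- replace (fst a * snd (g t) + snd a * fst (g t) + (fst (f t) * snd b + snd (f t) * fst b))
    with ((fst a * snd (g t) + fst (f t) * snd b) + (snd a * fst (g t) + snd (f t) * fst b)) by ring.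
  apply (is_derive_plus (V := R_NormedModule)); apply (is_derive_mult (K := R_AbsRing)); auto; intros; apply Rmult_comm.
Qed.

Lemma rder_scal c f t a : rder f t a -> rder (fun w => c * f w)%C t (c * a)%C.
Proof.
intros H. eapply rder_eq. apply (rder_mult (fun _ => c)). apply rder_const. exact H. simpl; ring.
Qed.

Lemma rder_RtoC (f : R -> R) t l : is_derive f t l -> rder (fun u => RtoC (f u)) t (RtoC l).
Proof.
intros H. apply is_derive_C_R; split; simpl. exact H. apply (is_derive_const (V := R_NormedModule)).
Qed.

Lemma rder_cis t : rder (fun u => (cos u, sin u)) t (Ci * (cos t, sin t))%C.
Proof.
apply is_derive_C_R; split; simpl; auto_derive; auto; ring.
Qed.

Lemma rder_comp (q : C -> C) (g : R -> C) t (d v l : C) :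
  cder q (g t) d -> rder g t v -> l = (v * d)%C -> rder (fun u => q (g u)) t l.
Proof. intros Hq Hg ->. now apply C_derive_comp_R. Qed.

(** * Mean value inequalities *)

Lemma unit_multiplier (w : C) : exists c, Cmod c = 1 /\ (c * w)%C = RtoC (Cmod w).
Proof.
destruct (Ceq_dec w 0) as [->|N].
- exists (RtoC 1). rewrite Cmod_1, Cmod_0. split; auto. ring.
- exists (Cconj w / RtoC (Cmod w))%C. assert (P := N). apply Cmod_gt_0 in P.
  assert (Y : RtoC (Cmod w) <> RtoC 0). { intros X. apply RtoC_inj in X. lra. }
  split.
  + rewrite Cmod_div, Cmod_conj, Cmod_R, Rabs_pos_eq by (auto; lra). field. lra.
  + transitivity ((w * Cconj w) / RtoC (Cmod w))%C. field; exact Y.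
    rewrite <- Cmod2_conj, RtoC_pow. field. exact Y.
Qed.

Lemma re_le_Cmod (z : C) : fst z <= Cmod z.
Proof. eapply Rle_trans. apply Rle_abs. eapply Rle_trans. apply Rmax_l. apply Rmax_Cmod. Qed.

(** There is no intermediate point for complex values. A unit [c] rotates [h b - h a] onto its
    modulus, and Lagrange's theorem is applied to the real part of [c * h]. *)
Lemma mean_value_C (h dh : R -> C) (a b M : R) : a <= b ->
  (forall t, a < t < b -> rder h t (dh t)) ->
  (forall t, a <= t <= b -> rcont h t) ->
  (forall t, a < t < b -> Cmod (dh t) <= M) ->
  Cmod (h b - h a)%C <= M * (b - a).
Proof.
intros Hab D Ch B.
destruct Hab as [Hab| <-].
2:{ replace (h a - h a)%C with (RtoC 0) by ring. rewrite Cmod_0. lra. }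
destruct (unit_multiplier (h b - h a)%C) as (c & c1 & E).
assert (M0 : 0 <= M). { eapply Rle_trans. apply Cmod_ge_0. apply (B ((a + b) / 2)). lra. }
destruct (MVT_cor2 (fun t => t) (fun _ => 1) a b) as (x0 & _ & _); auto.
{ intros; apply derivable_pt_lim_id. }
assert (D' : forall t, a < t < b -> is_derive (fun t => fst (c * h t)%C) t (fst (c * dh t)%C)).
{ intros t Ht. assert (X := rder_scal c h t (dh t) (D t Ht)). now apply is_derive_C_R in X. }
assert (C' : forall t, a <= t <= b -> continuous (fun t => fst (c * h t)%C) t).
{ intros t Ht. apply (continuous_fst_C (fun t => (c * h t)%C)). apply clim_scal. now apply Ch. }
assert (pr1 : forall x, a < x < b -> derivable_pt (fun t => fst (c * h t)%C) x).
{ intros x Hx. exists (fst (c * dh x)%C). apply is_derive_Reals. now apply D'. }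
assert (pr2 : forall x, a < x < b -> derivable_pt id x).
{ intros x Hx. apply derivable_pt_id. }
destruct (MVT (fun t => fst (c * h t)%C) id a b pr1 pr2 Hab) as (x & Hx & E').
{ intros t Ht. apply continuity_pt_filterlim. now apply C'. }
{ intros t Ht. apply derivable_continuous_pt, derivable_pt_id. }
assert (E1 : derive_pt (fun t => fst (c * h t)%C) x (pr1 x Hx) = fst (c * dh x)%C).
{ apply derive_pt_eq_0. apply is_derive_Reals. now apply D'. }
assert (E2 : derive_pt id x (pr2 x Hx) = 1).
{ apply derive_pt_eq_0. apply derivable_pt_lim_id. }
rewrite E1, E2 in E'. unfold id in E'.
replace (Cmod (h b - h a)) with (fst (c * (h b - h a))%C) by now rewrite E.
replace (fst (c * (h b - h a))%C) with (fst (c * h b)%C - fst (c * h a)%C) by (simpl; ring).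
assert (fst (c * dh x)%C <= M).
{ eapply Rle_trans. apply re_le_Cmod. rewrite Cmod_mult, c1, Rmult_1_l. now apply B. }
nra.
Qed.

Definition segment (a b : C) (t : R) : C := (a + RtoC t * (b - a))%C.

Lemma segment_0 a b : segment a b 0 = a.
Proof. unfold segment. ring. Qed.
Lemma segment_1 a b : segment a b 1 = b.
Proof. unfold segment. ring. Qed.

Lemma rder_segment a b t : rder (segment a b) t (b - a)%C.
Proof.
eapply rder_eq. apply rder_plus. apply rder_const. apply rder_mult.
apply rder_RtoC. apply (is_derive_id (K := R_AbsRing)). apply rder_const.
unfold one; simpl. ring.
Qed.

Lemma segment_dist a b t : 0 <= t <= 1 -> Cmod (segment a b t - a)%C <= Cmod (b - a)%C.
Proof.
intros Ht. unfold segment. replace (a + RtoC t * (b - a) - a)%C with (RtoC t * (b - a))%C by ring.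
rewrite Cmod_mult, Cmod_R, Rabs_pos_eq by lra. generalize (Cmod_ge_0 (b - a)). nra.
Qed.

Lemma segment_in_disc c r a b t : 0 <= t <= 1 -> Cmod (a - c)%C < r -> Cmod (b - c)%C < r ->
  Cmod (segment a b t - c)%C < r.
Proof.
intros Ht Ha Hb. unfold segment.
replace (a + RtoC t * (b - a) - c)%C with (RtoC (1 - t) * (a - c) + RtoC t * (b - c))%C
  by (rewrite RtoC_minus; ring).
eapply Rle_lt_trans. apply Cmod_triangle.
rewrite !Cmod_mult, !Cmod_R, !Rabs_pos_eq by lra.
destruct (Rle_lt_dec t 0). assert (t = 0) by lra. subst t. lra. nra.
Qed.

(** The mean value inequality for [f z - z * l] along the segment. With [l] the derivative at [a] it
    bounds the first-order remainder; with [l = 0] it is a Lipschitz bound. *)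
Lemma mean_value_segment (f df : C -> C) (a b l : C) (M : R) :
  (forall t, 0 <= t <= 1 -> cder f (segment a b t) (df (segment a b t))) ->
  (forall t, 0 <= t <= 1 -> Cmod (df (segment a b t) - l)%C <= M) ->
  Cmod (f b - f a - (b - a) * l)%C <= M * Cmod (b - a)%C.
Proof.
intros D B.
set (h := fun t => (f (segment a b t) - (segment a b t) * l)%C).
assert (Dh : forall t, 0 <= t <= 1 -> rder h t ((b - a) * (df (segment a b t) - l))%C).
{ intros t Ht. eapply rder_eq. apply rder_minus.
  apply C_derive_comp_R. now apply D. apply rder_segment.
  apply rder_mult. apply rder_segment. apply rder_const. simpl. ring. }
assert (X := mean_value_C h (fun t => (b - a) * (df (segment a b t) - l))%C 0 1 (M * Cmod (b - a)%C)).
unfold h in X at 3 4. rewrite segment_0, segment_1 in X.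
replace (f b - f a - (b - a) * l)%C with (f b - b * l - (f a - a * l))%C by ring.
replace (M * Cmod (b - a)%C) with (M * Cmod (b - a)%C * (1 - 0)) by ring. apply X.
- lra.
- intros t Ht. apply Dh. lra.
- intros t Ht. eapply rder_cont. now apply Dh.
- intros t Ht. rewrite Cmod_mult, Rmult_comm. apply Rmult_le_compat_r. apply Cmod_ge_0. apply B. lra.
Qed.

(** * Parametric complex integrals *)

Definition cint (f : R -> C) (a b : R) : C := RInt (V := C_R_CompleteNormedModule) f a b.

Lemma is_cint_unique f a b l : is_cint f a b l -> cint f a b = l.
Proof. intros H. apply (is_RInt_unique (V := C_R_CompleteNormedModule)). exact H. Qed.

Lemma cint_correct f a b : a <= b -> (forall t, a <= t <= b -> rcont f t) -> is_cint f a b (cint f a b).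
Proof.
intros Hab H. apply (RInt_correct (V := C_R_CompleteNormedModule)).
apply (ex_RInt_continuous (V := C_R_CompleteNormedModule)).
intros t Ht. apply H. rewrite Rmin_left, Rmax_right in Ht; auto.
Qed.

Lemma is_cint_eq (f : R -> C) a b (l l' : C) : is_cint f a b l -> l = l' -> is_cint f a b l'.
Proof. now intros H <-. Qed.

Lemma is_cint_plus f g a b l m : is_cint f a b l -> is_cint g a b m ->
  is_cint (fun t => f t + g t)%C a b (l + m)%C.
Proof. apply (is_RInt_plus (V := C_R_NormedModule)). Qed.

Lemma is_cint_minus f g a b l m : is_cint f a b l -> is_cint g a b m ->
  is_cint (fun t => f t - g t)%C a b (l - m)%C.
Proof. apply (is_RInt_minus (V := C_R_NormedModule)). Qed.

(** Integration is linear over the reals only, so a complex factor is treated on real and imaginary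
    parts. *)
Lemma is_cint_scal c f a b l : is_cint f a b l -> is_cint (fun t => c * f t)%C a b (c * l)%C.
Proof.
intros H.
assert (H1 := is_RInt_fct_extend_fst (U := R_NormedModule) (V := R_NormedModule) f a b _ H).
assert (H2 := is_RInt_fct_extend_snd (U := R_NormedModule) (V := R_NormedModule) f a b _ H).
apply (is_RInt_fct_extend_pair (U := R_NormedModule) (V := R_NormedModule)); simpl.
- apply (is_RInt_minus (V := R_NormedModule)); now apply (is_RInt_scal (V := R_NormedModule)).
- apply (is_RInt_plus (V := R_NormedModule)); now apply (is_RInt_scal (V := R_NormedModule)).
Qed.

Lemma is_cint_ext (f g : R -> C) a b (l : C) : a <= b -> (forall t, a < t < b -> f t = g t) -> is_cint f a b l -> is_cint g a b l.
Proof.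
intros Hab E. apply (is_RInt_ext (V := C_R_NormedModule)).
intros t. rewrite Rmin_left, Rmax_right by auto. apply E.
Qed.

Lemma cint_ext (f g : R -> C) a b : a <= b -> (forall t, a < t < b -> f t = g t) -> cint f a b = cint g a b.
Proof.
intros Hab E. apply (RInt_ext (V := C_R_CompleteNormedModule)).
intros t. rewrite Rmin_left, Rmax_right by auto. apply E.
Qed.

Lemma is_cint_bound f a b l M : a <= b -> (forall t, a <= t <= b -> Cmod (f t) <= M) ->
  is_cint f a b l -> Cmod l <= (b - a) * M.
Proof.
intros Hab B H. rewrite Cmod_norm.
apply (norm_RInt_le_const (V := C_R_NormedModule) f a b l M Hab); auto.
intros t Ht. rewrite <- Cmod_norm. now apply B.
Qed.

Lemma cint_derive F f a b : a <= b -> (forall t, a <= t <= b -> rder F t (f t)) ->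
  (forall t, a <= t <= b -> rcont f t) -> is_cint f a b (F b - F a)%C.
Proof.
intros Hab D Cf. apply (is_RInt_derive (V := C_R_CompleteNormedModule)).
- intros t. rewrite Rmin_left, Rmax_right by auto. apply D.
- intros t. rewrite Rmin_left, Rmax_right by auto. apply Cf.
Qed.

Lemma rder_cint_upper (f : R -> C) a t : (forall t, rcont f t) -> rder (fun u => cint f a u) t (f t).
Proof.
intros Cf. apply (is_derive_RInt (V := C_R_NormedModule) f (fun u => cint f a u) a t).
2: apply Cf.
apply filter_forall. intros u. apply (RInt_correct (V := C_R_CompleteNormedModule)).
apply (ex_RInt_continuous (V := C_R_CompleteNormedModule)). intros; apply Cf.
Qed.

Notation RC := (prod_UniformSpace R_UniformSpace C_UniformSpace).
Notation kcont k t z := (continuous (T := RC) (U := C_UniformSpace) (fun p => k (fst p) (snd p)) (t, z)).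

Lemma locally_RC (t : R) (z : C) (P : R * C -> Prop) : locally (T := RC) (t, z) P <->
  exists d : posreal, forall s w, Rabs (s - t) < d -> Cmod (w - z)%C < d -> P (s, w).
Proof.
split.
- intros [d Hd].
  destruct (proj1 (locally_Cmod z (ball (M := C_UniformSpace) z d))) as [e He].
  { exists d; auto. }
  exists (mkposreal _ (Rmin_stable_in_posreal d e)). simpl. intros s w Hs Hw.
  apply Hd. split; simpl. eapply Rlt_le_trans. exact Hs. apply Rmin_l.
  apply He. eapply Rlt_le_trans. exact Hw. apply Rmin_r.
- intros [d Hd].
  destruct (proj2 (locally_Cmod z (fun w => Cmod (w - z)%C < d))) as [e He].
  { exists d; auto. }
  exists (mkposreal _ (Rmin_stable_in_posreal d e)). intros [s w] [Hs Hw]. simpl in Hs, Hw.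
  apply Hd. eapply Rlt_le_trans. exact Hs. apply Rmin_l.
  apply He. eapply ball_le. 2: exact Hw. apply Rmin_r.
Qed.

Lemma kcont_slice (k : R -> C -> C) t z : kcont k t z -> rcont (fun t => k t z) t.
Proof.
intros H. apply clim_eps. apply locally_filter. intros eps he.
generalize (proj1 (clim_eps _ _ _) H eps he). intros X. apply locally_RC in X.
destruct X as [d Hd]. exists d. intros s Hs. apply (Hd s z). exact Hs.
replace (z - z)%C with (RtoC 0) by ring. rewrite Cmod_0. apply cond_pos.
Qed.

(** Compactness of [[a, b]] turns continuity at each [(t, z)] into an estimate uniform in [t]. Both
    [(t, w)] and [(t, z)] are compared with a common centre [(s, z)], whence [eps / 2]. *)
Lemma tube (k : R -> C -> C) (a b : R) (z : C) :
  (forall t, a <= t <= b -> kcont k t z) ->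
  forall eps, 0 < eps -> exists d : posreal, forall t w, a <= t <= b -> Cmod (w - z)%C < d ->
    Cmod (k t w - k t z)%C < eps.
Proof.
intros H eps he.
assert (Q : forall t, exists d : posreal, a <= t <= b -> forall s w, Rabs (s - t) < d -> Cmod (w - z)%C < d ->
  Cmod (k s w - k t z)%C < eps / 2).
{ intros t. destruct (classic (a <= t <= b)) as [Ht|Ht].
  - assert (he' : 0 < eps / 2) by lra.
    generalize (proj1 (clim_eps _ _ _) (H t Ht) _ he'). intros X. apply locally_RC in X.
    destruct X as [d Hd]. exists d. intros _. exact Hd.
  - exists (mkposreal 1 Rlt_0_1). tauto. }
set (delta := fun t => proj1_sig (constructive_indefinite_description _ (Q t))).
assert (Hdelta : forall t, a <= t <= b -> forall s w, Rabs (s - t) < delta t -> Cmod (w - z)%C < delta t ->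
  Cmod (k s w - k t z)%C < eps / 2).
{ intros t. unfold delta. now destruct constructive_indefinite_description. }
(* The centre [s] covering [t] is provided only under a double negation, so the goal is proved by
   contradiction. *)
destruct (compactness_value_1d a b delta) as [d Hd].
exists d. intros t w Ht Hw. apply NNPP. intros N. apply (Hd t Ht). intros (s & Hs & D1 & D2). apply N.
eapply Rle_lt_trans. apply (Cmod_triangle_minus _ (k s z)).
assert (X1 := Hdelta s Hs t w D1 ltac:(lra)).
assert (X2 := Hdelta s Hs t z D1). rewrite (Cmod_minus_sym (k t z)) in X2.
replace (z - z)%C with (RtoC 0) in X2 by ring. rewrite Cmod_0 in X2. specialize (X2 (cond_pos _)). lra.
Qed.

Lemma cint_param_continuous (k : R -> C -> C) (a b : R) (z : C) : a <= b ->
  locally (T := C_UniformSpace) z (fun w => forall t, a <= t <= b -> kcont k t w) ->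
  ccont (fun w => cint (fun t => k t w) a b) z.
Proof.
intros Hab H. apply locally_Cmod in H. destruct H as [r Hr].
assert (Hz : forall t, a <= t <= b -> kcont k t z).
{ apply Hr. replace (z - z)%C with (RtoC 0) by ring. rewrite Cmod_0. apply cond_pos. }
apply clim_eps. apply locally_filter. intros eps he.
(* The summand 1 keeps the denominator positive when [a = b]. *)
assert (he' : 0 < eps / (b - a + 1)) by (apply Rdiv_lt_0_compat; lra).
destruct (tube k a b z Hz _ he') as [d Hd].
apply locally_Cmod. exists (mkposreal _ (Rmin_stable_in_posreal d r)). simpl. intros w Hw.
assert (W1 : Cmod (w - z)%C < d). { eapply Rlt_le_trans. exact Hw. apply Rmin_l. }
assert (W2 : Cmod (w - z)%C < r). { eapply Rlt_le_trans. exact Hw. apply Rmin_r. }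
apply Rle_lt_trans with ((b - a) * (eps / (b - a + 1))).
- apply is_cint_bound with (fun t => (k t w - k t z)%C); auto.
  + intros t Ht. apply Rlt_le. now apply Hd.
  + apply is_cint_minus; apply cint_correct; auto; intros t Ht; apply kcont_slice.
    now apply Hr. now apply Hz.
- apply Rlt_le_trans with ((b - a + 1) * (eps / (b - a + 1))). nra. apply Req_le. field. lra.
Qed.

(** The remainder of the integral is the integral of the remainders. Each of these is controlled by
    the oscillation of [dk t] on the segment from [z] to [w], which [tube] makes small uniformly in
    [t]. *)
Lemma cint_param_derive (k dk : R -> C -> C) (a b : R) (z : C) : a <= b ->
  locally (T := C_UniformSpace) z (fun w => forall t, a <= t <= b ->
    cder (k t) w (dk t w) /\ rcont (fun t => k t w) t) ->
  (forall t, a <= t <= b -> kcont dk t z) ->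
  cder (fun w => cint (fun t => k t w) a b) z (cint (fun t => dk t z) a b).
Proof.
intros Hab H Hz. apply locally_Cmod in H. destruct H as [r Hr].
assert (Z0 : Cmod (z - z)%C = 0). { replace (z - z)%C with (RtoC 0) by ring. apply Cmod_0. }
apply cder_eps. intros eps he.
assert (he' : 0 < eps / (b - a + 1)) by (apply Rdiv_lt_0_compat; lra).
destruct (tube dk a b z Hz _ he') as [d Hd].
exists (mkposreal _ (Rmin_stable_in_posreal d r)). simpl. intros w Hw.
assert (W1 : Cmod (w - z)%C < d). { eapply Rlt_le_trans. exact Hw. apply Rmin_l. }
assert (W2 : Cmod (w - z)%C < r). { eapply Rlt_le_trans. exact Hw. apply Rmin_r. }
apply Rle_trans with ((b - a) * (eps / (b - a + 1) * Cmod (w - z)%C)).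
- apply is_cint_bound with (fun t => (k t w - k t z - (w - z) * dk t z)%C); auto.
  + intros t Ht. apply mean_value_segment with (dk t).
    * intros s Hs. apply Hr; auto. eapply Rle_lt_trans. now apply segment_dist. exact W2.
    * intros s Hs. apply Rlt_le. apply Hd; auto. eapply Rle_lt_trans. now apply segment_dist. exact W1.
  + apply is_cint_minus; [apply is_cint_minus|apply is_cint_scal]; apply cint_correct; auto; intros t Ht.
    * now apply Hr.
    * apply Hr; auto. rewrite Z0. apply cond_pos.
    * now apply kcont_slice, Hz.
- generalize (Cmod_ge_0 (w - z)). intros P.
  replace ((b - a) * (eps / (b - a + 1) * Cmod (w - z)%C)) with ((b - a) * (eps / (b - a + 1)) * Cmod (w - z)%C) by ring.
  apply Rmult_le_compat_r. exact P.
  apply Rle_trans with ((b - a + 1) * (eps / (b - a + 1))). nra. apply Req_le. field. lra.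
Qed.

(** * Goursat's lemma *)

Definition cint_seg (f : C -> C) (a b : C) : C :=
  cint (fun t => f (segment a b t) * (b - a))%C 0 1.

Lemma rcont_segment (f : C -> C) (a b : C) t : ccont f (segment a b t) ->
  rcont (fun t => f (segment a b t) * (b - a))%C t.
Proof.
intros H. apply Ccont_mult. 2: apply Ccont_const.
apply Ccont_comp. exact (rder_cont _ _ _ (rder_segment a b t)). exact H.
Qed.

Lemma cint_seg_correct (f : C -> C) a b : (forall t, 0 <= t <= 1 -> ccont f (segment a b t)) ->
  is_cint (fun t => f (segment a b t) * (b - a))%C 0 1 (cint_seg f a b).
Proof.
intros H. apply cint_correct. lra. intros t Ht. now apply rcont_segment, H.
Qed.

Lemma cint_seg_primitive (P f : C -> C) a b :
  (forall t, 0 <= t <= 1 -> cder P (segment a b t) (f (segment a b t))) ->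
  (forall t, 0 <= t <= 1 -> ccont f (segment a b t)) ->
  cint_seg f a b = (P b - P a)%C.
Proof.
intros D H. apply is_cint_unique.
replace (P b - P a)%C with (P (segment a b 1) - P (segment a b 0))%C by now rewrite segment_0, segment_1.
apply (cint_derive (fun t => P (segment a b t))). lra.
- intros t Ht. eapply rder_comp. now apply D. apply rder_segment. apply Cmult_comm.
- intros t Ht. now apply rcont_segment, H.
Qed.

Lemma cint_seg_plus (f g : C -> C) a b : (forall t, 0 <= t <= 1 -> ccont f (segment a b t)) ->
  (forall t, 0 <= t <= 1 -> ccont g (segment a b t)) ->
  cint_seg (fun z => f z + g z)%C a b = (cint_seg f a b + cint_seg g a b)%C.
Proof.
intros Hf Hg. apply is_cint_unique.
eapply is_cint_ext. lra. 2: apply is_cint_plus; apply cint_seg_correct; auto.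
intros t _. simpl. ring.
Qed.

Lemma cint_seg_bound (f : C -> C) a b M : (forall t, 0 <= t <= 1 -> ccont f (segment a b t)) ->
  (forall t, 0 <= t <= 1 -> Cmod (f (segment a b t)) <= M) ->
  Cmod (cint_seg f a b) <= M * Cmod (b - a)%C.
Proof.
intros Cf B. replace (M * Cmod (b - a)%C) with ((1 - 0) * (M * Cmod (b - a)%C)) by ring.
apply (is_cint_bound (fun t => f (segment a b t) * (b - a))%C). lra. 2: now apply cint_seg_correct.
intros t Ht. rewrite Cmod_mult. apply Rmult_le_compat_r. apply Cmod_ge_0. now apply B.
Qed.

Lemma cint_seg_rev (f : C -> C) a b : (forall t, 0 <= t <= 1 -> ccont f (segment a b t)) ->
  cint_seg f b a = (- cint_seg f a b)%C.
Proof.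
intros Cf. apply is_cint_unique.
assert (X := is_RInt_swap (V := C_R_NormedModule) _ _ _ _ (cint_seg_correct f a b Cf)).
assert (Y := is_RInt_comp_lin (V := C_R_NormedModule) (fun t => f (segment a b t) * (b - a))%C (-1) 1 0 1).
replace (-1 * 0 + 1) with 1 in Y by ring. replace (-1 * 1 + 1) with 0 in Y by ring.
specialize (Y _ X). eapply is_cint_ext. lra. 2: exact Y.
intros t _. etransitivity. apply scal_R_Cmult.
replace (segment a b (-1 * t + 1)) with (segment b a t).
ring. unfold segment. rewrite RtoC_plus, RtoC_mult. ring.
Qed.

Definition midpoint (a b : C) : C := segment a b (1 / 2).

Lemma segment_mid_l a b t : segment a (midpoint a b) t = segment a b (1 / 2 * t + 0).
Proof. unfold segment, midpoint, segment. rewrite RtoC_plus, RtoC_mult. ring. Qed.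

Lemma one_minus_half : (1 - RtoC (1 / 2) = RtoC (1 / 2))%C.
Proof. rewrite <- RtoC_minus. f_equal. field. Qed.

Lemma segment_mid_r a b t : segment (midpoint a b) b t = segment a b (1 / 2 * t + 1 / 2).
Proof.
unfold segment, midpoint, segment. rewrite RtoC_plus, RtoC_mult.
transitivity (a + RtoC (1/2) * (b - a) + RtoC t * ((1 - RtoC (1/2)) * (b - a)))%C. ring.
rewrite one_minus_half. ring.
Qed.

Lemma mid_diff a b : (midpoint a b - a = RtoC (1/2) * (b - a))%C.
Proof. unfold midpoint, segment. ring. Qed.

Lemma mid_diff_r a b : (b - midpoint a b = RtoC (1/2) * (b - a))%C.
Proof.
unfold midpoint, segment. transitivity ((1 - RtoC (1/2)) * (b - a))%C. ring.
now rewrite one_minus_half.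
Qed.

Lemma cint_seg_mid (f : C -> C) a b : (forall t, 0 <= t <= 1 -> ccont f (segment a b t)) ->
  cint_seg f a b = (cint_seg f a (midpoint a b) + cint_seg f (midpoint a b) b)%C.
Proof.
intros Cf. set (phi := fun t => (f (segment a b t) * (b - a))%C).
assert (Cp : forall t, 0 <= t <= 1 -> rcont phi t).
{ intros t Ht. now apply rcont_segment, Cf. }
assert (H1 : is_cint phi 0 (1 / 2) (cint phi 0 (1 / 2))).
{ apply cint_correct. lra. intros t Ht. apply Cp. lra. }
assert (H2 : is_cint phi (1 / 2) 1 (cint phi (1 / 2) 1)).
{ apply cint_correct. lra. intros t Ht. apply Cp. lra. }
apply is_cint_unique.
eapply is_cint_eq. exact (is_RInt_Chasles (V := C_R_NormedModule) _ _ _ _ _ _ H1 H2).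
apply (f_equal2 Cplus); symmetry; apply is_cint_unique.
- assert (Y := is_RInt_comp_lin (V := C_R_NormedModule) phi (1/2) 0 0 1).
  replace (1 / 2 * 0 + 0) with 0 in Y by ring. replace (1 / 2 * 1 + 0) with (1 / 2) in Y by ring.
  eapply is_cint_ext. lra. 2: exact (Y _ H1).
  intros t _. etransitivity. apply scal_R_Cmult. rewrite segment_mid_l, mid_diff. unfold phi. ring.
- assert (Y := is_RInt_comp_lin (V := C_R_NormedModule) phi (1/2) (1/2) 0 1).
  replace (1 / 2 * 0 + 1 / 2) with (1 / 2) in Y by ring. replace (1 / 2 * 1 + 1 / 2) with 1 in Y by field.
  eapply is_cint_ext. lra. 2: exact (Y _ H2).
  intros t _. etransitivity. apply scal_R_Cmult. rewrite segment_mid_r, mid_diff_r. unfold phi. ring.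
Qed.

(** The explicit rate [e] survives the passage to the limit; Goursat's argument needs it to compare
    the [n]-th triangle with the limit point. *)
Lemma Cauchy_sequence_limit (u : nat -> C) (e : nat -> R) :
  (forall n m, (n <= m)%nat -> Cmod (u m - u n)%C <= e n) ->
  (forall eps, 0 < eps -> exists n, e n < eps) ->
  exists l, forall n, Cmod (l - u n)%C <= e n.
Proof.
intros H He.
destruct (proj1 (filterlim_locally_cauchy (U := CompleteSpace.Pack C (CompleteSpace.Class C _ C_CompleteSpace_mixin) C) (F := eventually) u)) as [l Hl].
- intros eps.
  destruct (proj2 (locally_Cmod (RtoC 0) (fun w => ball (M := C_UniformSpace) (RtoC 0) eps w))) as [d Hd].
  { exists eps. intros w Hw. apply C_NormedModule_mixin_compat1. exact Hw. }
  destruct (He (eps / 2)) as [n Hn]. destruct eps; simpl; lra.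
  exists (fun m => (n <= m)%nat). split. exists n; auto.
  intros i j Hi Hj. apply C_NormedModule_mixin_compat1.
  change (Cmod (u j - u i)%C < eps).
  eapply Rle_lt_trans. apply (Cmod_triangle_minus _ (u n)). rewrite (Cmod_minus_sym (u n)).
  generalize (H n i Hi) (H n j Hj). lra.
- exists l. intros n. apply le_epsilon. intros eps he.
  assert (X := proj1 (clim_eps eventually u l) Hl eps he). destruct X as [N HN].
  specialize (HN (max n N) (Nat.le_max_r _ _)). specialize (H n (max n N) (Nat.le_max_l _ _)).
  eapply Rle_trans. apply (Cmod_triangle_minus _ (u (max n N))). rewrite Cmod_minus_sym. lra.
Qed.

Definition triangle_int (f : C -> C) (x : C * C * C) : C :=
  let '(a, b, c) := x in (cint_seg f a b + cint_seg f b c + cint_seg f c a)%C.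
Definition perimeter (x : C * C * C) : R :=
  let '(a, b, c) := x in Cmod (b - a)%C + Cmod (c - b)%C + Cmod (a - c)%C.
Definition vertex (x : C * C * C) : C := fst (fst x).
(** Balls are convex, so controlling the vertices controls the sides. This replaces the closed
    triangle as a set. *)
Definition in_ball (c0 : C) (r : R) (x : C * C * C) : Prop :=
  let '(a, b, c) := x in Cmod (a - c0)%C <= r /\ Cmod (b - c0)%C <= r /\ Cmod (c - c0)%C <= r.

Lemma segment_in_ball c r a b t : 0 <= t <= 1 -> Cmod (a - c)%C <= r -> Cmod (b - c)%C <= r ->
  Cmod (segment a b t - c)%C <= r.
Proof.
intros Ht Ha Hb. apply le_epsilon. intros eps he. apply Rlt_le.
apply segment_in_disc; auto; lra.
Qed.

Lemma Cmod_half w : Cmod (RtoC (1 / 2) * w)%C = Cmod w / 2.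
Proof. rewrite Cmod_mult, Cmod_R, Rabs_pos_eq by lra. lra. Qed.

(** The midpoints cut the triangle into four of half the perimeter. The integrals over the inner
    sides cancel in pairs, so one of the four carries at least a quarter of the integral in
    modulus. *)
Lemma triangle_bisect (f : C -> C) c0 r x :
  (forall z, Cmod (z - c0)%C <= r -> ccont f z) -> in_ball c0 r x ->
  exists y, in_ball c0 r y /\ Cmod (triangle_int f x) <= 4 * Cmod (triangle_int f y) /\
    perimeter y = perimeter x / 2 /\ Cmod (vertex y - vertex x)%C <= perimeter x.
Proof.
intros Cf. destruct x as [[a b] c]. intros (Ha & Hb & Hc).
set (ab := midpoint a b). set (bc := midpoint b c). set (ca := midpoint c a).
assert (h : 0 <= 1 / 2 <= 1) by lra.
assert (Hab : Cmod (ab - c0)%C <= r) by now apply segment_in_ball.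
assert (Hbc : Cmod (bc - c0)%C <= r) by now apply segment_in_ball.
assert (Hca : Cmod (ca - c0)%C <= r) by now apply segment_in_ball.
assert (S : forall u v, Cmod (u - c0)%C <= r -> Cmod (v - c0)%C <= r -> forall t, 0 <= t <= 1 -> ccont f (segment u v t)).
{ intros u v Hu Hv t Ht. apply Cf. now apply segment_in_ball. }
assert (E : triangle_int f (a, b, c) = (triangle_int f (a, ab, ca) + triangle_int f (ab, b, bc)
  + triangle_int f (ca, bc, c) + triangle_int f (ab, bc, ca))%C).
{ unfold triangle_int. rewrite (cint_seg_mid f a b), (cint_seg_mid f b c), (cint_seg_mid f c a) by auto.
  fold ab bc ca.
  rewrite (cint_seg_rev f ca ab), (cint_seg_rev f ab bc), (cint_seg_rev f bc ca) by auto. ring. }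
assert (M : Cmod (triangle_int f (a, b, c)) <= Cmod (triangle_int f (a, ab, ca)) + Cmod (triangle_int f (ab, b, bc))
  + Cmod (triangle_int f (ca, bc, c)) + Cmod (triangle_int f (ab, bc, ca))).
{ rewrite E. eapply Rle_trans. apply Cmod_triangle. apply Rplus_le_compat_r.
  eapply Rle_trans. apply Cmod_triangle. apply Rplus_le_compat_r. apply Cmod_triangle. }
assert (l1 : (ab - a = RtoC (1/2) * (b - a))%C) by apply mid_diff.
assert (l2 : (b - ab = RtoC (1/2) * (b - a))%C) by apply mid_diff_r.
assert (l3 : (bc - b = RtoC (1/2) * (c - b))%C) by apply mid_diff.
assert (l4 : (c - bc = RtoC (1/2) * (c - b))%C) by apply mid_diff_r.
assert (l5 : (ca - c = RtoC (1/2) * (a - c))%C) by apply mid_diff.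
assert (l6 : (a - ca = RtoC (1/2) * (a - c))%C) by apply mid_diff_r.
assert (m1 : (ab - ca = RtoC (1/2) * (b - c))%C).
{ replace (ab - ca)%C with ((ab - a) + (a - ca))%C by ring. rewrite l1, l6. ring. }
assert (m2 : (bc - ab = RtoC (1/2) * (c - a))%C).
{ replace (bc - ab)%C with ((bc - b) + (b - ab))%C by ring. rewrite l2, l3. ring. }
assert (m3 : (ca - bc = RtoC (1/2) * (a - b))%C).
{ replace (ca - bc)%C with ((ca - c) + (c - bc))%C by ring. rewrite l4, l5. ring. }
assert (P1 := Cmod_ge_0 (b - a)). assert (P2 := Cmod_ge_0 (c - b)). assert (P3 := Cmod_ge_0 (a - c)).
assert (X : Cmod (triangle_int f (a, b, c)) <= 4 * Cmod (triangle_int f (a, ab, ca)) \/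
  Cmod (triangle_int f (a, b, c)) <= 4 * Cmod (triangle_int f (ab, b, bc)) \/
  Cmod (triangle_int f (a, b, c)) <= 4 * Cmod (triangle_int f (ca, bc, c)) \/
  Cmod (triangle_int f (a, b, c)) <= 4 * Cmod (triangle_int f (ab, bc, ca))) by lra.
destruct X as [X|[X|[X|X]]].
- exists (a, ab, ca). split; [|split; [|split]]; auto. repeat split; auto.
  + unfold perimeter. rewrite l1, l6, (Cmod_minus_sym ca), m1, !Cmod_half, (Cmod_minus_sym b c). lra.
  + unfold vertex, perimeter; simpl. replace (a - a)%C with (RtoC 0) by ring. rewrite Cmod_0. lra.
- exists (ab, b, bc). split; [|split; [|split]]; auto. repeat split; auto.
  + unfold perimeter. rewrite l2, l3, (Cmod_minus_sym ab bc), m2, !Cmod_half, (Cmod_minus_sym c a). lra.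
  + unfold vertex, perimeter; simpl. rewrite l1, Cmod_half. lra.
- exists (ca, bc, c). split; [|split; [|split]]; auto. repeat split; auto.
  + unfold perimeter. rewrite l4, (Cmod_minus_sym bc), m3, l5, !Cmod_half, (Cmod_minus_sym a b). lra.
  + unfold vertex, perimeter; simpl. rewrite Cmod_minus_sym, l6, Cmod_half. lra.
- exists (ab, bc, ca). split; [|split; [|split]]; auto. repeat split; auto.
  + unfold perimeter. rewrite m1, m2, m3, !Cmod_half, (Cmod_minus_sym c a), (Cmod_minus_sym a b), (Cmod_minus_sym b c). lra.
  + unfold vertex, perimeter; simpl. rewrite l1, Cmod_half. lra.
Qed.

Lemma perimeter_ge_0 x : 0 <= perimeter x.
Proof.
destruct x as [[a b] c]. simpl.
generalize (Cmod_ge_0 (b - a)) (Cmod_ge_0 (c - b)) (Cmod_ge_0 (a - c)). lra.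
Qed.

(** The affine part of [f] at [l] has the primitive [P] and contributes nothing over a closed path;
    only the remainder is left. The condition on [rho] keeps all three sides within [rho] of [l]. *)
Lemma triangle_small (f : C -> C) c0 r x l d eps rho :
  (forall z, Cmod (z - c0)%C <= r -> ccont f z) -> in_ball c0 r x ->
  (forall w, Cmod (w - c0)%C <= r -> Cmod (w - l)%C <= rho ->
     Cmod (f w - f l - (w - l) * d)%C <= eps) ->
  Cmod (vertex x - l)%C + 2 * perimeter x <= rho ->
  Cmod (triangle_int f x) <= eps * perimeter x.
Proof.
intros Cf. destruct x as [[a b] c]. intros (Ha & Hb & Hc) D Hrho.
unfold vertex, perimeter in *; simpl in Hrho.
assert (P1 := Cmod_ge_0 (b - a)). assert (P2 := Cmod_ge_0 (c - b)). assert (P3 := Cmod_ge_0 (a - c)).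
set (aff := fun w => (f l + (w - l) * d)%C).
set (rem := fun w => (f w - f l - (w - l) * d)%C).
set (P := fun w => (f l * w + / RtoC 2 * ((w - l) * (w - l)) * d)%C).
assert (n2 : RtoC 2 <> RtoC 0). { intros X. apply RtoC_inj in X. lra. }
assert (DP : forall w, cder P w (aff w)).
{ intros w. unfold P, aff. eapply cder_eq. apply cder_plus. apply cder_scal. apply cder_id.
  apply cder_mult. apply cder_scal. apply cder_mult; (apply cder_minus; [apply cder_id|apply cder_const]).
  apply cder_const. simpl. field. }
assert (Ca : forall w, ccont aff w).
{ intros w. eapply cder_cont.
  apply cder_plus. apply cder_const. apply cder_mult; [apply cder_minus; [apply cder_id|apply cder_const]|apply cder_const]. }
assert (Cr : forall w, Cmod (w - c0)%C <= r -> ccont rem w).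
{ intros w Hw. apply (filterlim_ext (fun w => f w - aff w)%C). intros v; unfold rem, aff; ring.
  replace (rem w) with (f w - aff w)%C by (unfold rem, aff; ring).
  apply Ccont_minus. now apply Cf. apply Ca. }
assert (S : forall u v, Cmod (u - c0)%C <= r -> Cmod (v - c0)%C <= r ->
  cint_seg f u v = (cint_seg rem u v + (P v - P u))%C).
{ intros u v Hu Hv. rewrite <- (cint_seg_primitive P aff u v) by auto.
  rewrite <- cint_seg_plus; auto. unfold cint_seg. apply cint_ext. lra.
  intros t _. unfold rem, aff. ring.
  intros t Ht. apply Cr. now apply segment_in_ball. }
assert (E : triangle_int f (a, b, c) = triangle_int rem (a, b, c)).
{ simpl. rewrite !S by auto. ring. }
rewrite E.
assert (B : forall u v, Cmod (u - c0)%C <= r -> Cmod (v - c0)%C <= r ->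
  Cmod (v - u)%C + Cmod (u - l)%C <= rho -> Cmod (cint_seg rem u v) <= eps * Cmod (v - u)%C).
{ intros u v Hu Hv Huv. apply cint_seg_bound.
  - intros t Ht. apply Cr. now apply segment_in_ball.
  - intros t Ht. apply D. now apply segment_in_ball. eapply Rle_trans. apply (Cmod_triangle_minus _ u).
    generalize (segment_dist u v t Ht). lra. }
simpl. eapply Rle_trans. apply Cmod_triangle.
rewrite !Rmult_plus_distr_l. apply Rplus_le_compat.
eapply Rle_trans. apply Cmod_triangle. apply Rplus_le_compat.
- apply B; auto. lra.
- apply B; auto. generalize (Cmod_triangle_minus b a l). lra.
- apply B; auto. generalize (Cmod_triangle_minus c a l). rewrite (Cmod_minus_sym c a). lra.
Qed.

Lemma half_pow_lt (K eps : R) : 0 < eps -> exists n, K * (1 / 2) ^ n < eps.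
Proof.
intros he. destruct (Rle_lt_dec K 0) as [H|H].
- exists O. simpl. lra.
- destruct (pow_lt_1_zero (1/2)) with (y := eps / K) as [n Hn].
  rewrite Rabs_pos_eq; lra. apply Rdiv_lt_0_compat; lra.
  exists n. specialize (Hn n (Nat.le_refl n)). rewrite Rabs_pos_eq in Hn.
  apply Rmult_lt_compat_l with (r := K) in Hn; auto.
  replace (K * (eps / K)) with eps in Hn by (field; lra). exact Hn.
  apply pow_le. lra.
Qed.

(** After [n] bisections the integral has lost at most the factor 4^n, while differentiability at
    the limit point [l] bounds it by a small multiple of the squared perimeter, which shrinks by
    exactly 4^n. *)
Lemma goursat_ball (f : C -> C) c0 r x :
  (forall z, Cmod (z - c0)%C <= r -> ex_derive (K := C_AbsRing) (V := C_NormedModule) f z) ->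
  in_ball c0 r x -> triangle_int f x = RtoC 0.
Proof.
intros Hf Hx.
assert (Cf : forall z, Cmod (z - c0)%C <= r -> ccont f z).
{ intros z Hz. destruct (Hf z Hz) as [l Hl]. exact (cder_cont _ _ _ Hl). }
assert (Q : forall x, exists y, in_ball c0 r x -> in_ball c0 r y /\
    Cmod (triangle_int f x) <= 4 * Cmod (triangle_int f y) /\
    perimeter y = perimeter x / 2 /\ Cmod (vertex y - vertex x)%C <= perimeter x).
{ intros y. destruct (classic (in_ball c0 r y)) as [H|H].
  destruct (triangle_bisect f c0 r y Cf H) as [z Hz]. now exists z. exists y. tauto. }
set (step := fun x => proj1_sig (constructive_indefinite_description _ (Q x))).
assert (Hstep : forall x, in_ball c0 r x -> in_ball c0 r (step x) /\
    Cmod (triangle_int f x) <= 4 * Cmod (triangle_int f (step x)) /\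
    perimeter (step x) = perimeter x / 2 /\ Cmod (vertex (step x) - vertex x)%C <= perimeter x).
{ intros y. unfold step. now destruct constructive_indefinite_description. }
set (tri := fun n => Nat.iter n step x).
set (S := perimeter x). assert (S0 : 0 <= S) by apply perimeter_ge_0.
assert (I : forall n, in_ball c0 r (tri n) /\ perimeter (tri n) = S * (1/2)^n /\
  Cmod (triangle_int f x) * ((1/2)^n * (1/2)^n) <= Cmod (triangle_int f (tri n))).
{ induction n as [|n (I1 & I2 & I3)].
  - simpl. split; auto. unfold tri; simpl. fold S. split; lra.
  - change (tri (Datatypes.S n)) with (step (tri n)). destruct (Hstep _ I1) as (H1 & H2 & H3 & H4).
    split; auto. rewrite H3, I2. simpl. split. field. lra. }
(* Successive vertices differ by at most the perimeter [S * (1/2)^m], which equals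
   [2 * S * ((1/2)^m - (1/2)^(m+1))]; the sum telescopes. *)
assert (V : forall n m, (n <= m)%nat -> Cmod (vertex (tri m) - vertex (tri n))%C <= 2 * S * ((1/2)^n - (1/2)^m)).
{ intros n m Hnm. induction Hnm as [|m Hnm IH].
  - replace (vertex (tri n) - vertex (tri n))%C with (RtoC 0) by ring. rewrite Cmod_0. lra.
  - eapply Rle_trans. apply (Cmod_triangle_minus _ (vertex (tri m))).
    destruct (I m) as (I1 & I2 & _). destruct (Hstep _ I1) as (_ & _ & _ & H4).
    change (tri (Datatypes.S m)) with (step (tri m)). rewrite I2 in H4. simpl. lra. }
assert (pw : forall n, 0 < (1/2)^n) by (intros; apply pow_lt; lra).
destruct (Cauchy_sequence_limit (fun n => vertex (tri n)) (fun n => 2 * S * (1/2)^n)) as [l Hl].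
{ intros n m Hnm. eapply Rle_trans. now apply V. generalize (pw m). nra. }
{ intros eps he. apply half_pow_lt. exact he. }
simpl in Hl.
assert (L : Cmod (l - c0)%C <= r).
{ apply le_epsilon. intros eps he. destruct (half_pow_lt (2 * S) eps he) as [n Hn].
  eapply Rle_trans. apply (Cmod_triangle_minus _ (vertex (tri n))).
  destruct (I n) as [I1 _]. assert (Cmod (vertex (tri n) - c0)%C <= r).
  { destruct (tri n) as [[a b] c]. apply I1. }
  specialize (Hl n). lra. }
destruct (Hf l L) as [d Hd].
apply Cmod_eq_0. apply Rle_antisym. 2: apply Cmod_ge_0.
apply le_epsilon. intros eps he.
(* Slope, radius [4 * S * q] and perimeter [S * q] multiply to [4 * S * S * (q * q)] times the
   slope; the 1 guards against [S = 0]. *)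
assert (he' : 0 < eps / (4 * S * S + 1)) by (apply Rdiv_lt_0_compat; nra).
destruct (is_derive_C_eps f l d Hd (mkposreal _ he')) as [dl Hdl]. simpl in Hdl.
destruct (half_pow_lt (4 * S) dl (cond_pos dl)) as [n Hn].
destruct (I n) as (I1 & I2 & I3). assert (pn := pw n). set (q := (1/2)^n) in *.
(* The radius is [2 * S * q] for the distance from the vertex to [l], plus twice the perimeter
   [S * q]. *)
assert (X := triangle_small f c0 r (tri n) l d (eps / (4 * S * S + 1) * (4 * S * q)) (4 * S * q) Cf I1).
assert (Y : Cmod (triangle_int f (tri n)) <= eps / (4 * S * S + 1) * (4 * S * q) * perimeter (tri n)).
{ apply X.
  - intros w _ Hw. eapply Rle_trans. apply Hdl. lra. apply Rmult_le_compat_l; lra.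
  - rewrite I2. specialize (Hl n). rewrite Cmod_minus_sym in Hl. fold q in Hl. lra. }
rewrite I2 in Y.
assert (Z : Cmod (triangle_int f x) * (q * q) <= eps * (q * q)).
{ eapply Rle_trans. exact I3. eapply Rle_trans. exact Y.
  replace (eps / (4 * S * S + 1) * (4 * S * q) * (S * q)) with (eps * (4 * S * S / (4 * S * S + 1)) * (q * q)) by (field; nra).
  apply Rmult_le_compat_r. nra. rewrite <- (Rmult_1_r eps) at 2. apply Rmult_le_compat_l. lra.
  apply Rmult_le_reg_r with (4 * S * S + 1). nra. unfold Rdiv. rewrite Rmult_assoc, Rinv_l; nra. }
apply Rmult_le_reg_r in Z; nra.
Qed.

(** The primitive integrates from the centre along a radius. Goursat's lemma makes its increment
    from [z] to [w] the integral over the segment between them, and continuity of [f] at [z] gives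
    the derivative. *)
Theorem holomorphic_primitive (f : C -> C) c0 r : 0 < r ->
  (forall z, Cmod (z - c0)%C < r -> ex_derive (K := C_AbsRing) (V := C_NormedModule) f z) ->
  exists F, forall z, Cmod (z - c0)%C < r -> cder F z (f z).
Proof.
intros Hr Hf.
assert (Cf : forall z, Cmod (z - c0)%C < r -> ccont f z).
{ intros z Hz. destruct (Hf z Hz) as [l Hl]. exact (cder_cont _ _ _ Hl). }
assert (C0 : Cmod (c0 - c0)%C < r). { replace (c0 - c0)%C with (RtoC 0) by ring. now rewrite Cmod_0. }
assert (S : forall u v, Cmod (u - c0)%C < r -> Cmod (v - c0)%C < r -> forall t, 0 <= t <= 1 -> ccont f (segment u v t)).
{ intros u v Hu Hv t Ht. apply Cf. now apply segment_in_disc. }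
assert (T : forall z w, Cmod (z - c0)%C < r -> Cmod (w - c0)%C < r ->
  (cint_seg f c0 w - cint_seg f c0 z = cint_seg f z w)%C).
{ intros z w Hz Hw.
  (* The closed ball through the farther of the two points is still inside the open disc, as
     [goursat_ball] requires. *)
  assert (G := goursat_ball f c0 (Rmax (Cmod (z - c0)) (Cmod (w - c0))) (c0, z, w)).
  unfold triangle_int in G. rewrite (cint_seg_rev f c0 w) in G by auto.
  transitivity (cint_seg f z w - (cint_seg f c0 z + cint_seg f z w + - cint_seg f c0 w))%C. ring.
  rewrite G. ring.
  - intros v Hv. apply Hf. eapply Rle_lt_trans. exact Hv. now apply Rmax_lub_lt.
  - repeat split. 2: apply Rmax_l. 2: apply Rmax_r.
    replace (c0 - c0)%C with (RtoC 0) by ring. rewrite Cmod_0. eapply Rle_trans. 2: apply Rmax_l. apply Cmod_ge_0. }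
exists (fun z => cint_seg f c0 z). intros z Hz.
apply cder_eps. intros eps he.
assert (X := proj1 (clim_eps _ _ _) (Cf z Hz) eps he). apply locally_Cmod in X. destruct X as [d Hd].
assert (he' : 0 < Rmin d (r - Cmod (z - c0))). { apply Rmin_glb_lt. apply cond_pos. lra. }
exists (mkposreal _ he'). simpl. intros w Hw.
assert (Hw1 : Cmod (w - z)%C < d). { eapply Rlt_le_trans. exact Hw. apply Rmin_l. }
assert (Hw2 : Cmod (w - c0)%C < r).
{ eapply Rle_lt_trans. apply (Cmod_triangle_minus _ z).
  assert (Cmod (w - z)%C < r - Cmod (z - c0)%C). { eapply Rlt_le_trans. exact Hw. apply Rmin_r. } lra. }
rewrite T by auto.
replace (cint_seg f z w - (w - z) * f z)%C with (cint_seg (fun v => f v + - f z)%C z w).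
2:{ rewrite cint_seg_plus; auto. rewrite (cint_seg_primitive (fun v => - f z * v)%C (fun _ => - f z)%C). ring.
    intros t _. eapply cder_eq. apply cder_scal. apply cder_id. simpl; ring.
    intros; apply continuous_const. intros; apply continuous_const. }
apply cint_seg_bound.
- intros t Ht. apply Ccont_plus. now apply S. apply Ccont_const.
- intros t Ht. apply Rlt_le. apply (Hd (segment z w t)).
  eapply Rle_lt_trans. apply segment_dist; auto. exact Hw1.
Qed.

(** * Cauchy's formula *)

Notation cdiff f z := (ex_derive (K := C_AbsRing) (V := C_NormedModule) f z).

Definition circ (c : C) (r t : R) : C := (c + RtoC r * (cos t, sin t))%C.
Definition circ' (r t : R) : C := (Ci * RtoC r * (cos t, sin t))%C.

Lemma Cmod_cis t : Cmod (cos t, sin t) = 1.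
Proof. apply circle_cis. Qed.

Lemma rder_circ c r t : rder (circ c r) t (circ' r t).
Proof.
unfold circ, circ'. eapply rder_eq. apply rder_plus. apply rder_const. apply rder_scal. apply rder_cis.
change zero with (RtoC 0). ring.
Qed.

Lemma rcont_circ' r t : rcont (circ' r) t.
Proof. unfold circ'. apply Ccont_scal. apply Ccont_cis. apply continuous_id. Qed.

Lemma Cmod_circ c r t : 0 <= r -> Cmod (circ c r t - c)%C = r.
Proof.
intros Hr. unfold circ. replace (c + RtoC r * (cos t, sin t) - c)%C with (RtoC r * (cos t, sin t))%C by ring.
rewrite Cmod_mult, Cmod_cis, Cmod_R, Rabs_pos_eq; lra.
Qed.

Lemma circ_2PI c r : circ c r (2 * PI) = circ c r 0.
Proof. unfold circ. now rewrite cos_2PI, sin_2PI, cos_0, sin_0. Qed.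

Lemma circ_neq c r a t : Cmod (a - c)%C < r -> (circ c r t - a)%C <> RtoC 0.
Proof.
intros Ha E. assert (r0 : 0 <= r). { generalize (Cmod_ge_0 (a - c)). lra. }
assert (X := Cmod_circ c r t r0).
replace (circ c r t) with (circ c r t - a + a)%C in X by ring. rewrite E in X.
replace (RtoC 0 + a - c)%C with (a - c)%C in X by ring. lra.
Qed.

Lemma cder_pow_inv (u : C) (n : nat) (w : C) : (u - w)%C <> RtoC 0 ->
  cder (fun w => (/ (u - w)) ^ n)%C w (RtoC (INR n) * (/ (u - w)) ^ S n)%C.
Proof.
intros N. assert (D : cder (fun w => / (u - w))%C w (/ (u - w) * / (u - w))%C).
{ eapply cder_eq. apply (cder_comp (fun w => u - w)%C (fun v => / v)%C).
  apply cder_minus. apply cder_const. apply cder_id. now apply cder_inv.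
  simpl. field. auto. }
induction n as [|n IH].
- simpl. eapply cder_eq. apply cder_const. ring.
- eapply cder_eq. apply (cder_mult _ _ _ _ _ D IH).
  rewrite S_INR, RtoC_plus. simpl. ring.
Qed.

Lemma continuous_snd_RC (t : R) (z : C) : continuous (T := RC) (U := C_UniformSpace) snd (t, z).
Proof. apply (continuous_snd (U := R_UniformSpace) (V := C_UniformSpace)). Qed.

Lemma continuous_fst_RC (t : R) (z : C) : continuous (T := RC) (U := R_UniformSpace) fst (t, z).
Proof. apply (continuous_fst (U := R_UniformSpace) (V := C_UniformSpace)). Qed.

Lemma kcont_fst (phi : R -> C) t z : rcont phi t -> kcont (fun t _ => phi t) t z.
Proof. intros H. apply (continuous_comp (U := RC) fst phi (t, z)). apply continuous_fst_RC. exact H. Qed.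

Lemma Ccont_pow {T : UniformSpace} (f : T -> C) x n : continuous (U := C_UniformSpace) f x ->
  continuous (U := C_UniformSpace) (fun y => (f y) ^ n)%C x.
Proof.
intros H. induction n as [|n IH]; simpl. apply Ccont_const. now apply Ccont_mult.
Qed.

(** Cauchy-type integral with kernel 1 / (zeta - a)^n over a circle, not normalised by 2 pi i. The
    factor of d zeta is left to the density [phi]; each derivative in [a] raises [n] by one. *)
Definition cauchy_int (c : C) (r : R) (phi : R -> C) (n : nat) (a : C) : C :=
  cint (fun t => phi t * (/ (circ c r t - a)) ^ n)%C 0 (2 * PI).

Lemma kcont_cauchy c r (phi : R -> C) n t a : Cmod (a - c)%C < r -> rcont phi t ->
  kcont (fun t a => phi t * (/ (circ c r t - a)) ^ n)%C t a.
Proof.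
intros Ha Hp. apply Ccont_mult. now apply kcont_fst.
apply Ccont_pow, Ccont_inv. apply Ccont_minus.
apply (kcont_fst (circ c r)). exact (rder_cont _ _ _ (rder_circ c r t)). apply continuous_snd_RC.
simpl. now apply circ_neq.
Qed.

Lemma disc_nbhd c r a : Cmod (a - c)%C < r -> locally (T := C_UniformSpace) a (fun w => Cmod (w - c)%C < r).
Proof.
intros Ha. apply locally_Cmod. assert (p : 0 < r - Cmod (a - c)%C) by lra.
exists (mkposreal _ p). simpl. intros w Hw. generalize (Cmod_triangle_minus w a c). lra.
Qed.

Lemma PI2_ge_0 : 0 <= 2 * PI.
Proof. generalize PI_RGT_0; lra. Qed.

Lemma cauchy_int_derive c r (phi : R -> C) n a : Cmod (a - c)%C < r -> (forall t, rcont phi t) ->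
  cder (cauchy_int c r phi n) a (RtoC (INR n) * cauchy_int c r phi (S n) a)%C.
Proof.
intros Ha Hp. eapply cder_eq.
apply (cint_param_derive (fun t a => phi t * (/ (circ c r t - a)) ^ n)%C
  (fun t a => phi t * (RtoC (INR n) * (/ (circ c r t - a)) ^ S n))%C). apply PI2_ge_0.
- generalize (disc_nbhd c r a Ha). apply filter_imp. intros w Hw t _. split.
  + apply cder_scal. apply cder_pow_inv. now apply circ_neq.
  + apply (kcont_slice (fun t a => phi t * (/ (circ c r t - a)) ^ n)%C). now apply kcont_cauchy.
- intros t _. apply (continuous_ext (T := RC) (U := C_UniformSpace)
    (fun p => RtoC (INR n) * (phi (fst p) * (/ (circ c r (fst p) - (snd p))) ^ S n))%C).
  intros p. simpl. ring. apply Ccont_scal. now apply kcont_cauchy.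
- apply is_cint_unique. eapply is_cint_ext. apply PI2_ge_0.
  2:{ apply is_cint_scal. apply cint_correct. apply PI2_ge_0. intros t _.
      apply (kcont_slice (fun t a => phi t * (/ (circ c r t - a)) ^ (S n))%C). now apply kcont_cauchy. }
  intros t _. simpl. ring.
Qed.

(** The derivative in [a] is the integral of [circ' r] against the kernel of order 2, an exact
    derivative in [t], hence 0. So the value is the one at the centre, where the integrand is
    constantly [Ci]. *)
Lemma winding_number c r a : 0 < r -> Cmod (a - c)%C < r ->
  cauchy_int c r (circ' r) 1 a = (Ci * RtoC (2 * PI))%C.
Proof.
intros Hr Ha.
assert (Z : forall w, Cmod (w - c)%C < r -> cauchy_int c r (circ' r) 2 w = RtoC 0).
{ intros w Hw. apply is_cint_unique.
  eapply is_cint_eq. apply (cint_derive (fun t => / (w - circ c r t))%C). apply PI2_ge_0.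
  - intros t _. assert (N := circ_neq c r w t Hw).
    assert (N' : (w - circ c r t)%C <> RtoC 0).
    { intros E. apply N. replace (circ c r t - w)%C with (- (w - circ c r t))%C by ring. rewrite E. ring. }
    eapply (rder_comp (fun u => / (w - u))%C).
    + apply (cder_comp (fun u => w - u)%C (fun v => / v)%C).
      apply cder_minus. apply cder_const. apply cder_id. now apply cder_inv.
    + apply rder_circ.
    + simpl. field. auto.
  - intros t _. apply (kcont_slice (fun t a => circ' r t * (/ (circ c r t - a)) ^ 2)%C).
    apply kcont_cauchy; auto. apply rcont_circ'.
  - rewrite circ_2PI. ring. }
assert (Cc : Cmod (c - c)%C < r). { replace (c - c)%C with (RtoC 0) by ring. now rewrite Cmod_0. }
transitivity (cauchy_int c r (circ' r) 1 c).
- assert (X := mean_value_segment (cauchy_int c r (circ' r) 1) (fun _ => RtoC 0) c a (RtoC 0) 0).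
  assert (E : (cauchy_int c r (circ' r) 1 a - cauchy_int c r (circ' r) 1 c)%C = RtoC 0).
  { apply Cmod_eq_0. apply Rle_antisym. 2: apply Cmod_ge_0.
    replace (cauchy_int c r (circ' r) 1 a - cauchy_int c r (circ' r) 1 c)%C
      with (cauchy_int c r (circ' r) 1 a - cauchy_int c r (circ' r) 1 c - (a - c) * RtoC 0)%C by ring.
    apply Rle_trans with (0 * Cmod (a - c)%C). 2: lra. apply X.
    - intros t Ht. eapply cder_eq. apply cauchy_int_derive. now apply segment_in_disc. apply rcont_circ'.
      rewrite Z. ring. now apply segment_in_disc.
    - intros t _. replace (RtoC 0 - RtoC 0)%C with (RtoC 0) by ring. rewrite Cmod_0. lra. }
  replace (cauchy_int c r (circ' r) 1 a) with ((cauchy_int c r (circ' r) 1 a - cauchy_int c r (circ' r) 1 c) + cauchy_int c r (circ' r) 1 c)%C by ring.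
  rewrite E. ring.
- apply is_cint_unique.
  eapply is_cint_eq. apply (cint_derive (fun t => Ci * RtoC t)%C). apply PI2_ge_0.
  + intros t _. eapply rder_eq. apply rder_scal. apply rder_RtoC. apply (is_derive_id (K := R_AbsRing)).
    unfold one, circ, circ'; simpl.
    assert (n1 : RtoC r <> RtoC 0). { intros X. apply RtoC_inj in X. lra. }
    assert (n2 : (cos t, sin t) <> RtoC 0). { apply Cmod_gt_0. rewrite Cmod_cis. lra. }
    field. replace (c + RtoC r * (cos t, sin t) - c)%C with (RtoC r * (cos t, sin t))%C by ring. now apply Cmult_neq_0.
  + intros t _. apply (kcont_slice (fun t a => circ' r t * (/ (circ c r t - a)) ^ 1)%C).
    apply kcont_cauchy; auto. apply rcont_circ'.
  + ring.
Qed.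

(* The integral of [F (a + s (gamma - a)) gamma' / (gamma - a)] over the circle does not depend on
   [s] in [0, 1]: its derivative in [s] is the integral of the [t]-derivative of
   [F (a + s (gamma - a)) / s]. *)
Lemma cauchy_formula_C1 (F f : C -> C) c rho r a : 0 < r < rho -> Cmod (a - c)%C < r ->
  (forall z, Cmod (z - c)%C < rho -> cder F z (f z)) ->
  (forall z, Cmod (z - c)%C < rho -> ccont f z) ->
  F a = (/ (Ci * RtoC (2 * PI)) * cauchy_int c r (fun t => F (circ c r t) * circ' r t) 1 a)%C.
Proof.
intros Hr Ha DF Cf.
assert (P0 := PI_RGT_0).
set (q := fun (t : R) (s : C) => (a + s * (circ c r t - a))%C).
(* The homotopy parameter is complex, so that [cint_param_derive] applies. Moving it by less than
   [(rho - r) / (2 * r)] moves the path by less than [rho - r], because the path is at most [2 * r]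
   away from [a]. *)
assert (Q : forall s : R, 0 <= s <= 1 -> exists d : posreal, forall w, Cmod (w - RtoC s)%C < d -> forall t, Cmod (q t w - c)%C < rho).
{ intros s Hs. assert (dp : 0 < (rho - r) / (2 * r)) by (apply Rdiv_lt_0_compat; lra).
  exists (mkposreal _ dp). simpl. intros w Hw t.
  assert (G := Cmod_circ c r t ltac:(lra)).
  replace (q t w - c)%C with ((segment a (circ c r t) s - c) + (w - RtoC s) * (circ c r t - a))%C by (unfold q, segment; ring).
  eapply Rle_lt_trans. apply Cmod_triangle. rewrite Cmod_mult.
  assert (Cmod (segment a (circ c r t) s - c)%C <= r) by (apply segment_in_ball; lra).
  assert (Cmod (circ c r t - a)%C <= 2 * r). { eapply Rle_trans. apply (Cmod_triangle_minus _ c). rewrite (Cmod_minus_sym c). lra. }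
  assert (Cmod (w - RtoC s)%C * Cmod (circ c r t - a)%C < (rho - r)).
  { apply Rle_lt_trans with (Cmod (w - RtoC s)%C * (2 * r)). apply Rmult_le_compat_l. apply Cmod_ge_0. auto.
    replace (rho - r) with ((rho - r) / (2 * r) * (2 * r)) by (field; lra). apply Rmult_lt_compat_r; lra. }
  lra. }
assert (cq : forall t w, kcont q t w).
{ intros t w. unfold q. apply Ccont_plus. apply Ccont_const. apply Ccont_mult. apply continuous_snd_RC.
  apply Ccont_minus. 2: apply Ccont_const. apply (kcont_fst (circ c r)). exact (rder_cont _ _ _ (rder_circ c r t)). }
set (k := fun t s => (F (q t s) * (circ' r t / (circ c r t - a)))%C).
set (dk := fun t s => (f (q t s) * circ' r t)%C).
assert (ck : forall t w, Cmod (q t w - c)%C < rho -> kcont k t w).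
{ intros t w Hw. unfold k. apply Ccont_mult. apply Ccont_comp. apply cq. exact (cder_cont _ _ _ (DF _ Hw)).
  apply Ccont_div. apply (kcont_fst (circ' r)). apply rcont_circ'.
  apply Ccont_minus. 2: apply Ccont_const. apply (kcont_fst (circ c r)). exact (rder_cont _ _ _ (rder_circ c r t)).
  simpl. now apply circ_neq. }
assert (cdk : forall t w, Cmod (q t w - c)%C < rho -> kcont dk t w).
{ intros t w Hw. unfold dk. apply Ccont_mult. apply Ccont_comp. apply cq. apply (Cf _ Hw).
  apply (kcont_fst (circ' r)). apply rcont_circ'. }
assert (Q0 : forall s : R, 0 <= s <= 1 -> forall t, Cmod (q t (RtoC s) - c)%C < rho).
{ intros s Hs. destruct (Q s Hs) as [d Hd]. apply Hd. replace (RtoC s - RtoC s)%C with (RtoC 0) by ring. rewrite Cmod_0. apply cond_pos. }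
assert (D : forall s : R, 0 <= s <= 1 -> cder (fun s => cint (fun t => k t s) 0 (2 * PI)) (RtoC s) (cint (fun t => dk t (RtoC s)) 0 (2 * PI))).
{ intros s Hs. apply cint_param_derive. lra.
  - apply locally_Cmod. destruct (Q s Hs) as [d Hd]. exists d. intros w Hw t _. specialize (Hd w Hw t). split.
    + assert (N := circ_neq c r a t Ha). unfold k, dk. eapply cder_eq.
      apply cder_mult. apply (cder_comp (q t) F). unfold q. apply cder_plus. apply cder_const.
      apply cder_mult. apply cder_id. apply cder_const. now apply DF. apply cder_const.
      change (q t w) with (a + w * (circ c r t - a))%C. cbv beta. field. auto.
    + apply (kcont_slice k). now apply ck.
  - intros t _. apply cdk. now apply Q0. }
(* Division by [s] excludes 0. The mean value inequality asks for the derivative only inside the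
   interval and for continuity at its ends. *)
assert (Z : forall s : R, 0 < s < 1 -> cint (fun t => dk t (RtoC s)) 0 (2 * PI) = RtoC 0).
{ intros s Hs. assert (n1 : RtoC s <> RtoC 0). { intros X. apply RtoC_inj in X. lra. }
  apply is_cint_unique. eapply is_cint_eq. apply (cint_derive (fun t => / RtoC s * F (q t (RtoC s)))%C). lra.
  - intros t _. eapply rder_eq. apply rder_scal. apply C_derive_comp_R. apply DF. apply Q0; lra.
    unfold q. apply rder_plus. apply rder_const. apply rder_scal. apply rder_minus. apply rder_circ. apply rder_const.
    unfold dk. change zero with (RtoC 0). field. auto.
  - intros t _. apply (kcont_slice dk). apply cdk. apply Q0; lra.
  - unfold q. rewrite circ_2PI. ring. }
assert (E : (cint (fun t => k t (RtoC 1)) 0 (2 * PI) - cint (fun t => k t (RtoC 0)) 0 (2 * PI))%C = RtoC 0).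
{ apply Cmod_eq_0. apply Rle_antisym. 2: apply Cmod_ge_0.
  apply Rle_trans with (0 * (1 - 0)). 2: lra.
  apply (mean_value_C (fun s => cint (fun t => k t (RtoC s)) 0 (2 * PI)) (fun _ => RtoC 0)). lra.
  - intros s Hs. eapply rder_eq. apply (rder_cder (fun s => cint (fun t => k t s) 0 (2 * PI))).
    apply (D s). lra. now apply Z.
  - intros s Hs. eapply rder_cont. apply (rder_cder (fun s => cint (fun t => k t s) 0 (2 * PI))). apply (D s Hs).
  - intros s _. rewrite Cmod_0. lra. }
assert (E1 : cint (fun t => k t (RtoC 1)) 0 (2 * PI) = cauchy_int c r (fun t => F (circ c r t) * circ' r t)%C 1 a).
{ apply cint_ext. lra. intros t _. unfold k, q.
  replace (a + RtoC 1 * (circ c r t - a))%C with (circ c r t) by ring. simpl.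
  field. now apply circ_neq. }
assert (E0 : cint (fun t => k t (RtoC 0)) 0 (2 * PI) = (F a * (Ci * RtoC (2 * PI)))%C).
{ rewrite <- (winding_number c r a) by (auto; lra). apply is_cint_unique.
  eapply is_cint_ext. lra.
  2:{ apply is_cint_scal. apply cint_correct. lra. intros t _.
      apply (kcont_slice (fun t a => circ' r t * (/ (circ c r t - a)) ^ 1)%C). apply kcont_cauchy; auto. apply rcont_circ'. }
  intros t _. unfold k, q. replace (a + RtoC 0 * (circ c r t - a))%C with a by ring. simpl.
  field. now apply circ_neq. }
rewrite E1, E0 in E.
assert (n : (Ci * RtoC (2 * PI))%C <> RtoC 0).
{ apply Cmult_neq_0. intros X. injection X. lra. intros X. apply RtoC_inj in X. lra. }
replace (cauchy_int c r (fun t => F (circ c r t) * circ' r t)%C 1 a)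
  with ((cauchy_int c r (fun t => F (circ c r t) * circ' r t)%C 1 a - F a * (Ci * RtoC (2 * PI))) + F a * (Ci * RtoC (2 * PI)))%C by ring.
rewrite E. field. repeat split; auto. intros X. apply RtoC_inj in X. lra. intros X; injection X; lra.
Qed.

(** * Holomorphic functions on the disc and its exterior *)

Lemma cdiff_cont (f : C -> C) z : cdiff f z -> ccont f z.
Proof. intros [l H]. exact (cder_cont _ _ _ H). Qed.

Lemma cdiff_C_derive (f : C -> C) z : cdiff f z -> cder f z (C_derive f z).
Proof. intros H. exact (C_derive_correct f z (RtoC 0) H). Qed.

Lemma open_disc_inside (U : C -> Prop) z : locally (T := C_UniformSpace) z U ->
  exists rho, 0 < rho /\ forall w, Cmod (w - z)%C < rho -> U w.
Proof. intros H. apply locally_Cmod in H. destruct H as [d Hd]. exists d. split. apply cond_pos. exact Hd. Qed.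

Lemma Cmod_minus_self z : Cmod (z - z)%C = 0.
Proof. replace (z - z)%C with (RtoC 0) by ring. apply Cmod_0. Qed.

Lemma rcont_circ_mult (F : C -> C) c r rho t : 0 <= r < rho -> (forall z, Cmod (z - c)%C < rho -> ccont F z) ->
  rcont (fun t => F (circ c r t) * circ' r t)%C t.
Proof.
intros Hr HF. apply Ccont_mult. 2: apply rcont_circ'.
apply Ccont_comp. exact (rder_cont _ _ _ (rder_circ c r t)). apply HF. rewrite Cmod_circ; lra.
Qed.

(** The formula represents the primitive [F], with kernel of order 1. Differentiating the
    representation gives [f] with order 2, its derivative [f1] with order 3, and the
    differentiability of [f1]. *)
Lemma holomorphic_derivative_local (f : C -> C) c rho : 0 < rho -> (forall z, Cmod (z - c)%C < rho -> cdiff f z) ->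
  exists f1 : C -> C, forall a, Cmod (a - c)%C < rho / 2 -> cder f a (f1 a) /\ cdiff f1 a.
Proof.
intros Hr Hf. destruct (holomorphic_primitive f c rho Hr Hf) as [F HF].
set (r := rho / 2). assert (Hr' : 0 < r < rho) by (unfold r; lra).
set (phi := fun t => (F (circ c r t) * circ' r t)%C).
assert (Hp : forall t, rcont phi t).
{ intros t. apply rcont_circ_mult with rho. lra. intros z Hz. exact (cder_cont _ _ _ (HF z Hz)). }
set (k := (/ (Ci * RtoC (2 * PI)))%C).
assert (E0 : forall a, Cmod (a - c)%C < r -> F a = (k * cauchy_int c r phi 1 a)%C).
{ intros a Ha. apply (cauchy_formula_C1 F f c rho r a Hr' Ha HF). intros z Hz. now apply cdiff_cont, Hf. }
assert (D : forall n a (l : C), Cmod (a - c)%C < r -> cder (fun a => l * cauchy_int c r phi n a)%C a (l * RtoC (INR n) * cauchy_int c r phi (S n) a)%C).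
{ intros n a l Ha. eapply cder_eq. apply cder_scal. now apply cauchy_int_derive. ring. }
assert (E1 : forall a, Cmod (a - c)%C < r -> f a = (k * RtoC (INR 1) * cauchy_int c r phi 2 a)%C).
{ intros a Ha. apply (is_derive_C_unique F a). apply HF. lra.
  eapply cder_ext_loc. 2: now apply D.
  generalize (disc_nbhd c r a Ha). apply filter_imp. intros w Hw. symmetry. now apply E0. }
exists (fun a => k * RtoC (INR 1) * RtoC (INR 2) * cauchy_int c r phi 3 a)%C.
intros a Ha. split.
- eapply cder_ext_loc. 2: now apply D.
  generalize (disc_nbhd c r a Ha). apply filter_imp. intros w Hw. symmetry. now apply E1.
- eexists. now apply D.
Qed.

Section Open.
Context (U : C -> Prop) (Uo : forall z, U z -> locally (T := C_UniformSpace) z U).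

Lemma holomorphic_derivative (f : C -> C) : (forall z, U z -> cdiff f z) -> forall z, U z -> cdiff (C_derive f) z.
Proof.
intros Hf z Hz. destruct (open_disc_inside U z (Uo z Hz)) as (rho & Hr & Hd).
destruct (holomorphic_derivative_local f z rho Hr) as [f1 H1]. intros w Hw. now apply Hf, Hd.
destruct (proj2 (H1 z ltac:(rewrite Cmod_minus_self; lra))) as [l Hl]. exists l.
eapply cder_ext_loc. 2: exact Hl.
generalize (disc_nbhd z (rho / 2) z ltac:(rewrite Cmod_minus_self; lra)). apply filter_imp.
intros w Hw. symmetry. apply is_C_derive_unique. now apply H1.
Qed.

(** Cauchy's formula passes to the uniform limit. So [f] is locally a Cauchy integral with
    continuous density, and such integrals are differentiable. *)
Lemma holomorphic_uniform_limit (f : C -> C) : (forall z, U z -> ccont f z) ->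
  (forall eps, 0 < eps -> exists g : C -> C, (forall z, U z -> cdiff g z) /\ forall z, U z -> Cmod (f z - g z)%C <= eps) ->
  forall z, U z -> cdiff f z.
Proof.
intros Cf Lf z Hz. destruct (open_disc_inside U z (Uo z Hz)) as (rho & Hr & Hd).
set (r := rho / 2). assert (Hr' : 0 < r < rho) by (unfold r; lra).
set (k := (/ (Ci * RtoC (2 * PI)))%C).
set (phi := fun (f : C -> C) t => (f (circ z r t) * circ' r t)%C).
assert (Hp : forall g : C -> C, (forall z, U z -> ccont g z) -> forall t, rcont (phi g) t).
{ intros g Hg t. apply rcont_circ_mult with rho. lra. intros w Hw. now apply Hg, Hd. }
assert (E : forall a, Cmod (a - z)%C < r -> (f a - k * cauchy_int z r (phi f) 1 a)%C = RtoC 0).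
{ intros a Ha. apply Cmod_eq_0. apply Rle_antisym. 2: apply Cmod_ge_0.
  apply le_epsilon. intros eps he.
  assert (Da : 0 < r - Cmod (a - z)%C) by lra.
  (* Replacing [g] by [f] costs [eps / A] at the point [a], and [eps / A] times the rest of [A] in
     the integral: length of the parameter interval, speed [r], and kernel at most
     [/ (r - Cmod (a - z))]. *)
  set (A := 1 + Cmod k * (2 * PI) * (r * / (r - Cmod (a - z)%C))).
  assert (A0 : 0 < A). { unfold A. assert (0 <= Cmod k * (2 * PI) * (r * / (r - Cmod (a - z)%C))). 2: lra.
    apply Rmult_le_pos. apply Rmult_le_pos. apply Cmod_ge_0. apply PI2_ge_0. apply Rmult_le_pos. lra. apply Rlt_le, Rinv_0_lt_compat. lra. }
  destruct (Lf (eps / A)) as (g & G1 & G2). now apply Rdiv_lt_0_compat.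
  assert (he' : 0 < eps / A) by now apply Rdiv_lt_0_compat.
  assert (Cg : forall z, U z -> ccont g z) by (intros; now apply cdiff_cont, G1).
  assert (Eg : g a = (k * cauchy_int z r (phi g) 1 a)%C).
  { apply (cauchy_formula_C1 g (C_derive g) z rho r a Hr' Ha).
    intros w Hw. now apply cdiff_C_derive, G1, Hd.
    intros w Hw. apply cdiff_cont. apply holomorphic_derivative; auto. }
  assert (B : Cmod (cauchy_int z r (phi f) 1 a - cauchy_int z r (phi g) 1 a)%C <= (2 * PI - 0) * (eps / A * (r * / (r - Cmod (a - z)%C)))).
  { apply is_cint_bound with (fun t => phi f t * (/ (circ z r t - a)) ^ 1 - phi g t * (/ (circ z r t - a)) ^ 1)%C. apply PI2_ge_0.
    - intros t _. assert (N := circ_neq z r a t Ha). unfold phi.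
      replace (f (circ z r t) * circ' r t * (/ (circ z r t - a)) ^ 1 - g (circ z r t) * circ' r t * (/ (circ z r t - a)) ^ 1)%C
        with ((f (circ z r t) - g (circ z r t)) * (circ' r t * / (circ z r t - a)))%C by (simpl; ring).
      rewrite !Cmod_mult, Cmod_inv by auto.
      assert (Ec : Cmod (circ' r t) = r). { unfold circ'. rewrite !Cmod_mult, Cmod_Ci, Cmod_cis, Cmod_R, Rabs_pos_eq; lra. }
      rewrite Ec.
      assert (Bz : U (circ z r t)). { apply Hd. rewrite Cmod_circ; lra. }
      apply Rmult_le_compat. apply Cmod_ge_0. apply Rmult_le_pos. lra. apply Rlt_le, Rinv_0_lt_compat. now apply Cmod_gt_0.
      now apply G2. apply Rmult_le_compat_l. lra. apply Rinv_le_contravar. lra.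
      assert (X := Cmod_circ z r t ltac:(lra)). assert (Y := Cmod_triangle_minus (circ z r t) a z). lra.
    - apply is_cint_minus; (apply cint_correct; [apply PI2_ge_0|]); intros t _.
      apply (kcont_slice (fun t a => phi f t * (/ (circ z r t - a)) ^ 1)%C). now apply kcont_cauchy; auto.
      apply (kcont_slice (fun t a => phi g t * (/ (circ z r t - a)) ^ 1)%C). now apply kcont_cauchy; auto. }
  replace (f a - k * cauchy_int z r (phi f) 1 a)%C with ((f a - g a) - k * (cauchy_int z r (phi f) 1 a - cauchy_int z r (phi g) 1 a))%C
    by (rewrite Eg; ring).
  eapply Rle_trans. apply Cmod_triangle. rewrite Cmod_opp, Cmod_mult.
  assert (G3 : Cmod (f a - g a)%C <= eps / A). { apply G2, Hd. lra. }
  assert (G4 := Rmult_le_compat_l (Cmod k) _ _ (Cmod_ge_0 k) B).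
  replace (0 + eps) with (eps / A * A) by (field; lra).
  unfold A at 2. lra. }
exists (k * (RtoC (INR 1) * cauchy_int z r (phi f) 2 z))%C.
assert (Z0 : Cmod (z - z)%C < r) by (rewrite Cmod_minus_self; lra).
eapply cder_ext_loc. 2:{ apply cder_scal. apply cauchy_int_derive. exact Z0. now apply Hp. }
generalize (disc_nbhd z r z Z0). apply filter_imp. intros w Hw.
replace (k * cauchy_int z r (phi f) 1 w)%C with (f w - (f w - k * cauchy_int z r (phi f) 1 w))%C by ring.
rewrite (E w Hw). ring.
Qed.
End Open.

(** [cauchy_estimate] after the change of variable [a + rho * w]. The continuity of the derivative
    that it demands is now a consequence of differentiability. *)
Lemma cauchy_estimate_scaled (f : C -> C) a rho M : 0 < rho ->
  (forall z, Cmod (z - a)%C < 2 * rho -> cdiff f z) ->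
  (forall z, Cmod (z - a)%C < 2 * rho -> Cmod (f z) <= M) ->
  Cmod (C_derive f a) <= 2 * M / rho.
Proof.
intros Hr Hf HM.
assert (Hin : forall w, Cmod (w - RtoC 0)%C < 2 -> Cmod (a + RtoC rho * w - a)%C < 2 * rho).
{ intros w Hw. replace (a + RtoC rho * w - a)%C with (RtoC rho * w)%C by ring.
  replace (w - RtoC 0)%C with w in Hw by ring. rewrite Cmod_mult, Cmod_R, Rabs_pos_eq by lra. nra. }
assert (Ho : forall z, Cmod (z - a)%C < 2 * rho -> locally (T := C_UniformSpace) z (fun z => Cmod (z - a)%C < 2 * rho)).
{ intros z Hz. now apply disc_nbhd. }
assert (X := cauchy_estimate (fun w => f (a + RtoC rho * w)%C) (fun w => RtoC rho * C_derive f (a + RtoC rho * w))%C (RtoC 0) M).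
assert (D : forall w, cder (fun w => a + RtoC rho * w)%C w (RtoC rho)).
{ intros w. eapply cder_eq. apply cder_plus. apply cder_const. apply cder_scal. apply cder_id. ring. }
assert (Y : Cmod (RtoC rho * C_derive f (a + RtoC rho * RtoC 0))%C <= 2 * M).
{ apply X.
  - intros w Hw. apply (cder_comp (fun w => a + RtoC rho * w)%C f). apply D. apply cdiff_C_derive. now apply Hf, Hin.
  - intros w Hw. apply Ccont_scal. apply (Ccont_comp (T := C_UniformSpace) (fun w => a + RtoC rho * w)%C).
    exact (cder_cont _ _ _ (D w)). apply cdiff_cont.
    apply (holomorphic_derivative (fun z => Cmod (z - a)%C < 2 * rho) Ho f Hf). now apply Hin.
  - intros w Hw. apply HM, Hin. lra. }
replace (a + RtoC rho * RtoC 0)%C with a in Y by ring.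
rewrite Cmod_mult, Cmod_R, Rabs_pos_eq in Y by lra.
apply Rmult_le_reg_l with rho; auto. replace (rho * (2 * M / rho)) with (2 * M) by (field; lra). exact Y.
Qed.

Lemma disc_mult (t : R) (z : C) : 0 <= t <= 1 -> disc z -> disc (RtoC t * z)%C.
Proof.
unfold disc. intros Ht Hz. rewrite Cmod_mult, Cmod_R, Rabs_pos_eq by lra. generalize (Cmod_ge_0 z). nra.
Qed.

Lemma disc_mult_locally z : disc z -> locally (T := C_UniformSpace) z (fun w => forall t, 0 <= t <= 1 -> disc (RtoC t * w)%C).
Proof.
intros Hz. generalize (disc_open z Hz). apply filter_imp. intros w Hw t Ht. now apply disc_mult.
Qed.

Lemma kcont_dilate (phi : R -> R) (g : C -> C) t z : continuous phi t -> ccont g (RtoC (phi t) * z)%C ->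
  kcont (fun t z => g (RtoC (phi t) * z)%C) t z.
Proof.
intros Hp Hg. apply Ccont_comp; auto. apply Ccont_mult. 2: apply continuous_snd_RC.
apply (kcont_fst (fun t => RtoC (phi t))). now apply Ccont_RtoC.
Qed.

Lemma rder_dilate (g : C -> C) (phi : R -> R) dphi z t l : cder g (RtoC (phi t) * z)%C l -> is_derive phi t dphi ->
  rder (fun t => g (RtoC (phi t) * z)%C) t (RtoC dphi * z * l)%C.
Proof.
intros Hg Hp. apply (C_derive_comp_R g (fun t => RtoC (phi t) * z)%C). exact Hg.
eapply rder_eq. apply rder_mult. apply rder_RtoC. exact Hp. apply rder_const. cbv beta. ring.
Qed.

Lemma cder_dilate (g : C -> C) (s : R) z l : cder g (RtoC s * z)%C l -> cder (fun z => g (RtoC s * z)%C) z (RtoC s * l)%C.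
Proof.
intros Hg. apply (cder_comp (fun z => RtoC s * z)%C g). 2: exact Hg.
eapply cder_eq. apply cder_scal. apply cder_id. ring.
Qed.

(** Hadamard's formula: the quotient is the integral of f'(t z) over [[0, 1]], which has no special
    case at 0 and can be differentiated under the integral sign. *)
Lemma holomorphic_divide (f : C -> C) : (forall z, disc z -> cdiff f z) -> f (RtoC 0) = RtoC 0 ->
  exists k : C -> C, (forall z, disc z -> cdiff k z) /\ forall z, disc z -> f z = (z * k z)%C.
Proof.
intros Hf H0.
assert (H1 := holomorphic_derivative disc disc_open f Hf).
assert (H2 := holomorphic_derivative disc disc_open _ H1).
exists (fun z => cint (fun t => C_derive f (RtoC t * z)%C) 0 1). split.
- intros z Hz. exists (cint (fun t => RtoC t * C_derive (C_derive f) (RtoC t * z))%C 0 1).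
  apply (cint_param_derive (fun t z => C_derive f (RtoC t * z)%C) (fun t z => RtoC t * C_derive (C_derive f) (RtoC t * z))%C). lra.
  + generalize (disc_mult_locally z Hz). apply filter_imp. intros w Hw t Ht. split.
    * apply cder_dilate. now apply cdiff_C_derive, H1, Hw.
    * apply (kcont_slice (fun t w => C_derive f (RtoC t * w)%C)). apply (kcont_dilate (fun t => t)). apply continuous_id.
      now apply cdiff_cont, H1, Hw.
  + intros t Ht. apply Ccont_mult. apply (kcont_fst (fun t => RtoC t)). apply Ccont_RtoC, continuous_id.
    apply (kcont_dilate (fun t => t)). apply continuous_id. now apply cdiff_cont, H2, disc_mult.
- intros z Hz. transitivity (f (RtoC 1 * z) - f (RtoC 0 * z))%C.
  { replace (RtoC 0 * z)%C with (RtoC 0) by ring. rewrite H0. replace (RtoC 1 * z)%C with z by ring. ring. }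
  assert (Cd : forall t, 0 <= t <= 1 -> rcont (fun t => C_derive f (RtoC t * z)%C) t).
  { intros t Ht. apply (kcont_slice (fun t w => C_derive f (RtoC t * w)%C)). apply (kcont_dilate (fun t => t)). apply continuous_id.
    now apply cdiff_cont, H1, disc_mult. }
  rewrite <- (is_cint_unique (fun t => z * C_derive f (RtoC t * z))%C 0 1 (z * cint (fun t => C_derive f (RtoC t * z)%C) 0 1)%C).
  + symmetry. apply is_cint_unique. apply (cint_derive (fun t => f (RtoC t * z)%C)). lra.
    * intros t Ht. eapply rder_eq. apply (rder_dilate f (fun t => t)). apply cdiff_C_derive, Hf. now apply disc_mult.
      apply (is_derive_id (K := R_AbsRing)). unfold one; simpl. ring.
    * intros t Ht. apply Ccont_scal. now apply Cd.
  + apply is_cint_scal. apply cint_correct. lra. exact Cd.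
Qed.

(** A substitute for the maximum principle. For [Cmod z >= 1/2] division costs a factor 2; for
    smaller [z], Cauchy's estimate with radius parameter [1/4] bounds the derivative of [z * k z] by
    [2 * S / (1/4) = 8 * S], and the mean value inequality from 0 to [z] divides by [z]. The point 0
    is excluded from the hypothesis because it corresponds to infinity in the application. *)
Lemma divide_bound (k : C -> C) S : (forall z, disc z -> cdiff k z) -> (forall z, disc z -> z <> RtoC 0 -> Cmod (z * k z)%C <= S) ->
  forall z, disc z -> Cmod (k z) <= 8 * S.
Proof.
intros Hk HS'.
assert (S0 : 0 <= S).
{ eapply Rle_trans. apply Cmod_ge_0. apply (HS' (RtoC (1/2))). unfold disc. rewrite Cmod_R, Rabs_pos_eq; lra.
  intros X. apply RtoC_inj in X. lra. }
assert (HS : forall z, disc z -> Cmod (z * k z)%C <= S).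
{ intros z Hz. destruct (Ceq_dec z 0) as [->|N]. rewrite Cmult_0_l, Cmod_0. exact S0. auto. }
set (g := fun z => (z * k z)%C).
assert (Hg : forall z, disc z -> cder g z (k z + z * C_derive k z)%C).
{ intros z Hz. eapply cder_eq. apply cder_mult. apply cder_id. now apply cdiff_C_derive, Hk. cbv beta. ring. }
assert (B : forall w, Cmod w < 1 / 2 -> Cmod (C_derive g w) <= 8 * S).
{ intros w Hw. replace (8 * S) with (2 * S / (1 / 4)) by field.
  assert (X : forall z, Cmod (z - w)%C < 2 * (1 / 4) -> disc z).
  { intros z Hz. unfold disc. eapply Rle_lt_trans. apply (Cmod_le_plus_minus z w). lra. }
  apply cauchy_estimate_scaled. lra.
  - intros z Hz. eexists. now apply Hg, X.
  - intros z Hz. now apply HS, X. }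
intros z Hz. destruct (Rle_lt_dec (1 / 2) (Cmod z)) as [H|H].
- specialize (HS z Hz). rewrite Cmod_mult in HS. generalize (Cmod_ge_0 (k z)). nra.
- destruct (Ceq_dec z 0) as [->|N].
  + replace (k (RtoC 0)) with (C_derive g (RtoC 0)). now apply B.
    apply is_C_derive_unique. eapply cder_eq. now apply Hg. ring.
  + assert (X : Cmod (g z - g (RtoC 0) - (z - RtoC 0) * RtoC 0)%C <= 8 * S * Cmod (z - RtoC 0)%C).
    { apply mean_value_segment with (C_derive g).
      - intros t Ht. apply cdiff_C_derive. eexists. apply Hg. unfold segment.
        replace (RtoC 0 + RtoC t * (z - RtoC 0))%C with (RtoC t * z)%C by ring. now apply disc_mult.
      - intros t Ht. unfold segment.
        replace (RtoC 0 + RtoC t * (z - RtoC 0))%C with (RtoC t * z)%C by ring.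
        replace (C_derive g (RtoC t * z) - RtoC 0)%C with (C_derive g (RtoC t * z))%C by ring.
        apply B. rewrite Cmod_mult, Cmod_R, Rabs_pos_eq by lra. generalize (Cmod_ge_0 z). nra. }
    replace (g z - g (RtoC 0) - (z - RtoC 0) * RtoC 0)%C with (z * k z)%C in X by (unfold g; ring).
    replace (z - RtoC 0)%C with z in X by ring. rewrite Cmod_mult in X.
    apply Cmod_gt_0 in N. apply Rmult_le_reg_l with (Cmod z); auto. lra.
Qed.

Lemma exterior_neq0 z : exterior z -> z <> RtoC 0.
Proof. intros Hz. apply Cmod_gt_0. unfold exterior in Hz. lra. Qed.

Lemma inv_exterior z : exterior z -> disc (/ z)%C.
Proof.
intros Hz. unfold disc. rewrite Cmod_inv by now apply exterior_neq0.
rewrite <- Rinv_1. apply Rinv_lt_contravar; unfold exterior in Hz; lra.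
Qed.

Lemma inv_disc z : disc z -> z <> RtoC 0 -> exterior (/ z)%C.
Proof.
intros Hz N. unfold exterior. rewrite Cmod_inv by auto.
apply Cmod_gt_0 in N. rewrite <- Rinv_1. apply Rinv_lt_contravar; unfold disc in Hz; lra.
Qed.

Lemma Cinv_inv z : z <> RtoC 0 -> (/ / z)%C = z.
Proof. intros N. field. auto. Qed.

(* Riemann's removable singularity theorem at infinity: with [q z = g (1 / z)], the function
   [z q z] is differentiable at 0 with derivative [lim q = 0], so it is divisible by [z] twice. *)
Lemma holomorphic_inversion (g : C -> C) : (forall z, exterior z -> cdiff g z) ->
  (forall eps, 0 < eps -> exists M, forall z, exterior z -> M < Cmod z -> Cmod (g z) < eps) ->
  exists k : C -> C, (forall z, disc z -> cdiff k z) /\ forall z, exterior z -> g z = (k (/ z) / z)%C.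
Proof.
intros Hg Lg.
set (q := fun z => if Ceq_dec z 0 then RtoC 0 else g (/ z)%C).
assert (q0 : q (RtoC 0) = RtoC 0). { unfold q. now destruct Ceq_dec. }
assert (qn : forall z, z <> RtoC 0 -> q z = g (/ z)%C). { intros z N. unfold q. now destruct Ceq_dec. }
assert (D0 : cder (fun z => z * q z)%C (RtoC 0) (RtoC 0)).
{ apply cder_slope. exists q. repeat split; auto.
  - unfold continuous. rewrite q0. apply clim_eps. apply locally_filter. intros eps he.
    destruct (Lg eps he) as [M HM]. apply locally_Cmod.
    assert (dp : 0 < / (Rmax M 1)). { apply Rinv_0_lt_compat. eapply Rlt_le_trans. 2: apply Rmax_r. lra. }
    exists (mkposreal _ dp). simpl. intros w Hw. replace (w - RtoC 0)%C with w in Hw by ring.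
    replace (q w - RtoC 0)%C with (q w) by ring.
    destruct (Ceq_dec w 0) as [->|N]. rewrite q0, Cmod_0; auto.
    assert (P := N). apply Cmod_gt_0 in P. rewrite qn by auto.
    assert (L : Rmax M 1 < / Cmod w).
    { rewrite <- (Rinv_inv (Rmax M 1)). apply Rinv_lt_contravar; auto. now apply Rmult_lt_0_compat. }
    assert (L1 := Rmax_l M 1). assert (L2 := Rmax_r M 1).
    apply HM; unfold exterior; rewrite Cmod_inv by auto; lra.
  - intros w. ring. }
destruct (holomorphic_divide (fun z => z * q z)%C) as (k1 & K1 & E1).
{ intros z Hz. destruct (Ceq_dec z 0) as [->|N]. eexists; exact D0.
  eexists. apply cder_mult. apply cder_id.
  eapply cder_ext_loc with (f := fun z => g (/ z)%C).
  { assert (P := N). apply Cmod_gt_0 in P. generalize (Cmod_gt_locally z 0 P). apply filter_imp.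
    intros w Hw. apply Cmod_gt_0 in Hw. symmetry. now apply qn. }
  apply (cder_comp (fun z => / z)%C g). now apply cder_inv. apply cdiff_C_derive, Hg. now apply inv_disc. }
{ ring. }
assert (d0 : disc (RtoC 0)). { unfold disc. rewrite Cmod_0. lra. }
assert (Z : k1 (RtoC 0) = RtoC 0).
{ apply (is_derive_C_unique (fun z => z * k1 z)%C (RtoC 0)).
  - eapply cder_eq. apply cder_mult. apply cder_id. apply cdiff_C_derive, K1; auto. cbv beta. ring.
  - eapply cder_ext_loc. 2: exact D0. generalize (disc_open _ d0). apply filter_imp. intros w Hw. simpl. now apply E1. }
destruct (holomorphic_divide k1 K1 Z) as (k & K2 & E2).
exists k. split; auto. intros z Hz.
assert (N := exterior_neq0 z Hz). assert (Nz : (/ z)%C <> RtoC 0).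
{ apply Cmod_gt_0. rewrite Cmod_inv by auto. apply Rinv_0_lt_compat. now apply Cmod_gt_0. }
assert (X := E1 _ (inv_exterior z Hz)). simpl in X. rewrite (E2 _ (inv_exterior z Hz)), qn, Cinv_inv in X by auto.
assert (Y : (z * (/ z * g z) = z * (/ z * (/ z * k (/ z))))%C) by now rewrite X.
replace (z * (/ z * g z))%C with (g z) in Y by (field; auto). rewrite Y. field. auto.
Qed.

(** * The operator z d/dz + 1/2 and its inverse on the disc *)

Definition euler_op (f : C -> C) (z : C) : C := (z * C_derive f z + RtoC (1 / 2) * f z)%C.

Lemma is_derive_sqr t : is_derive (fun u => u ^ 2) t (2 * t).
Proof. auto_derive; auto; ring. Qed.

(* The solution is the integral of [s^(-1/2) k (s z)] over [0, 1]; [s = t^2] removes the singular weight. *)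
Lemma euler_op_surjective (k : C -> C) : (forall z, disc z -> cdiff k z) ->
  (exists g, continuous_on (T := C_UniformSpace) (U := C_UniformSpace) closed_disc g /\ forall z, disc z -> g z = k z) ->
  exists m : C -> C, (forall z, disc z -> cdiff m z) /\ (forall z, disc z -> euler_op m z = k z) /\
    exists h, (forall z, ccont h z) /\ forall z, disc z -> h z = m z.
Proof.
intros Hk (g & Cg & Eg).
assert (Hk1 := holomorphic_derivative disc disc_open k Hk).
assert (T2 : forall t : R, 0 <= t <= 1 -> 0 <= t ^ 2 <= 1) by (intros t Ht; simpl; nra).
set (m := fun z => (RtoC 2 * cint (fun t => k (RtoC (t ^ 2) * z)%C) 0 1)%C).
set (dm := fun z => (RtoC 2 * cint (fun t => RtoC (t ^ 2) * C_derive k (RtoC (t ^ 2) * z))%C 0 1)%C).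
assert (Cs : forall t : R, continuous (fun u : R => u ^ 2) t).
{ intros t. apply (ex_derive_continuous (V := R_NormedModule)). eexists. apply is_derive_sqr. }
assert (c1 : forall t z, 0 <= t <= 1 -> disc z -> kcont (fun t z => k (RtoC (t ^ 2) * z)%C) t z).
{ intros t z Ht Hz. apply (kcont_dilate (fun t => t ^ 2)); auto. apply cdiff_cont, Hk. apply disc_mult; auto. }
assert (c2 : forall t z, 0 <= t <= 1 -> disc z -> kcont (fun t z => RtoC (t ^ 2) * C_derive k (RtoC (t ^ 2) * z))%C t z).
{ intros t z Ht Hz. apply Ccont_mult. apply (kcont_fst (fun t => RtoC (t ^ 2))). now apply Ccont_RtoC.
  apply (kcont_dilate (fun t => t ^ 2)); auto. apply cdiff_cont, Hk1. apply disc_mult; auto. }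
assert (D : forall z, disc z -> cder m z (dm z)).
{ intros z Hz. apply cder_scal.
  apply (cint_param_derive (fun t z => k (RtoC (t ^ 2) * z)%C) (fun t z => RtoC (t ^ 2) * C_derive k (RtoC (t ^ 2) * z))%C). lra.
  - generalize (disc_open z Hz). apply filter_imp. intros w Hw t Ht. split.
    + apply cder_dilate. apply cdiff_C_derive, Hk. apply disc_mult; auto.
    + apply (kcont_slice (fun t z => k (RtoC (t ^ 2) * z)%C)). auto.
  - auto. }
exists m. split; [|split].
- intros z Hz. eexists. now apply D.
- intros z Hz. unfold euler_op. rewrite (is_C_derive_unique _ _ _ (D z Hz)).
  assert (I1 : is_cint (fun t => k (RtoC (t ^ 2) * z)%C) 0 1 (cint (fun t => k (RtoC (t ^ 2) * z)%C) 0 1)).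
  { apply cint_correct. lra. intros t Ht. apply (kcont_slice (fun t z => k (RtoC (t ^ 2) * z)%C)). auto. }
  assert (I2 : is_cint (fun t => RtoC (t ^ 2) * C_derive k (RtoC (t ^ 2) * z))%C 0 1
    (cint (fun t => RtoC (t ^ 2) * C_derive k (RtoC (t ^ 2) * z))%C 0 1)).
  { apply cint_correct. lra. intros t Ht. apply (kcont_slice (fun t z => RtoC (t ^ 2) * C_derive k (RtoC (t ^ 2) * z))%C). auto. }
  assert (X := is_cint_plus _ _ _ _ _ _ I1 (is_cint_scal (RtoC 2 * z)%C _ _ _ _ I2)).
  apply is_cint_unique in X.
  (* The sum of the two integrands is the derivative of [t * k (t^2 z)], whose increment over
     [[0, 1]] is [k z]. *)
  assert (Y : is_cint (fun t => k (RtoC (t ^ 2) * z) + RtoC 2 * z * (RtoC (t ^ 2) * C_derive k (RtoC (t ^ 2) * z)))%C 0 1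
    (RtoC 1 * k (RtoC (1 ^ 2) * z) - RtoC 0 * k (RtoC (0 ^ 2) * z))%C).
  { apply (cint_derive (fun t => RtoC t * k (RtoC (t ^ 2) * z))%C). lra.
    - intros t Ht. eapply rder_eq. apply rder_mult. apply rder_RtoC. apply (is_derive_id (K := R_AbsRing)).
      apply (rder_dilate k (fun t => t ^ 2)). apply cdiff_C_derive, Hk. apply disc_mult; auto. apply is_derive_sqr.
      unfold one; simpl. rewrite !RtoC_mult. ring.
    - intros t Ht. apply Ccont_plus. apply (kcont_slice (fun t z => k (RtoC (t ^ 2) * z)%C)). auto.
      apply Ccont_scal. apply (kcont_slice (fun t z => RtoC (t ^ 2) * C_derive k (RtoC (t ^ 2) * z))%C). auto. }
  apply is_cint_unique in Y. rewrite X in Y. unfold m, dm.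
  replace (k z) with (RtoC 1 * k (RtoC (1 ^ 2) * z) - RtoC 0 * k (RtoC (0 ^ 2) * z))%C.
  2:{ replace (1 ^ 2) with 1 by ring. replace (RtoC 1 * z)%C with z by ring. ring. }
  rewrite <- Y.
  assert (h2 : (RtoC (1 / 2) * RtoC 2 = 1)%C) by (rewrite <- RtoC_mult; f_equal; field).
  match goal with |- (?x + RtoC (1/2) * (RtoC 2 * ?y) = _)%C => replace (x + RtoC (1/2) * (RtoC 2 * y))%C with (x + (RtoC (1/2) * RtoC 2) * y)%C by ring end.
  rewrite h2. ring.
(* Composing [g] with the radial retraction onto the closed disc extends it continuously to the
   plane. Continuity of the parametric integral then needs no one-sided version at boundary
   points. *)
- set (g' := fun z => g (z / RtoC (Rmax 1 (Cmod z)))%C).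
  assert (mp : forall z, 0 < Rmax 1 (Cmod z)). { intros z. eapply Rlt_le_trans. 2: apply Rmax_l. lra. }
  assert (mc : forall z, closed_disc (z / RtoC (Rmax 1 (Cmod z)))%C).
  { intros z. unfold closed_disc. rewrite Cmod_div, Cmod_R, Rabs_pos_eq.
    apply Rmult_le_reg_r with (Rmax 1 (Cmod z)). auto. unfold Rdiv. rewrite Rmult_assoc, Rinv_l, Rmult_1_r, Rmult_1_l. apply Rmax_r.
    generalize (mp z); lra. generalize (mp z); lra. intros X. apply RtoC_inj in X. generalize (mp z); lra. }
  assert (Cg' : forall z, ccont g' z).
  { intros z. unfold continuous, g'.
    eapply filterlim_comp. 2: exact (Cg _ (mc z)).
    assert (L : ccont (fun z => z / RtoC (Rmax 1 (Cmod z)))%C z).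
    { apply Ccont_div. apply continuous_id. apply Ccont_RtoC.
      apply (continuous_comp (V := R_UniformSpace) Cmod (fun x => Rmax 1 x)).
      apply continuous_Cmod, continuous_id.
      apply continuity_pt_filterlim. apply continuity_pt_ext with (fun x => (1 + x + Rabs (1 - x)) / 2).
      { intros x. unfold Rmax. destruct Rle_dec. rewrite Rabs_left1; lra. rewrite Rabs_pos_eq; lra. }
      reg.
      intros X. apply RtoC_inj in X. generalize (mp z); lra. }
    intros P HP. specialize (L _ HP). revert L. unfold filtermap. apply filter_imp.
    intros x Hx. apply Hx, mc. }
  exists (fun z => (RtoC 2 * cint (fun t => g' (RtoC (t ^ 2) * z)%C) 0 1)%C). split.
  + intros z. apply Ccont_scal. apply (cint_param_continuous (fun t z => g' (RtoC (t ^ 2) * z)%C)). lra.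
    apply filter_forall. intros w t _. apply (kcont_dilate (fun t => t ^ 2)); auto.
  + intros z Hz. unfold m. f_equal. apply cint_ext. lra. intros t Ht.
    assert (Hd : disc (RtoC (t ^ 2) * z)%C). { apply disc_mult; auto. apply T2. lra. }
    unfold g'. rewrite Rmax_left by (unfold disc in Hd; lra).
    rewrite <- Eg by auto. f_equal. field.
Qed.

(* [t m (t^2 z)] has derivative [2 (euler_op m) (t^2 z)] in [t]. *)
Lemma euler_op_bound (m : C -> C) S : (forall z, disc z -> cdiff m z) ->
  (forall z, disc z -> z <> RtoC 0 -> Cmod (euler_op m z) <= S) -> forall z, disc z -> Cmod (m z) <= 2 * S.
Proof.
intros Hm HS z Hz.
assert (T2 : forall t : R, 0 <= t <= 1 -> 0 <= t ^ 2 <= 1) by (intros t Ht; simpl; nra).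
assert (S0 : 0 <= S).
{ eapply Rle_trans. apply Cmod_ge_0. apply (HS (RtoC (1/2))). unfold disc. rewrite Cmod_R, Rabs_pos_eq; lra.
  intros X. apply RtoC_inj in X. lra. }
(* No bound is assumed at 0, so there it is recovered from nearby points by continuity. For other
   [z] the path [t^2 z] with [t > 0] avoids 0. *)
destruct (Ceq_dec z 0) as [E|N].
{ apply le_epsilon. intros eps he.
  assert (X := holomorphic_derivative disc disc_open m Hm).
  assert (Ce : ccont (euler_op m) z).
  { unfold euler_op. apply Ccont_plus. apply Ccont_mult. apply continuous_id. apply cdiff_cont. auto.
    apply Ccont_scal. apply cdiff_cont. auto. }
  assert (Y := proj1 (clim_eps _ _ _) Ce (eps / 2) ltac:(lra)). apply locally_Cmod in Y. destruct Y as [d Hd].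
  set (r := Rmin (d / 2) (1 / 2)). assert (Hr : 0 < r). { apply Rmin_glb_lt. generalize (cond_pos d); lra. lra. }
  assert (r1 : r <= d / 2) by apply Rmin_l. assert (r2 : r <= 1 / 2) by apply Rmin_r.
  assert (dr : Cmod (RtoC r) = r) by (rewrite Cmod_R, Rabs_pos_eq; lra).
  assert (B1 := Hd (RtoC r)). subst z. replace (RtoC r - RtoC 0)%C with (RtoC r) in B1 by ring.
  rewrite dr in B1. assert (B2 := HS (RtoC r)).
  unfold disc in B2. rewrite dr in B2.
  assert (B3 : Cmod (euler_op m (RtoC 0)) <= S + eps / 2).
  { eapply Rle_trans. apply (Cmod_le_plus_minus _ (euler_op m (RtoC r))). rewrite Cmod_minus_sym.
    apply Rplus_le_compat. apply B2. lra. intros Y. apply RtoC_inj in Y. lra. apply Rlt_le, B1. generalize (cond_pos d); lra. }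
  unfold euler_op in B3. rewrite Cmult_0_l, Cplus_0_l, Cmod_half in B3. lra. }
set (h := fun t => (RtoC t * m (RtoC (t ^ 2) * z))%C).
assert (Dh : forall t, 0 <= t <= 1 -> rder h t (RtoC 2 * euler_op m (RtoC (t ^ 2) * z))%C).
{ intros t Ht. eapply rder_eq. apply rder_mult. apply rder_RtoC. apply (is_derive_id (K := R_AbsRing)).
  apply (rder_dilate m (fun t => t ^ 2)). apply cdiff_C_derive, Hm. apply disc_mult; auto. apply is_derive_sqr.
  unfold one, euler_op; simpl. rewrite !RtoC_mult.
  assert (h2 : (RtoC 2 * RtoC (1 / 2) = 1)%C) by (rewrite <- RtoC_mult; f_equal; field).
  rewrite Cmult_plus_distr_l, (Cmult_assoc (RtoC 2) (RtoC (1 / 2))), h2. ring. }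
assert (X := mean_value_C h _ 0 1 (2 * S) ltac:(lra) (fun t Ht => Dh t ltac:(lra)) (fun t Ht => rder_cont _ _ _ (Dh t Ht))).
unfold h in X at 1 2.
replace (RtoC 1 * m (RtoC (1 ^ 2) * z) - RtoC 0 * m (RtoC (0 ^ 2) * z))%C with (m z) in X.
2:{ replace (1 ^ 2) with 1 by ring. replace (RtoC 1 * z)%C with z by ring. ring. }
rewrite Rminus_0_r, Rmult_1_r in X. apply X.
intros t Ht. rewrite Cmod_mult, Cmod_R, Rabs_pos_eq by lra. apply Rmult_le_compat_l. lra.
apply HS. apply disc_mult; auto. apply T2. lra. apply Cmult_neq_0; auto. intros Y. apply RtoC_inj in Y. simpl in Y. nra.
Qed.

(** * Derivatives with continuous extensions *)

(** Subtracting two pairs with a common entry gives a pair with an entry 0, and the norm bounds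
    force the other entry to be 0. So the relation is a bijection, and the same bounds make it
    bicontinuous. *)
Lemma isomorphism_of_relation {E F : NormedModule C_AbsRing} (Rel : E -> F -> Prop) (A B : R) :
  (forall x1 y1 x2 y2, Rel x1 y1 -> Rel x2 y2 -> Rel (plus x1 x2) (plus y1 y2)) ->
  (forall c x y, Rel x y -> Rel (scal c x) (scal c y)) ->
  (forall x, exists y, Rel x y) -> (forall y, exists x, Rel x y) ->
  (forall x y, Rel x y -> norm y <= A * norm x) ->
  (forall x y, Rel x y -> norm x <= B * norm y) ->
  exists Phi : E -> F, isomorphism Phi /\ forall x, Rel x (Phi x).
Proof.
intros Rp Rs Tl Tr Ba Bb.
assert (Rm : forall x1 y1 x2 y2, Rel x1 y1 -> Rel x2 y2 -> Rel (minus x1 x2) (minus y1 y2)).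
{ intros x1 y1 x2 y2 H1 H2. assert (X := Rs (opp one) _ _ H2). rewrite !scal_opp_one in X. exact (Rp _ _ _ _ H1 X). }
assert (Fl : forall x y1 y2, Rel x y1 -> Rel x y2 -> y1 = y2).
{ intros x y1 y2 H1 H2. apply (plus_reg_r (opp y2)). fold (minus y1 y2). rewrite plus_opp_r. apply norm_eq_zero.
  apply Rle_antisym. 2: apply norm_ge_0. assert (Z : norm (minus x x) = 0) by (rewrite minus_eq_zero; exact norm_zero).
  eapply Rle_trans. exact (Ba _ _ (Rm _ _ _ _ H1 H2)). rewrite Z. lra. }
assert (Fr : forall x1 x2 y, Rel x1 y -> Rel x2 y -> x1 = x2).
{ intros x1 x2 y H1 H2. apply (plus_reg_r (opp x2)). fold (minus x1 x2). rewrite plus_opp_r. apply norm_eq_zero.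
  apply Rle_antisym. 2: apply norm_ge_0. assert (Z : norm (minus y y) = 0) by (rewrite minus_eq_zero; exact norm_zero).
  eapply Rle_trans. exact (Bb _ _ (Rm _ _ _ _ H1 H2)). rewrite Z. lra. }
set (Phi := fun x => proj1_sig (constructive_indefinite_description _ (Tl x))).
set (Psi := fun y => proj1_sig (constructive_indefinite_description _ (Tr y))).
assert (HPhi : forall x, Rel x (Phi x)). { intros x. unfold Phi. now destruct constructive_indefinite_description. }
assert (HPsi : forall y, Rel (Psi y) y). { intros x. unfold Psi. now destruct constructive_indefinite_description. }
(* [is_linear] asks for a positive constant, while [A] and [B] are arbitrary reals. *)
assert (Ab : forall M x y z, x <= M * y -> 0 <= y -> z = Rmax M 0 + 1 -> x <= z * y).
{ intros M x y z H1 H2 ->. eapply Rle_trans. exact H1. apply Rmult_le_compat_r; auto. generalize (Rmax_l M 0); lra. }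
assert (Ap : forall M, 0 < Rmax M 0 + 1). { intros M. generalize (Rmax_r M 0); lra. }
exists Phi. split; auto. split; [|split; [|split]].
- intros x y. apply (Fl (plus x y)); auto.
- intros c x. apply (Fl (scal c x)); auto.
- intros x. apply linear_cont. split.
  + intros u v. apply (Fl (plus u v)); auto.
  + intros c u. apply (Fl (scal c u)); auto.
  + exists (Rmax A 0 + 1). split; auto. intros u. apply (Ab A); auto. apply norm_ge_0.
- exists Psi. split; [|split].
  + intros x. apply (Fr _ _ (Phi x)); auto.
  + intros y. apply (Fl (Psi y)); auto.
  + intros y. apply linear_cont. split.
    * intros u v. apply (Fr _ _ (plus u v)); auto.
    * intros c u. apply (Fr _ _ (scal c u)); auto.
    * exists (Rmax B 0 + 1). split; auto. intros u. apply (Ab B); auto. apply norm_ge_0.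
Qed.

Notation cont_on K g := (continuous_on (T := C_UniformSpace) (U := C_UniformSpace) K g).

Lemma cont_on_eps (K : C -> Prop) (g : C -> C) z : cont_on K g -> K z ->
  forall eps, 0 < eps -> exists d : posreal, forall w, K w -> Cmod (w - z)%C < d -> Cmod (g w - g z)%C < eps.
Proof.
intros H Hz eps he. assert (X := proj1 (clim_eps _ _ _) (H z Hz) eps he).
apply locally_Cmod in X. destruct X as [d Hd]. exists d. auto.
Qed.

Lemma cont_on_plus K f g : cont_on K f -> cont_on K g -> cont_on K (fun z => f z + g z)%C.
Proof. intros Hf Hg z Hz. apply (clim_plus (within K (locally (T := C_UniformSpace) z))). now apply Hf. now apply Hg. Qed.
Lemma cont_on_mult K f g : cont_on K f -> cont_on K g -> cont_on K (fun z => f z * g z)%C.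
Proof. intros Hf Hg z Hz. apply (clim_mult (within K (locally (T := C_UniformSpace) z))). now apply Hf. now apply Hg. Qed.
Lemma cont_on_of_ccont (K : C -> Prop) (g : C -> C) : (forall z, K z -> ccont g z) -> cont_on K g.
Proof. intros H z Hz. eapply filterlim_filter_le_1. 2: now apply H. intros P. unfold within. apply filter_imp. auto. Qed.
Lemma cont_on_scal K c g : cont_on K g -> cont_on K (fun z => c * g z)%C.
Proof. intros H. apply cont_on_mult; auto. apply cont_on_of_ccont. intros; apply Ccont_const. Qed.
Lemma cont_on_id K : cont_on K (fun z => z).
Proof. apply cont_on_of_ccont. intros; apply continuous_id. Qed.

(** Meant for [f2] with a denominator [z] and [f1] controlled only near 0. Agreement on a whole
    annulus inside the seam gives continuity at the seam itself, where [f2] is the formula in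
    force. *)
Lemma cont_on_glue (K : C -> Prop) (f1 f2 : C -> C) :
  (forall z, K z -> Cmod z < 1 / 2 -> ccont f1 z) ->
  (forall z, K z -> 1 / 4 < Cmod z -> clim (within K (locally (T := C_UniformSpace) z)) f2 (f2 z)) ->
  (forall z, K z -> 1 / 4 < Cmod z < 1 / 2 -> f1 z = f2 z) ->
  cont_on K (fun z => if Rlt_dec (Cmod z) (1 / 2) then f1 z else f2 z).
Proof.
intros H1 H2 E z Hz. destruct (Rlt_dec (Cmod z) (1 / 2)) as [L|L].
- apply (filterlim_ext_loc f1).
  + unfold within. generalize (Cmod_lt_locally z (1 / 2) L). apply filter_imp. intros w Hw _.
    destruct Rlt_dec; tauto.
  + eapply filterlim_filter_le_1. 2: now apply H1. intros P. unfold within. apply filter_imp. auto.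
- apply (filterlim_ext_loc f2).
  + assert (L' : 1 / 4 < Cmod z) by lra.
    unfold within. generalize (Cmod_gt_locally z (1 / 4) L'). apply filter_imp. intros w Hw Kw.
    destruct Rlt_dec; auto. symmetry. apply E; auto.
  + apply H2; auto. lra.
Qed.

Section Jets.
Context (U K : C -> Prop).
Context (Uo : forall z, U z -> locally (T := C_UniformSpace) z U).
Context (UK : forall z, U z -> K z).
Context (Ud : forall z, K z -> forall eps : posreal, exists w, U w /\ ball (M := C_UniformSpace) z eps w).

Definition Cderive_n (l : nat) (f : C -> C) : C -> C := Nat.iter l C_derive f.

Lemma Cderive_n_holomorphic (f : C -> C) l : (forall z, U z -> cdiff f z) -> forall z, U z -> cdiff (Cderive_n l f) z.
Proof. intros Hf. induction l as [|l IH]; simpl; auto. intros z Hz. now apply (holomorphic_derivative U Uo). Qed.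

Lemma Cderive_n_correct (f : C -> C) l : (forall z, U z -> cdiff f z) ->
  forall z, U z -> cder (Cderive_n l f) z (Cderive_n (S l) f z).
Proof. intros Hf z Hz. apply cdiff_C_derive. now apply Cderive_n_holomorphic. Qed.

Lemma eq_on_U_loc (f g : C -> C) z : (forall z, U z -> f z = g z) -> U z ->
  locally (T := C_UniformSpace) z (fun w => f w = g w).
Proof. intros E Hz. generalize (Uo z Hz). apply filter_imp. exact E. Qed.

Lemma cdiff_ext_U (f g : C -> C) : (forall z, U z -> f z = g z) -> (forall z, U z -> cdiff f z) ->
  forall z, U z -> cdiff g z.
Proof.
intros E Hf z Hz. destruct (Hf z Hz) as [l Hl]. exists l. eapply cder_ext_loc. 2: exact Hl.
now apply eq_on_U_loc.
Qed.

Lemma Cderive_n_ext (f g : C -> C) l : (forall z, U z -> cdiff f z) -> (forall z, U z -> f z = g z) ->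
  forall z, U z -> Cderive_n l f z = Cderive_n l g z.
Proof.
intros Hf E. induction l as [|l IH]; auto. intros z Hz. symmetry. apply is_C_derive_unique.
eapply cder_ext_loc. 2: now apply Cderive_n_correct. apply eq_on_U_loc; auto.
Qed.

Lemma Cderive_n_is_nderive (f : C -> C) l : (forall z, U z -> cdiff f z) ->
  is_nderive (K := C_AbsRing) (V := C_NormedModule) U f l (Cderive_n l f).
Proof.
intros Hf. induction l as [|l IH]; simpl; auto.
exists (Cderive_n l f). split; auto. intros z Hz. now apply Cderive_n_correct.
Qed.

Lemma is_nderive_ext_r (f g h : C -> C) l : (forall z, U z -> g z = h z) ->
  is_nderive (K := C_AbsRing) (V := C_NormedModule) U f l g ->
  is_nderive (K := C_AbsRing) (V := C_NormedModule) U f l h.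
Proof.
intros E. destruct l as [|l]; simpl.
- intros H z Hz. now rewrite <- E, H.
- intros (k & H1 & H2). exists k. split; auto. intros z Hz. rewrite <- E by auto. now apply H2.
Qed.

(** Derivatives of all orders exist, so the inductive predicate [is_nderive] can be replaced by an
    equation with the iterated [C_derive], a total function. *)
Lemma holo_jet_iff (f : {z : C | U z} -> C) l g : holomorphic f ->
  holo_jet K f l g <-> (forall z, U z -> g z = Cderive_n l (ext0 f) z) /\ cont_on K g.
Proof.
intros Hf. split; intros [H1 H2]; split; auto.
- intros z Hz. apply (is_nderive_unique (V := C_NormedModule) U (ext0 f) l); auto.
  + apply Uopen_abs. exact Uo.
  + apply is_derive_C_unique.
  + now apply Cderive_n_is_nderive.
- eapply is_nderive_ext_r. 2: now apply Cderive_n_is_nderive. intros; symmetry; now apply H1.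
Qed.

(** Membership in the spaces of holomorphic functions, up to decay at infinity, for total functions
    whose values outside [U] are irrelevant. *)
Definition jets (n : nat) (f : C -> C) : Prop :=
  (forall z, U z -> cdiff f z) /\
  forall l, (l <= n)%nat -> exists g, cont_on K g /\ forall z, U z -> g z = Cderive_n l f z.

Lemma jets_iff (f : {z : C | U z} -> C) n :
  holomorphic f /\ (forall l, (l <= n)%nat -> exists g, holo_jet K f l g) <-> jets n (ext0 f).
Proof.
split; intros [H1 H2]; split; auto; intros l Hl; destruct (H2 l Hl) as [g G]; exists g.
- apply holo_jet_iff in G; auto. tauto.
- apply holo_jet_iff; auto. tauto.
Qed.

Lemma jets_ext n (f g : C -> C) : (forall z, U z -> f z = g z) -> jets n f -> jets n g.
Proof.
intros E [H1 H2]. split. now apply (cdiff_ext_U f).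
intros l Hl. destruct (H2 l Hl) as (k & K1 & K2). exists k. split; auto.
intros z Hz. rewrite K2 by auto. now apply Cderive_n_ext.
Qed.

Lemma jets_le n m f : (m <= n)%nat -> jets n f -> jets m f.
Proof. intros L [H1 H2]. split; auto. intros l Hl. apply H2. lia. Qed.

Definition holo_values (n : nat) (f : {z : C | U z} -> C) (r : R) : Prop :=
  exists l g y, (l <= n)%nat /\ holo_jet K f l g /\ K y /\ r = Cmod (g y).

Lemma holo_values_derive n f l z : jets n (ext0 f) -> (l <= n)%nat -> U z ->
  holo_values n f (Cmod (Cderive_n l (ext0 f) z)).
Proof.
intros Hj Hl Hz. destruct (proj2 Hj l Hl) as (g & G1 & G2).
exists l, g, z. repeat split; auto.
- apply holo_jet_iff; auto. exact (proj1 Hj).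
- now rewrite G2.
Qed.

Lemma cont_on_bound (g : C -> C) M : cont_on K g -> (forall z, U z -> Cmod (g z) <= M) -> forall z, K z -> Cmod (g z) <= M.
Proof.
intros Cg B z Hz. apply le_epsilon. intros eps he.
destruct (cont_on_eps K g z Cg Hz eps he) as [d Hd].
destruct (proj2 (locally_Cmod z (fun w => Cmod (w - z)%C < d))) as [e He].
{ exists d. auto. }
destruct (Ud z Hz e) as (w & Hw & Bw).
eapply Rle_trans. apply (Cmod_le_plus_minus _ (g w)). rewrite Cmod_minus_sym.
apply Rplus_le_compat. now apply B. apply Rlt_le, Hd; auto.
Qed.

Lemma holo_values_le n f M : holomorphic f ->
  (forall l z, (l <= n)%nat -> U z -> Cmod (Cderive_n l (ext0 f) z) <= M) ->
  forall r, holo_values n f r -> r <= M.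
Proof.
intros Hf B r (l & g & y & Hl & G & Hy & ->). apply holo_jet_iff in G; auto. destruct G as [G1 G2].
apply cont_on_bound; auto. intros z Hz. rewrite G1 by auto. now apply B.
Qed.

(** Each differentiation of z u produces an extra u, so the constant 1/2 grows to [l + 1/2]. *)
Lemma Cderive_n_euler (f : C -> C) l : (forall z, U z -> cdiff f z) -> forall z, U z ->
  Cderive_n l (euler_op f) z = (z * Cderive_n (S l) f z + RtoC (INR l + 1 / 2) * Cderive_n l f z)%C.
Proof.
intros Hf. induction l as [|l IH]; intros z Hz.
- simpl. unfold euler_op. now rewrite Rplus_0_l.
- apply is_C_derive_unique. eapply cder_ext_loc. apply (eq_on_U_loc _ _ z (fun z Hz => eq_sym (IH z Hz)) Hz).
  eapply cder_eq. apply cder_plus. apply cder_mult. apply cder_id. now apply Cderive_n_correct.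
  apply cder_scal. now apply Cderive_n_correct.
  rewrite S_INR. replace (INR l + 1 + 1 / 2) with (INR l + 1 / 2 + 1) by ring. rewrite (RtoC_plus _ 1). cbv beta. ring.
Qed.

Lemma euler_holomorphic (f : C -> C) : (forall z, U z -> cdiff f z) -> forall z, U z -> cdiff (euler_op f) z.
Proof.
intros Hf z Hz. eexists. unfold euler_op. apply cder_plus. apply cder_mult. apply cder_id.
apply (Cderive_n_correct f 1); auto. apply cder_scal. apply (Cderive_n_correct f 0); auto.
Qed.

Lemma jets_euler n f : jets (S n) f -> jets n (euler_op f).
Proof.
intros [H1 H2]. split. now apply euler_holomorphic.
intros l Hl. destruct (H2 l ltac:(lia)) as (g0 & A0 & B0). destruct (H2 (S l) ltac:(lia)) as (g1 & A1 & B1).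
exists (fun z => z * g1 z + RtoC (INR l + 1 / 2) * g0 z)%C. split.
- apply cont_on_plus. apply cont_on_mult; auto. apply cont_on_id. now apply cont_on_scal.
- intros z Hz. rewrite Cderive_n_euler, B0, B1; auto.
Qed.

(* Discs for Cauchy's estimate, needed where [z f'] does not control [f'] or conversely: near 0
   (void for the exterior) and near infinity (void for the disc). *)
Context (near0 : forall z, K z -> Cmod z < 1 / 2 -> forall w, Cmod (w - z)%C < 1 / 2 -> U w).
Context (far : forall z, K z -> 2 < Cmod z -> forall w, Cmod (w - z)%C < Cmod z / 2 -> U w).

(** For large [z] a bound on the next derivative does not bound its product with [z]; Cauchy's
    estimate for the [l]-th derivative on a disc of radius proportional to [Cmod z] does, by
    [8 * N]. The rest is at most [(n + 1/2) * N]. *)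
Lemma euler_bound_above n f N : (forall z, U z -> cdiff f z) ->
  (forall l z, (l <= S n)%nat -> U z -> Cmod (Cderive_n l f z) <= N) ->
  forall l z, (l <= n)%nat -> U z -> Cmod (Cderive_n l (euler_op f) z) <= (INR n + 9) * N.
Proof.
intros Hf B l z Hl Hz. rewrite Cderive_n_euler by auto.
assert (N0 : 0 <= N). { eapply Rle_trans. apply Cmod_ge_0. apply (B O z); auto. lia. }
assert (X : Cmod (z * Cderive_n (S l) f z)%C <= 8 * N).
{ rewrite Cmod_mult. destruct (Rle_lt_dec (Cmod z) 2) as [H|H].
  - assert (Y := B (S l) z ltac:(lia) Hz). generalize (Cmod_ge_0 z) (Cmod_ge_0 (Cderive_n (S l) f z)). nra.
  - assert (Y : Cmod (C_derive (Cderive_n l f) z) <= 2 * N / (Cmod z / 4)).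
    { apply cauchy_estimate_scaled. lra.
      - intros w Hw. apply Cderive_n_holomorphic; auto. apply (far z); auto. lra.
      - intros w Hw. apply B. lia. apply (far z); auto. lra. }
    apply Rmult_le_compat_l with (r := Cmod z) in Y. 2: apply Cmod_ge_0.
    replace (Cmod z * (2 * N / (Cmod z / 4))) with (8 * N) in Y by (field; lra). exact Y. }
eapply Rle_trans. apply Cmod_triangle. rewrite (Cmod_mult (RtoC _)), Cmod_R.
assert (Il : 0 <= INR l) by apply pos_INR. assert (In : INR l <= INR n) by (apply le_INR; auto).
rewrite Rabs_pos_eq by lra. assert (Y := B l z ltac:(lia) Hz).
assert (Z := Cmod_ge_0 (Cderive_n l f z)). nra.
Qed.

Lemma euler_derive_far (f : C -> C) l z : (forall z, U z -> cdiff f z) -> U z -> z <> RtoC 0 ->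
  Cderive_n (S l) f z = ((Cderive_n l (euler_op f) z - RtoC (INR l + 1 / 2) * Cderive_n l f z) / z)%C.
Proof. intros Hf Hz N. rewrite Cderive_n_euler by auto. field. auto. Qed.

(** Where [Cmod z >= 1/2], solving for the derivative and dividing by [z] costs a factor 2 and gives
    [2 + (2 l + 1) B]; near 0 Cauchy's estimate gives [8 B]. The chosen constant dominates both. It
    depends on neither [f] nor [n]. *)
Lemma euler_bound_below c l : 0 <= c -> exists B, 0 <= B /\ forall n (f : C -> C) S, (l <= n + 1)%nat ->
  (forall z, U z -> cdiff f z) -> 0 <= S ->
  (forall z, U z -> Cmod (f z) <= c * S) ->
  (forall l z, (l <= n)%nat -> U z -> Cmod (Cderive_n l (euler_op f) z) <= S) ->
  forall z, U z -> Cmod (Cderive_n l f z) <= B * S.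
Proof.
intros Hc. induction l as [|l (B & B0 & IH)].
- exists c. split; auto.
- assert (Il : 0 <= INR l) by apply pos_INR.
  exists (2 + (2 * INR l + 9) * B). split. nra.
  intros n f S Hl Hf S0 Hb He z Hz.
  assert (IH' := IH n f S ltac:(lia) Hf S0 Hb He).
  destruct (Rle_lt_dec (1 / 2) (Cmod z)) as [H|H].
  + assert (N : z <> RtoC 0). { apply Cmod_gt_0. lra. }
    rewrite euler_derive_far by auto. rewrite Cmod_div by auto.
    apply Rmult_le_reg_r with (Cmod z). lra. unfold Rdiv at 1. rewrite Rmult_assoc, Rinv_l, Rmult_1_r by lra.
    unfold Cminus. eapply Rle_trans. apply Cmod_triangle. rewrite Cmod_opp, Cmod_mult, Cmod_R, Rabs_pos_eq by lra.
    assert (X := He l z ltac:(lia) Hz). assert (Y := IH' z Hz).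
    apply Rle_trans with (S + (INR l + 1 / 2) * (B * S)). apply Rplus_le_compat; auto. apply Rmult_le_compat_l; lra.
    apply Rle_trans with ((2 + (2 * INR l + 9) * B) * S * (1 / 2)).
    assert (0 <= B * S) by nra. nra. apply Rmult_le_compat_l; auto. apply Rmult_le_pos; nra.
  + assert (X : Cmod (C_derive (Cderive_n l f) z) <= 2 * (B * S) / (1 / 4)).
    { apply cauchy_estimate_scaled. lra.
      - intros w Hw. apply Cderive_n_holomorphic; auto. apply (near0 z); auto. lra.
      - intros w Hw. apply IH'. apply (near0 z); auto. lra. }
    eapply Rle_trans. exact X. assert (0 <= B * S) by nra. nra.
Qed.

Lemma euler_bound_below_all c n : 0 <= c -> exists B, 0 <= B /\ forall (f : C -> C) S,
  (forall z, U z -> cdiff f z) -> 0 <= S ->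
  (forall z, U z -> Cmod (f z) <= c * S) ->
  (forall l z, (l <= n)%nat -> U z -> Cmod (Cderive_n l (euler_op f) z) <= S) ->
  forall l z, (l <= n + 1)%nat -> U z -> Cmod (Cderive_n l f z) <= B * S.
Proof.
intros Hc.
assert (X : forall m, exists B, 0 <= B /\ forall (f : C -> C) S,
  (forall z, U z -> cdiff f z) -> 0 <= S ->
  (forall z, U z -> Cmod (f z) <= c * S) ->
  (forall l z, (l <= n)%nat -> U z -> Cmod (Cderive_n l (euler_op f) z) <= S) ->
  forall l z, (l <= m)%nat -> (l <= n + 1)%nat -> U z -> Cmod (Cderive_n l f z) <= B * S).
{ induction m as [|m (B & B0 & IH)].
  - destruct (euler_bound_below c 0 Hc) as (B & B0 & HB). exists B. split; auto.
    intros f S Hf S0 Hb He l z Hl Hl' Hz. replace l with O in * by lia. apply (HB n); auto.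
  - destruct (euler_bound_below c (S m) Hc) as (B' & B0' & HB). exists (B + B'). split. lra.
    intros f s Hf S0 Hb He l z Hl Hl' Hz. rewrite Rmult_plus_distr_r.
    assert (0 <= B * s) by nra. assert (0 <= B' * s) by nra.
    destruct (Nat.eq_dec l (S m)) as [->|N].
    + assert (Y := HB n f s Hl' Hf S0 Hb He z Hz). lra.
    + assert (Y := IH f s Hf S0 Hb He l z ltac:(lia) Hl' Hz). lra. }
destruct (X (n + 1)%nat) as (B & B0 & HB). exists B. split; auto.
Qed.

(** The gain of one derivative: away from 0 the extension of the next derivative is the quotient by
    [z] of already extended functions, and near 0 the points of [K] lie in [U], where the derivative
    itself is continuous. *)
Lemma jets_euler_inv n (f : C -> C) : (forall z, U z -> cdiff f z) ->
  (exists g, cont_on K g /\ forall z, U z -> g z = f z) -> jets n (euler_op f) -> jets (S n) f.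
Proof.
intros Hf H0 [_ He]. split; auto. intros l. induction l as [|l IH]; intros Hl. exact H0.
destruct (IH ltac:(lia)) as (gf & F1 & F2). destruct (He l ltac:(lia)) as (ge & E1 & E2).
set (h := fun z => ((ge z + RtoC (- (INR l + 1 / 2)) * gf z) / z)%C).
assert (Eh : forall z, U z -> z <> RtoC 0 -> h z = Cderive_n (S l) f z).
{ intros z Hz N. rewrite euler_derive_far by auto. unfold h. rewrite E2, F2, RtoC_opp by auto. field. auto. }
exists (fun z => if Rlt_dec (Cmod z) (1 / 2) then Cderive_n (S l) f z else h z). split.
- apply cont_on_glue.
  + intros z Kz Lz. apply cdiff_cont. apply Cderive_n_holomorphic; auto. apply (near0 z); auto.
    rewrite Cmod_minus_self. lra.
  + intros z Kz Lz. apply (clim_div (within K (locally (T := C_UniformSpace) z))).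
    * exact (cont_on_plus K _ _ E1 (cont_on_scal K _ _ F1) z Kz).
    * exact (cont_on_id K z Kz).
    * apply Cmod_gt_0. lra.
  + intros z Kz Lz. symmetry. apply Eh. apply (near0 z); auto. lra. rewrite Cmod_minus_self. lra. apply Cmod_gt_0. lra.
- intros z Hz. destruct Rlt_dec; auto. apply Eh; auto. apply Cmod_gt_0. lra.
Qed.

End Jets.

(** * The isomorphism on holomorphic functions *)

Definition restrict (U : C -> Prop) (f : C -> C) : {z : C | U z} -> C := fun z => f (proj1_sig z).

Lemma ext0_restrict U f z : U z -> ext0 (restrict U f) z = f z.
Proof. intros Hz. now rewrite (ext0_in U _ z Hz). Qed.

Section EulerIsomorphism.
Context (U K : C -> Prop).
Context (Uo : forall z, U z -> locally (T := C_UniformSpace) z U).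
Context (UK : forall z, U z -> K z).
Context (Ud : forall z, K z -> forall eps : posreal, exists w, U w /\ ball (M := C_UniformSpace) z eps w).
Context (near0 : forall z, K z -> Cmod z < 1 / 2 -> forall w, Cmod (w - z)%C < 1 / 2 -> U w).
Context (far : forall z, K z -> 2 < Cmod z -> forall w, Cmod (w - z)%C < Cmod z / 2 -> U w).

Lemma euler_op_ext (f g : C -> C) : (forall z, U z -> cdiff f z) -> (forall z, U z -> f z = g z) ->
  forall z, U z -> euler_op f z = euler_op g z.
Proof.
intros Hf E z Hz. unfold euler_op. rewrite E by auto. do 2 f_equal.
exact (Cderive_n_ext U Uo f g 1 Hf E z Hz).
Qed.

Lemma euler_op_plus (f g : C -> C) : (forall z, U z -> cdiff f z) -> (forall z, U z -> cdiff g z) ->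
  forall z, U z -> euler_op (fun w => f w + g w)%C z = (euler_op f z + euler_op g z)%C.
Proof.
intros Hf Hg z Hz. unfold euler_op.
rewrite (is_C_derive_unique (fun w => f w + g w)%C z (C_derive f z + C_derive g z)%C). ring.
apply cder_plus; now apply cdiff_C_derive; auto.
Qed.

Lemma euler_op_scal c (f : C -> C) : (forall z, U z -> cdiff f z) ->
  forall z, U z -> euler_op (fun w => c * f w)%C z = (c * euler_op f z)%C.
Proof.
intros Hf z Hz. unfold euler_op.
rewrite (is_C_derive_unique (fun w => c * f w)%C z (c * C_derive f z)%C). ring.
apply cder_scal; now apply cdiff_C_derive; auto.
Qed.

(** What distinguishes the disc from the exterior is isolated here: the decay condition [adm], the
    sup-norm bound with constant [c], and the solvability of the equation. [A] and [val] present the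
    normed spaces through their functions and norms only. *)
Context (adm : (C -> C) -> Prop).
Context (adm_ext : forall f g, (forall z, U z -> f z = g z) -> adm f -> adm g).
Context (adm_euler : forall f, (forall z, U z -> cdiff f z) -> adm f -> adm (euler_op f)).
Context (c : R) (c0 : 0 <= c).
Context (a_priori : forall f S, (forall z, U z -> cdiff f z) -> adm f ->
  (forall z, U z -> Cmod (euler_op f z) <= S) -> forall z, U z -> Cmod (f z) <= c * S).
Context (solve : forall g, (forall z, U z -> cdiff g z) -> adm g ->
  (exists h, cont_on K h /\ forall z, U z -> h z = g z) ->
  exists f, (forall z, U z -> cdiff f z) /\ adm f /\ (forall z, U z -> euler_op f z = g z) /\
    exists h, cont_on K h /\ forall z, U z -> h z = f z).
Context (A : nat -> NormedModule C_AbsRing) (val : forall n, A n -> {z : C | U z} -> C).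
Context (val_plus : forall n (x y : A n), val n (plus x y) = fun z => (val n x z + val n y z)%C).
Context (val_scal : forall n k (x : A n), val n (scal k x) = fun z => (k * val n x z)%C).
Context (val_jets : forall n (x : A n), adm (ext0 (val n x)) /\ jets U K n (ext0 (val n x))).
Context (val_surj : forall n f, adm (ext0 f) -> jets U K n (ext0 f) -> exists x : A n, val n x = f).
Context (val_ub : forall n (x : A n) l z, (l <= n)%nat -> U z -> Cmod (Cderive_n l (ext0 (val n x)) z) <= norm x).
Context (val_le : forall n (x : A n) M,
  (forall l z, (l <= n)%nat -> U z -> Cmod (Cderive_n l (ext0 (val n x)) z) <= M) -> norm x <= M).

Lemma euler_isomorphism p : exists Phi : A (S p) -> A p, isomorphism Phi /\
  forall x z, U z -> ext0 (val p (Phi x)) z = euler_op (ext0 (val (S p) x)) z.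
Proof.
destruct (euler_bound_below_all U K Uo UK near0 c p c0) as (B & B0 & HB).
assert (Hol : forall n (x : A n), forall z, U z -> cdiff (ext0 (val n x)) z).
{ intros n x. apply (val_jets n x). }
apply (isomorphism_of_relation (fun (x : A (S p)) (y : A p) => forall z, U z -> ext0 (val p y) z = euler_op (ext0 (val (S p) x)) z)
  (INR p + 9) B).
- intros x1 y1 x2 y2 H1 H2 z Hz. rewrite !val_plus, ext0_plus, H1, H2 by auto.
  rewrite <- euler_op_plus by auto. apply euler_op_ext; auto.
  + intros w Hw. destruct (Hol _ x1 w Hw) as [l1 L1], (Hol _ x2 w Hw) as [l2 L2]. eexists. apply cder_plus; eassumption.
  + intros w _. now rewrite ext0_plus.
- intros k x y H1 z Hz. rewrite !val_scal, ext0_scal, H1 by auto.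
  rewrite <- euler_op_scal by auto. apply euler_op_ext; auto.
  + intros w Hw. destruct (Hol _ x w Hw) as [l1 L1]. eexists. apply cder_scal; eassumption.
  + intros w _. now rewrite ext0_scal.
- intros x. destruct (val_jets _ x) as [X1 X2].
  assert (E : forall z, U z -> euler_op (ext0 (val (S p) x)) z = ext0 (restrict U (euler_op (ext0 (val (S p) x)))) z).
  { intros z Hz. now rewrite ext0_restrict. }
  destruct (val_surj p (restrict U (euler_op (ext0 (val (S p) x))))) as [y Hy].
  + eapply adm_ext. exact E. apply adm_euler; auto.
  + apply (jets_ext U K Uo _ _ _ E). now apply jets_euler.
  + exists y. intros z Hz. rewrite Hy. symmetry. now apply E.
- intros y. destruct (val_jets _ y) as [Y1 Y2].
  destruct (solve (ext0 (val p y))) as (f & F1 & F2 & F3 & F4); auto.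
  { destruct (proj2 Y2 O ltac:(lia)) as [h Hh]. exists h. exact Hh. }
  assert (E : forall z, U z -> f z = ext0 (restrict U f) z).
  { intros z Hz. now rewrite ext0_restrict. }
  destruct (val_surj (S p) (restrict U f)) as [x Hx].
  + eapply adm_ext. exact E. auto.
  + apply (jets_ext U K Uo _ _ _ E). apply jets_euler_inv; auto.
    apply (jets_ext U K Uo _ _ _ (fun z Hz => eq_sym (F3 z Hz)) Y2).
  + exists x. intros z Hz. rewrite Hx. rewrite <- F3 by auto. apply euler_op_ext; auto.
- intros x y H. apply val_le. intros l z Hl Hz.
  assert (E : Cderive_n l (ext0 (val p y)) z = Cderive_n l (euler_op (ext0 (val (S p) x))) z).
  { apply (Cderive_n_ext U Uo); auto. }
  rewrite E. apply (euler_bound_above U K Uo UK far p); auto.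
- intros x y H. apply val_le. intros l z Hl Hz.
  assert (Y : forall l z, (l <= p)%nat -> U z -> Cmod (Cderive_n l (euler_op (ext0 (val (S p) x))) z) <= norm y).
  { intros l' z' Hl' Hz'.
    replace (Cderive_n l' (euler_op (ext0 (val (S p) x))) z') with (Cderive_n l' (ext0 (val p y)) z'). auto.
    apply (Cderive_n_ext U Uo); auto. }
  apply HB; auto. apply norm_ge_0. 2: lia.
  intros w Hw. apply a_priori; auto. apply (val_jets _ x). intros v Hv. apply (Y O v); auto. lia.
Qed.
End EulerIsomorphism.

Lemma jet_norm_disc_ub n (x : ApD n) l z : (l <= n)%nat -> disc z -> Cmod (Cderive_n l (ext0 (fn x)) z) <= norm x.
Proof.
intros Hl Hz. apply (jnorm_ub disc_jets n x).
apply (holo_values_derive disc closed_disc disc_open disc_closed_disc); auto.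
apply (jets_iff disc closed_disc disc_open). exact (proj2_sig x).
Qed.

Lemma jet_norm_disc_le n (x : ApD n) M :
  (forall l z, (l <= n)%nat -> disc z -> Cmod (Cderive_n l (ext0 (fn x)) z) <= M) -> norm x <= M.
Proof.
intros H. apply (jnorm_lub disc_jets n x).
apply (holo_values_le disc closed_disc disc_open disc_closed_disc disc_dense); auto. exact (proj1 (proj2_sig x)).
Qed.

Lemma jet_norm_exterior_ub n (x : ApE n) l z : (l <= n)%nat -> exterior z -> Cmod (Cderive_n l (ext0 (fn x)) z) <= norm x.
Proof.
intros Hl Hz. apply (jnorm_ub exterior_jets n x).
apply (holo_values_derive exterior closed_exterior exterior_open exterior_closed_exterior); auto.
apply (jets_iff exterior closed_exterior exterior_open).
destruct (proj2_sig x) as [[X1 _] X2]. split. exact X1. exact X2.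
Qed.

Lemma jet_norm_exterior_le n (x : ApE n) M :
  (forall l z, (l <= n)%nat -> exterior z -> Cmod (Cderive_n l (ext0 (fn x)) z) <= M) -> norm x <= M.
Proof.
intros H. apply (jnorm_lub exterior_jets n x).
apply (holo_values_le exterior closed_exterior exterior_open exterior_closed_exterior exterior_dense); auto. exact (proj1 (proj1 (proj2_sig x))).
Qed.

Lemma disc_near0 z : closed_disc z -> Cmod z < 1 / 2 -> forall w, Cmod (w - z)%C < 1 / 2 -> disc w.
Proof. intros _ H w Hw. unfold disc. generalize (Cmod_le_plus_minus w z). lra. Qed.
Lemma disc_far z : closed_disc z -> 2 < Cmod z -> forall w, Cmod (w - z)%C < Cmod z / 2 -> disc w.
Proof. unfold closed_disc. intros; lra. Qed.
Lemma exterior_near0 z : closed_exterior z -> Cmod z < 1 / 2 -> forall w, Cmod (w - z)%C < 1 / 2 -> exterior w.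
Proof. unfold closed_exterior. intros; lra. Qed.
Lemma exterior_far z : closed_exterior z -> 2 < Cmod z -> forall w, Cmod (w - z)%C < Cmod z / 2 -> exterior w.
Proof.
intros _ H w Hw. unfold exterior. generalize (Cmod_le_plus_minus z w). rewrite Cmod_minus_sym. lra.
Qed.

Lemma disc_euler_isomorphism p : exists Phi : ApD (S p) -> ApD p, isomorphism Phi /\
  forall x z, disc z -> ext0 (fn (Phi x)) z = euler_op (ext0 (fn x)) z.
Proof.
apply (euler_isomorphism disc closed_disc disc_open disc_closed_disc disc_near0 disc_far
  (fun _ => True) (fun _ _ _ _ => I) (fun _ _ _ => I) 2 ltac:(lra)) with (A := ApD) (val := fun n x => fn x).
- intros f S Hf _ Hb. apply euler_op_bound; auto.
- intros g Hg _ Hh. destruct (euler_op_surjective g Hg Hh) as (m & M1 & M2 & h & H1 & H2).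
  exists m. repeat split; auto. exists h. split; auto. apply cont_on_of_ccont. auto.
- reflexivity.
- reflexivity.
- intros n x. split; auto. apply (jets_iff disc closed_disc disc_open). exact (proj2_sig x).
- intros n f _ Hf. apply (jets_iff disc closed_disc disc_open) in Hf. now exists (exist _ f Hf).
- apply jet_norm_disc_ub.
- apply jet_norm_disc_le.
Qed.

Definition vanishing (f : C -> C) : Prop :=
  forall eps, 0 < eps -> exists M, forall z, exterior z -> M < Cmod z -> Cmod (f z) < eps.

Lemma vanishing_iff (f : {z : C | exterior z} -> C) : vanishes_at_infinity f <-> vanishing (ext0 f).
Proof.
split.
- intros H eps he. destruct (H (mkposreal eps he)) as [M HM]. exists M.
  intros z Hz L. rewrite (ext0_in _ f z Hz). now apply HM.
- intros H eps. destruct (H eps (cond_pos eps)) as [M HM]. exists M.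
  intros [z Hz] L. rewrite <- (ext0_in _ f z Hz). now apply HM.
Qed.

(** Cauchy's estimate on the disc of radius [Cmod z / 2] about [z], which stays beyond [M] once
    [Cmod z > 2 * M], bounds [z f'] by [8 * (eps / 16)]. *)
Lemma vanishing_euler f : (forall z, exterior z -> cdiff f z) -> vanishing f -> vanishing (euler_op f).
Proof.
intros Hf H eps he. destruct (H (eps / 16) ltac:(lra)) as [M HM].
exists (Rmax 2 (2 * M)). intros z Hz L.
assert (L1 := Rmax_l 2 (2 * M)). assert (L2 := Rmax_r 2 (2 * M)).
assert (X : Cmod (C_derive f z) <= 2 * (eps / 16) / (Cmod z / 4)).
{ apply cauchy_estimate_scaled. lra.
  - intros w Hw. apply Hf. apply (exterior_far z); try lra. now apply exterior_closed_exterior.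
  - intros w Hw. apply Rlt_le, HM. apply (exterior_far z); try lra. now apply exterior_closed_exterior.
    generalize (Cmod_le_plus_minus z w). rewrite Cmod_minus_sym. lra. }
apply Rmult_le_compat_l with (r := Cmod z) in X. 2: apply Cmod_ge_0.
replace (Cmod z * (2 * (eps / 16) / (Cmod z / 4))) with (eps / 2) in X by (field; lra).
unfold euler_op. eapply Rle_lt_trans. apply Cmod_triangle. rewrite Cmod_half, Cmod_mult.
assert (Y := HM z Hz ltac:(lra)). lra.
Qed.

(** The inversion reverses the sign of z d/dz and the factor 1/z contributes -1, so the constant
    becomes 1/2 - 1 = -1/2 and a common sign comes out. *)
Lemma euler_op_inversion (f m : C -> C) : (forall z, disc z -> cdiff m z) ->
  (forall z, exterior z -> f z = (m (/ z) / z)%C) -> forall z, exterior z ->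
  cdiff f z /\ euler_op f z = (- euler_op m (/ z) / z)%C.
Proof.
intros Hm E z Hz. assert (N := exterior_neq0 z Hz).
assert (D : cder f z ((- / (z * z) * C_derive m (/ z)) * / z + m (/ z) * (- / (z * z)))%C).
{ assert (Di := cder_inv z N).
  apply (cder_ext_loc (fun z => m (/ z) * / z)%C).
  2: exact (cder_mult _ _ _ _ _ (cder_comp (fun z => / z)%C m z _ _ Di (cdiff_C_derive m _ (Hm _ (inv_exterior z Hz)))) Di).
  generalize (exterior_open z Hz). apply filter_imp. intros w Hw. symmetry. now apply E. }
split. eexists; exact D.
unfold euler_op at 1. rewrite (is_C_derive_unique _ _ _ D), E by auto. unfold euler_op.
(* The one place where the value 1/2 matters; [field] sees [RtoC (1 / 2)] as an atom. *)
assert (h2 : (RtoC (1 / 2) = 1 - RtoC (1 / 2))%C) by now rewrite one_minus_half.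
rewrite h2 at 1. field. auto.
Qed.

Lemma exterior_euler_isomorphism p : exists Phi : ApE (S p) -> ApE p, isomorphism Phi /\
  forall x z, exterior z -> ext0 (fn (Phi x)) z = euler_op (ext0 (fn x)) z.
Proof.
apply (euler_isomorphism exterior closed_exterior exterior_open exterior_closed_exterior exterior_near0 exterior_far
  vanishing) with (c := 16) (A := ApE) (val := fun n x => fn x).
- intros f g E H eps he. destruct (H eps he) as [M HM]. exists M. intros z Hz L. rewrite <- E by auto. auto.
- apply vanishing_euler.
- lra.
(* The sup bound: [w * k w] is the image of [f] at [1/w], so [divide_bound] gives [8 * S] for [k],
   [euler_op_bound] doubles this for [m], and [Cmod (f z) <= Cmod (m (/ z))] as [Cmod z > 1]. Hence
   the constant 16. *)
- intros f S Hf Vf Hb z Hz.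
  destruct (holomorphic_inversion f Hf Vf) as (m & M1 & M2).
  assert (Hf' := euler_holomorphic exterior exterior_open f Hf).
  destruct (holomorphic_inversion _ Hf' (vanishing_euler f Hf Vf)) as (k & K1 & K2).
  assert (Ek : forall w, disc w -> w <> RtoC 0 -> (w * k w = euler_op f (/ w))%C).
  { intros w Hw N. rewrite K2 by now apply inv_disc. rewrite Cinv_inv by auto. field. auto. }
  assert (Em : forall w, disc w -> w <> RtoC 0 -> euler_op m w = (- k w)%C).
  { intros w Hw N. assert (X := Ek w Hw N).
    rewrite (proj2 (euler_op_inversion f m M1 M2 _ (inv_disc w Hw N))), Cinv_inv in X by auto.
    assert (Y : (/ w * (w * k w) = / w * (- euler_op m w / / w))%C) by now rewrite X.
    replace (/ w * (w * k w))%C with (k w) in Y by (field; auto). rewrite Y. field. auto. }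
  assert (Bk : forall w, disc w -> Cmod (k w) <= 8 * S).
  { apply divide_bound; auto. intros w Hw N. rewrite Ek by auto. apply Hb. now apply inv_disc. }
  assert (Bm : forall w, disc w -> Cmod (m w) <= 2 * (8 * S)).
  { apply euler_op_bound; auto. intros w Hw N. rewrite Em, Cmod_opp by auto. auto. }
  rewrite M2 by auto. rewrite Cmod_div by now apply exterior_neq0.
  assert (X := Bm _ (inv_exterior z Hz)).
  unfold exterior in Hz. apply Rmult_le_reg_r with (Cmod z). lra. unfold Rdiv. rewrite Rmult_assoc, Rinv_l by lra.
  assert (0 <= 16 * S). { generalize (Cmod_ge_0 (m (/ z)%C)). lra. } nra.
- intros g Hg Vg (h0 & C0 & E0).
  destruct (holomorphic_inversion g Hg Vg) as (k & K1 & K2).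
  assert (Ek : forall w, disc w -> w <> RtoC 0 -> (k w = g (/ w) / w)%C).
  { intros w Hw N. rewrite K2 by now apply inv_disc. rewrite Cinv_inv by auto. field. auto. }
  destruct (euler_op_surjective (fun z => (- 1) * k z)%C) as (m & M1 & M2 & h & H1 & H2).
  { intros z Hz. destruct (K1 z Hz) as [l L]. eexists. apply cder_scal. exact L. }
  (* [k] extends continuously to the closed disc: near 0 it is holomorphic, and near the circle it
     is the inverted extension [h0] of [g]. *)
  { exists (fun z => if Rlt_dec (Cmod z) (1 / 2) then ((- 1) * k z)%C else ((- 1) * (h0 (/ z) / z))%C). split.
    - apply cont_on_glue.
      + intros z _ Hz. apply Ccont_scal. apply cdiff_cont, K1. unfold disc; lra.
      + intros z Kz Hz. assert (N : z <> RtoC 0) by (apply Cmod_gt_0; lra).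
        apply (clim_scal (within closed_disc (locally (T := C_UniformSpace) z)) (- 1)%C).
        apply (clim_div (within closed_disc (locally (T := C_UniformSpace) z)) (fun z => h0 (/ z)%C)).
        2: exact (cont_on_id closed_disc z Kz). 2: exact N.
        assert (Iv : forall w, closed_disc w -> w <> RtoC 0 -> closed_exterior (/ w)%C).
        { intros w Hw Nw. unfold closed_exterior, closed_disc in *. rewrite Cmod_inv by auto.
          apply Cmod_gt_0 in Nw. rewrite <- Rinv_1. now apply Rinv_le_contravar. }
        apply clim_eps. typeclasses eauto. intros eps he.
        destruct (cont_on_eps _ _ _ C0 (Iv z Kz N) eps he) as [d Hd].
        assert (Ci : ccont (fun z => / z)%C z) by (apply Ccont_inv; [apply continuous_id | exact N]).
        assert (X := proj1 (clim_eps _ _ _) Ci d (cond_pos d)).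
        assert (P := N). apply Cmod_gt_0 in P.
        unfold within. generalize (filter_and _ _ X (Cmod_gt_locally z 0 P)). apply filter_imp.
        intros w [W1 W2] Kw. apply Hd; auto. apply Iv; auto. now apply Cmod_gt_0.
      + intros z Kz Hz. rewrite Ek. rewrite E0; auto. apply inv_disc. unfold disc; lra. apply Cmod_gt_0; lra.
        unfold disc; lra. apply Cmod_gt_0; lra.
    - intros z Hz. destruct Rlt_dec as [L|L]; auto.
      assert (N : z <> RtoC 0) by (apply Cmod_gt_0; lra).
      rewrite Ek by auto. rewrite E0; auto. now apply inv_disc. }
  set (f := fun z => (m (/ z) / z)%C).
  assert (Ef : forall z, exterior z -> cdiff f z /\ euler_op f z = (- euler_op m (/ z) / z)%C).
  { apply euler_op_inversion; auto. }
  exists f. split; [|split; [|split]].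
  + apply Ef.
  (* [m] is bounded near 0 because [h] is continuous there, so the factor [1/z] in [f] forces
     decay. *)
  + intros eps he.
    assert (X := proj1 (clim_eps _ _ _) (H1 (RtoC 0)) 1 Rlt_0_1). apply locally_Cmod in X. destruct X as [e He].
    set (B := Cmod (h (RtoC 0)) + 1). assert (B0 : 0 < B). { unfold B. generalize (Cmod_ge_0 (h (RtoC 0))). lra. }
    exists (Rmax (/ e) (B / eps)). intros z Hz L. assert (N := exterior_neq0 z Hz).
    assert (L1 := Rmax_l (/ e) (B / eps)). assert (L2 := Rmax_r (/ e) (B / eps)).
    assert (e0 := cond_pos e). assert (ie : 0 < / e) by now apply Rinv_0_lt_compat.
    assert (Bz : Cmod (m (/ z)%C) <= B).
    { rewrite <- H2 by now apply inv_exterior.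
      eapply Rle_trans. apply (Cmod_le_plus_minus _ (h (RtoC 0))). unfold B. apply Rplus_le_compat_l. apply Rlt_le, He.
      replace (/ z - RtoC 0)%C with (/ z)%C by ring. rewrite Cmod_inv by auto. rewrite <- (Rinv_inv e).
      apply Rinv_lt_contravar; try lra. apply Rmult_lt_0_compat; lra. }
    unfold f. rewrite Cmod_div by auto. assert (z0 : 0 < Cmod z) by lra.
    apply Rmult_lt_reg_r with (Cmod z); auto. unfold Rdiv. rewrite Rmult_assoc, Rinv_l, Rmult_1_r by lra.
    eapply Rle_lt_trans. exact Bz. replace B with (eps * (B / eps)) by (field; lra). apply Rmult_lt_compat_l; lra.
  + intros z Hz. rewrite (proj2 (Ef z Hz)), M2, K2 by auto using inv_exterior. field. now apply exterior_neq0.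
  + exists (fun z => h (/ z) / z)%C. split.
    * apply cont_on_of_ccont. intros z Hz. assert (N : z <> RtoC 0) by (apply Cmod_gt_0; unfold closed_exterior in Hz; lra).
      apply Ccont_div; auto. 2: apply continuous_id. apply (Ccont_comp (T := C_UniformSpace) (fun z => / z)%C z h); auto.
      apply Ccont_inv; auto. apply continuous_id.
    * intros z Hz. unfold f. rewrite H2; auto. now apply inv_exterior.
- reflexivity.
- reflexivity.
- intros n x. destruct (proj2_sig x) as [[X1 X2] X3]. split. now apply vanishing_iff.
  apply (jets_iff exterior closed_exterior exterior_open). split. exact X1. exact X3.
- intros n f Vf Hf. apply (jets_iff exterior closed_exterior exterior_open) in Hf. apply vanishing_iff in Vf.
  assert (M : jmem exterior_jets n f). { destruct Hf. split. split; auto. auto. }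
  now exists (exist _ f M).
- apply jet_norm_exterior_ub.
- apply jet_norm_exterior_le.
Qed.

(** * The circle and boundary values *)

Definition unit_exp (t : R) : C := (cos t, sin t).

Lemma unit_exp_plus s t : unit_exp (s + t) = (unit_exp s * unit_exp t)%C.
Proof. unfold unit_exp. rewrite cos_plus, sin_plus. unfold Cmult; simpl. f_equal; ring. Qed.

Lemma unit_exp_opp t : (unit_exp (- t) * unit_exp t = 1)%C.
Proof. rewrite <- unit_exp_plus, Rplus_opp_l. unfold unit_exp. now rewrite cos_0, sin_0. Qed.

Lemma rder_unit_exp c t : rder (fun t => unit_exp (c * t)) t (Ci * RtoC c * unit_exp (c * t))%C.
Proof. apply is_derive_C_R; unfold unit_exp; split; simpl; auto_derive; auto; ring. Qed.

Lemma cis_eq_iff s t : cis s = cis t <-> unit_exp s = unit_exp t.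
Proof.
split.
- intros H. exact (f_equal (@proj1_sig _ _) H).
- intros H. unfold cis. apply eq_sig_hprop. intros; apply proof_irrelevance. exact H.
Qed.

Lemma cis_eq_shift s t u : cis s = cis t -> cis (s + u) = cis (t + u).
Proof. rewrite !cis_eq_iff, !unit_exp_plus. now intros ->. Qed.

Lemma circle_descend (g : R -> C) : (forall s t, cis s = cis t -> g s = g t) ->
  exists h : {z : C | circle z} -> C, forall t, h (cis t) = g t.
Proof.
intros H. exists (fun z => g (proj1_sig (constructive_indefinite_description _ (cis_surj z)))).
intros t. apply H. destruct constructive_indefinite_description as [s Hs]. simpl. now symmetry.
Qed.

Lemma rder_shift (y : R -> C) s u l : rder y (s + u) l -> rder (fun u => y (s + u)) u l.
Proof.
intros H. apply is_derive_C_R in H. destruct H as [H1 H2]. apply is_derive_C_R.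
assert (D : is_derive (fun u => s + u) u 1) by (auto_derive; auto; ring).
split.
- generalize (is_derive_comp (V := R_NormedModule) (fun t => fst (y t)) (fun u => s + u) u _ _ H1 D).
  unfold scal; simpl; unfold mult; simpl. now rewrite Rmult_1_l.
- generalize (is_derive_comp (V := R_NormedModule) (fun t => snd (y t)) (fun u => s + u) u _ _ H2 D).
  unfold scal; simpl; unfold mult; simpl. now rewrite Rmult_1_l.
Qed.

Lemma rder_zero_const (w : R -> C) : (forall t, rder w t (RtoC 0)) -> forall s t, w s = w t.
Proof.
intros H.
assert (X : forall s t, s <= t -> w t = w s).
{ intros s t L.
  assert (Y := mean_value_C w (fun _ => RtoC 0) s t 0 L (fun u _ => H u) (fun u _ => rder_cont _ _ _ (H u))).
  rewrite Rmult_0_l in Y. assert (Z : (w t - w s)%C = RtoC 0).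
  { apply Cmod_eq_0. apply Rle_antisym. apply Y. intros u _. rewrite Cmod_0. lra. apply Cmod_ge_0. }
  replace (w t) with (w t - w s + w s)%C by ring. rewrite Z. ring. }
intros s t. destruct (Rle_lt_dec s t). symmetry; auto. apply X. lra.
Qed.

(* [exp (i t / 2) y] is 2 pi-antiperiodic with derivative [i exp (i t / 2) q], so twice its value is an integral over one period. *)
Lemma periodic_ode_bound (y q : R -> C) S : (forall t, rder y t (Ci * (q t - RtoC (1 / 2) * y t))%C) ->
  (forall t, y (t + 2 * PI) = y t) -> (forall t, Cmod (q t) <= S) -> forall t, Cmod (y t) <= PI * S.
Proof.
intros D P B t.
set (E := fun t => (unit_exp (1 / 2 * t) * y t)%C).
assert (DE : forall t, rder E t (Ci * unit_exp (1 / 2 * t) * q t)%C).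
{ intros u. eapply rder_eq. apply rder_mult. apply rder_unit_exp. apply D. cbv beta. ring. }
assert (P0 := PI_RGT_0).
assert (X := mean_value_C E _ t (t + 2 * PI) S ltac:(lra) (fun u _ => DE u) (fun u _ => rder_cont _ _ _ (DE u))).
replace (E (t + 2 * PI)%R - E t)%C with (RtoC (- 2) * E t)%C in X.
2:{ unfold E. rewrite P. replace (1 / 2 * (t + 2 * PI)) with (1 / 2 * t + PI) by field.
    rewrite unit_exp_plus. replace (unit_exp PI) with (RtoC (- 1)).
    2:{ unfold unit_exp. now rewrite cos_PI, sin_PI. }
    replace (-2) with (-1 - 1) by ring. rewrite RtoC_minus. ring. }
unfold E in X. rewrite !Cmod_mult, Cmod_R in X.
replace (Cmod (unit_exp (1 / 2 * t))) with 1 in X by (symmetry; apply Cmod_cis).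
rewrite Rabs_left in X by lra.
assert (2 * Cmod (y t) <= S * (2 * PI)). 2: lra.
replace (2 * Cmod (y t)) with (- -2 * (1 * Cmod (y t))) by ring.
replace (S * (2 * PI)) with (S * (t + 2 * PI - t)) by ring. apply X.
intros u _. rewrite !Cmod_mult, Cmod_Ci. unfold unit_exp. rewrite Cmod_cis, !Rmult_1_l. apply B.
Qed.

(** Variation of constants with the integrating factor [exp (i t / 2)]. Since the factor is -1 at
    the end of the period, periodicity requires [-(c + J (2 pi)) = c], which determines [c]. *)
Lemma periodic_ode_solution (q : R -> C) : (forall t, rcont q t) -> (forall t, q (t + 2 * PI) = q t) ->
  exists y : R -> C, (forall t, rder y t (Ci * (q t - RtoC (1 / 2) * y t))%C) /\ forall t, y (t + 2 * PI) = y t.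
Proof.
intros Cq Pq.
set (J := fun t => cint (fun s => Ci * unit_exp (1 / 2 * s) * q s)%C 0 t).
assert (DJ : forall t, rder J t (Ci * unit_exp (1 / 2 * t) * q t)%C).
{ intros t. apply (rder_cint_upper (fun s => Ci * unit_exp (1 / 2 * s) * q s)%C).
  intros u. apply Ccont_mult; auto. apply Ccont_scal. exact (rder_cont _ _ _ (rder_unit_exp (1 / 2) u)). }
assert (J0 : J 0 = RtoC 0).
{ unfold J, cint. exact (RInt_point (V := C_R_CompleteNormedModule) 0 _). }
set (c := (RtoC (- (1 / 2)) * J (2 * PI)%R)%C).
set (y := fun t => (unit_exp (- (1 / 2) * t) * (c + J t))%C).
assert (Ee : forall t, (unit_exp (- (1 / 2) * t) * unit_exp (1 / 2 * t) = 1)%C).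
{ intros t. replace (- (1 / 2) * t) with (- (1 / 2 * t)) by ring. apply unit_exp_opp. }
assert (Dy : forall t, rder y t (Ci * (q t - RtoC (1 / 2) * y t))%C).
{ intros t. eapply rder_eq. apply rder_mult. apply rder_unit_exp. apply rder_plus. apply rder_const. apply DJ.
  unfold y. cbv beta. rewrite RtoC_opp.
  transitivity (Ci * ((unit_exp (- (1 / 2) * t) * unit_exp (1 / 2 * t)) * q t - RtoC (1 / 2) * (unit_exp (- (1 / 2) * t) * (c + J t))))%C.
  ring. rewrite Ee. ring. }
exists y. split; auto.
(* This difference solves the homogeneous equation, so it vanishes everywhere once it vanishes at
   0. *)
set (d := fun t => (y (2 * PI + t)%R - y t)%C).
assert (Dd : forall t, rder (fun t => unit_exp (1 / 2 * t) * d t)%C t (RtoC 0)).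
{ intros t. eapply rder_eq. apply rder_mult. apply rder_unit_exp. apply rder_minus. apply rder_shift. apply Dy. apply Dy. cbv beta.
  rewrite (Rplus_comm (2 * PI) t), Pq. unfold d. rewrite (Rplus_comm (2 * PI) t). ring. }
intros t. rewrite Rplus_comm.
assert (X := rder_zero_const _ Dd t 0). simpl in X.
assert (d0 : d 0 = RtoC 0).
{ unfold d, y. rewrite Rplus_0_r, J0, Rmult_0_r.
  replace (- (1 / 2) * (2 * PI)) with (- PI) by field.
  unfold unit_exp. rewrite cos_neg, sin_neg, cos_PI, sin_PI, cos_0, sin_0, Ropp_0.
  change (-1, 0) with (RtoC (- 1)). change (1, 0) with (RtoC 1). unfold c.
  transitivity (- (1 - RtoC (1 / 2) - RtoC (1 / 2)) * J (2 * PI)%R)%C. rewrite !RtoC_opp. ring.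
  rewrite one_minus_half. ring. }
rewrite d0, Cmult_0_r in X.
assert (Y : (unit_exp (- (1 / 2) * t) * (unit_exp (1 / 2 * t) * d t) = RtoC 0)%C) by (rewrite X; ring).
rewrite Cmult_assoc, Ee, Cmult_1_l in Y. unfold d in Y.
replace (y (2 * PI + t)) with (y (2 * PI + t)%R - y t + y t)%C by ring. rewrite Y. ring.
Qed.

Notation nder f l g := (is_nderive (K := R_AbsRing) (V := C_R_NormedModule) (fun _ => True) f l g).

(** [is_nderive] peels off the outermost derivative; here the innermost one is moved, which is what
    an induction through a first-order equation needs. *)
Lemma nder_shift (f f1 g : R -> C) l : (forall t, rder f t (f1 t)) -> nder f1 l g -> nder f (S l) g.
Proof.
intros D. revert g. induction l as [|l IH]; intros g H.
- exists f. split. now intros t _. intros t _. simpl in H. rewrite H by auto. apply D.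
- destruct H as (h & H1 & H2). exists h. split. exact (IH h H1). exact H2.
Qed.

Lemma nder_unshift (f f1 g : R -> C) l : (forall t, rder f t (f1 t)) -> nder f (S l) g -> nder f1 l g.
Proof.
intros D. revert g. induction l as [|l IH]; intros g (h & H1 & H2).
- intros t _. apply (is_derive_CR_unique h t). now apply H2.
  apply (rder_ext f). 2: apply D. intros u. symmetry. now apply H1.
- exists h. split; auto.
Qed.

Lemma circle_jet_shift (f f1 : {z : C | circle z} -> C) l g : (forall t, rder (fun u => f (cis u)) t (f1 (cis t))) ->
  circle_jet f (S l) g <-> circle_jet f1 l g.
Proof.
intros D. split; intros [H1 H2]; split; auto.
- exact (nder_unshift _ _ _ _ D H1).
- exact (nder_shift _ _ _ _ D H1).
Qed.

Lemma circle_jet_unique f l g1 g2 : circle_jet f l g1 -> circle_jet f l g2 -> forall t, g1 t = g2 t.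
Proof. intros H1 H2 t. exact (jet_unique circle_jets f l g1 g2 H1 H2 t I). Qed.

Lemma circle_jet_comb a b f1 f2 l g1 g2 : circle_jet f1 l g1 -> circle_jet f2 l g2 ->
  circle_jet (fun z => a * f1 z + b * f2 z)%C l (fun t => a * g1 t + b * g2 t)%C.
Proof.
intros H1 H2. exact (jet_plus circle_jets _ _ l _ _ (jet_scal circle_jets a _ _ _ H1) (jet_scal circle_jets b _ _ _ H2)).
Qed.

Lemma circle_jet_ext f1 f2 l g : (forall z, f1 z = f2 z) -> circle_jet f1 l g -> circle_jet f2 l g.
Proof. intros E. apply functional_extensionality in E. now subst. Qed.

Lemma circle_norm_ub n (x : CpT n) l g t : (l <= n)%nat -> circle_jet (fn x) l g -> Cmod (g t) <= norm x.
Proof. intros Hl G. apply (jnorm_ub circle_jets n x). exists l, g, t. repeat split; auto; apply G. Qed.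

Lemma circle_norm_le n (x : CpT n) M : (forall l g t, (l <= n)%nat -> circle_jet (fn x) l g -> Cmod (g t) <= M) -> norm x <= M.
Proof. intros H. apply (jnorm_lub circle_jets n x). intros r (l & g & t & Hl & G & _ & ->). now apply (H l). Qed.

Lemma circle_mem_jets n (x : CpT n) l : (l <= n)%nat -> exists g, circle_jet (fn x) l g.
Proof. apply (proj2_sig x). Qed.

Lemma circle_mem_of_jets n (f : {z : C | circle z} -> C) : (forall l, (l <= n)%nat -> exists g, circle_jet f l g) ->
  exists x : CpT n, fn x = f.
Proof. intros H. assert (M : jmem circle_jets n f) by (split; [exact I | exact H]). now exists (exist _ f M). Qed.

Lemma fn_bound n (x : CpT n) z : Cmod (fn x z) <= norm x.
Proof.
destruct (circle_mem_jets n x 0 ltac:(lia)) as [g G]. destruct (cis_surj z) as [t ->].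
assert (E : g t = fn x (cis t)) by now apply G. rewrite <- E. apply (circle_norm_ub n x 0); auto. lia.
Qed.

Lemma rcont_fn n (x : CpT n) t : rcont (fun t => fn x (cis t)) t.
Proof.
destruct (circle_mem_jets n x 0 ltac:(lia)) as [g [G1 G2]].
apply (continuous_ext (T := R_UniformSpace) (U := C_UniformSpace) g). intros u. now apply G1. apply G2.
Qed.

(** The equation h = -i f' + f / 2 solved for f', so that differentiability of [f] is part of the
    relation. *)
Definition circle_euler (f h : {z : C | circle z} -> C) : Prop :=
  forall t, rder (fun u => f (cis u)) t (Ci * (h (cis t) - RtoC (1 / 2) * f (cis t)))%C.

Lemma Ci_Ci : (Ci * Ci = - RtoC 1)%C.
Proof. apply injective_projections; simpl; ring. Qed.

Lemma circle_euler_isomorphism p : exists Phi : CpT (S p) -> CpT p, isomorphism Phi /\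
  forall x : CpT (S p), circle_euler (fn x) (fn (Phi x)).
Proof.
assert (CiK : forall a b : C, (a = (- Ci) * (Ci * (a - RtoC (1 / 2) * b)) + RtoC (1 / 2) * b)%C).
{ intros a b. transitivity (- (Ci * Ci) * (a - RtoC (1 / 2) * b) + RtoC (1 / 2) * b)%C. rewrite Ci_Ci. ring. ring. }
(* The constant 2 exceeds 1 + 1/2. The constant 4 exceeds PI, the sup-norm bound, and 1 + 4/2, the
   bound it passes on to the next derivative. *)
apply (isomorphism_of_relation (fun (x : CpT (S p)) (y : CpT p) => circle_euler (fn x) (fn y)) 2 4).
- intros x1 y1 x2 y2 H1 H2 t. eapply rder_eq. apply (rder_plus _ _ _ _ _ (H1 t) (H2 t)).
  change (fn (plus y1 y2) (cis t)) with (fn y1 (cis t) + fn y2 (cis t))%C.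
  change (fn (plus x1 x2) (cis t)) with (fn x1 (cis t) + fn x2 (cis t))%C. ring.
- intros c x y H1 t. eapply rder_eq. apply (rder_scal c _ _ _ (H1 t)).
  change (fn (scal c y) (cis t)) with (c * fn y (cis t))%C.
  change (fn (scal c x) (cis t)) with (c * fn x (cis t))%C. ring.
- intros x. destruct (circle_mem_jets _ x 1 ltac:(lia)) as [g [(h0 & E0 & D0) Cg]].
  assert (D : forall t, rder (fun u => fn x (cis u)) t (g t)).
  { intros t. apply (rder_ext h0). intros u. now apply E0. now apply D0. }
  destruct (circle_descend g) as [g1 Hg1].
  (* The derivative in the angle depends only on the point of the circle: both values are the
     derivative at 0 of the same translated function. *)
  { intros s t E. apply (is_derive_CR_unique (fun u => fn x (cis (s + u))) 0).
    - apply (rder_shift (fun u => fn x (cis u))). rewrite Rplus_0_r. apply D.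
    - apply (rder_ext (fun u => fn x (cis (t + u)))). intros u. now rewrite (cis_eq_shift s t u E).
      apply (rder_shift (fun u => fn x (cis u))). rewrite Rplus_0_r. apply D. }
  assert (D1 : forall t, rder (fun u => fn x (cis u)) t (g1 (cis t))).
  { intros t. rewrite Hg1. apply D. }
  destruct (circle_mem_of_jets p (fun z => (- Ci) * g1 z + RtoC (1 / 2) * fn x z)%C) as [y Hy].
  + intros l Hl. destruct (circle_mem_jets _ x l ltac:(lia)) as [k0 K0]. destruct (circle_mem_jets _ x (S l) ltac:(lia)) as [k1 K1].
    eexists. apply circle_jet_comb. apply (circle_jet_shift _ _ _ _ D1). exact K1. exact K0.
  + exists y. intros t. rewrite Hy. eapply rder_eq. apply D1.
    transitivity (- (Ci * Ci) * g1 (cis t))%C. rewrite Ci_Ci. ring. ring.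
- intros y.
  destruct (periodic_ode_solution (fun t => fn y (cis t))) as (w & W1 & W2).
  { apply rcont_fn. }
  { intros t. now rewrite cis_period. }
  destruct (circle_descend w) as [f Hf].
  (* Two translates starting at the same point of the circle differ by a periodic solution with
     right-hand side 0, and the a priori bound makes it vanish. *)
  { intros s t E. set (d := fun u => (w (s + u)%R - w (t + u)%R)%C).
    assert (X : Cmod (d 0) <= PI * 0).
    { apply (periodic_ode_bound d (fun _ => RtoC 0)).
      - intros u. eapply rder_eq. apply rder_minus; apply rder_shift; apply W1. cbv beta.
        rewrite (cis_eq_shift s t u E). unfold d. ring.
      - intros u. unfold d. now rewrite <- !Rplus_assoc, !W2.
      - intros u. rewrite Cmod_0. lra. }
    rewrite Rmult_0_r in X. assert (Z : d 0 = RtoC 0). { apply Cmod_eq_0. apply Rle_antisym; auto. apply Cmod_ge_0. }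
    unfold d in Z. rewrite !Rplus_0_r in Z. replace (w s) with (w s - w t + w t)%C by ring. rewrite Z. ring. }
  assert (D : circle_euler f (fn y)).
  { intros t. apply (rder_ext w). intros u. now rewrite Hf. rewrite Hf. apply W1. }
  destruct (circle_mem_of_jets (S p) f) as [x Hx].
  + intros l. induction l as [|l IH]; intros Hl.
    * exists w. split. intros t _. now rewrite Hf. intros t. exact (rder_cont _ _ _ (W1 t)).
    * destruct IH as [k0 K0]. lia. destruct (circle_mem_jets _ y l ltac:(lia)) as [k1 K1].
      eexists. apply (circle_jet_shift f (fun z => Ci * (fn y z - RtoC (1 / 2) * f z))%C). exact D.
      apply (circle_jet_ext (fun z => Ci * fn y z + (- Ci * RtoC (1 / 2)) * f z)%C). intros z; ring.
      apply circle_jet_comb. exact K1. exact K0.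
  + exists x. now rewrite Hx.
- intros x y D. apply circle_norm_le. intros l g t Hl G.
  destruct (circle_mem_jets _ x l ltac:(lia)) as [k0 K0]. destruct (circle_mem_jets _ x (S l) ltac:(lia)) as [k1 K1].
  assert (B0 := circle_norm_ub _ x l k0 t ltac:(lia) K0). assert (B1 := circle_norm_ub _ x (S l) k1 t ltac:(lia) K1).
  apply (circle_jet_shift (fn x) (fun z => Ci * (fn y z - RtoC (1 / 2) * fn x z))%C _ _ D) in K1.
  assert (X := circle_jet_comb (- Ci)%C (RtoC (1 / 2)) _ _ _ _ _ K1 K0).
  rewrite (circle_jet_unique (fn y) l g (fun t => (- Ci) * k1 t + RtoC (1 / 2) * k0 t)%C G) with (t := t).
  + eapply Rle_trans. apply Cmod_triangle. rewrite Cmod_half, Cmod_mult, Cmod_opp, Cmod_Ci.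
    generalize (Cmod_ge_0 (k0 t)) (Cmod_ge_0 (k1 t)). lra.
  + eapply circle_jet_ext. 2: exact X. intros z. symmetry. apply CiK.
- intros x y D. apply circle_norm_le. intros l. induction l as [|l IH]; intros g t Hl G.
  + assert (E : g t = fn x (cis t)) by now apply G. rewrite E.
    apply Rle_trans with (PI * norm y).
    * apply (periodic_ode_bound (fun t => fn x (cis t)) (fun t => fn y (cis t))). exact D.
      intros u. now rewrite cis_period. intros u. apply fn_bound.
    * apply Rmult_le_compat_r. apply norm_ge_0. apply PI_4.
  + destruct (circle_mem_jets _ x l ltac:(lia)) as [k0 K0]. destruct (circle_mem_jets _ y l ltac:(lia)) as [k1 K1].
    assert (B0 := IH k0 t ltac:(lia) K0). assert (B1 := circle_norm_ub _ y l k1 t ltac:(lia) K1).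
    apply (circle_jet_shift (fn x) (fun z => Ci * (fn y z - RtoC (1 / 2) * fn x z))%C _ _ D) in G.
    assert (X := circle_jet_comb Ci (- Ci * RtoC (1 / 2))%C _ _ _ _ _ K1 K0).
    rewrite (circle_jet_unique _ l g (fun t => Ci * k1 t + (- Ci * RtoC (1 / 2)) * k0 t)%C G) with (t := t).
    * eapply Rle_trans. apply Cmod_triangle. rewrite !Cmod_mult, Cmod_opp, Cmod_Ci, Cmod_R, Rabs_pos_eq by lra.
      generalize (Cmod_ge_0 (k0 t)) (Cmod_ge_0 (k1 t)). lra.
    * eapply circle_jet_ext. 2: exact X. intros z. simpl. ring.
Qed.

(** * Boundary values of functions on the disc and on the exterior *)

Lemma rder_of_eps (f : R -> C) (t : R) (l : C) :
  (forall eps, 0 < eps -> exists d : posreal, forall s, Rabs (s - t) < d ->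
    Cmod (f s - f t - RtoC (s - t) * l)%C <= eps * Rabs (s - t)) -> rder f t l.
Proof.
intros H. split. apply (is_linear_scal_l (K := R_AbsRing) (V := C_R_NormedModule)).
intros x Hx.
assert (Ex : t = x) by exact (is_filter_lim_locally_unique (V := R_NormedModule) t x Hx).
subst x. intros eps. destruct (H eps (cond_pos eps)) as [d Hd].
exists d. intros s Hs. rewrite <- Cmod_norm. rewrite scal_R_Cmult. exact (Hd s Hs).
Qed.

Lemma unit_exp_dist s t : Cmod (unit_exp s - unit_exp t)%C <= Rabs (s - t).
Proof.
assert (X : forall a b, a <= b -> Cmod (unit_exp b - unit_exp a)%C <= b - a).
{ intros a b L. replace (b - a) with (1 * (b - a)) by ring.
  apply (mean_value_C unit_exp (fun t => Ci * unit_exp t)%C); auto.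
  - intros u _. apply rder_cis.
  - intros u _. exact (rder_cont _ _ _ (rder_cis u)).
  - intros u _. rewrite Cmod_mult, Cmod_Ci. unfold unit_exp. rewrite Cmod_cis. lra. }
destruct (Rle_lt_dec t s).
- rewrite Rabs_pos_eq by lra. auto.
- rewrite Cmod_minus_sym, Rabs_left by lra. replace (- (s - t)) with (t - s) by ring. apply X. lra.
Qed.

Section Boundary.
Context (U K : C -> Prop).
Context (Uo : forall z, U z -> locally (T := C_UniformSpace) z U).
Context (UK : forall z, U z -> K z).
Context (circleK : forall z, circle z -> K z).
Context (approach : forall eps, 0 < eps -> exists r : R, Rabs (r - 1) < eps /\ forall t, U (RtoC r * unit_exp t)%C).

(* The mean value inequality on the circle of radius [r], followed by [r -> 1]. *)
Lemma boundary_derivative (f g0 g1 : C -> C) : (forall z, U z -> cdiff f z) ->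
  cont_on K g0 -> (forall z, U z -> g0 z = f z) ->
  cont_on K g1 -> (forall z, U z -> g1 z = C_derive f z) ->
  forall t, rder (fun t => g0 (unit_exp t)) t (Ci * (unit_exp t * g1 (unit_exp t)))%C.
Proof.
intros Hf C0 E0 C1 E1 t.
assert (CG : cont_on K (fun z => Ci * (z * g1 z))%C).
{ apply cont_on_scal. apply cont_on_mult; auto. apply cont_on_id. }
assert (KC : forall s, K (unit_exp s)) by (intros; apply circleK, circle_cis).
set (D := (Ci * (unit_exp t * g1 (unit_exp t)))%C).
assert (Rd : forall r s, Rabs (r - 1) = Cmod (RtoC r * unit_exp s - unit_exp s)%C).
{ intros r s. replace (RtoC r * unit_exp s - unit_exp s)%C with (RtoC (r - 1) * unit_exp s)%C by (rewrite RtoC_minus; ring).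
  unfold unit_exp. rewrite Cmod_mult, Cmod_cis, Cmod_R. ring. }
apply rder_of_eps. intros eps he.
destruct (cont_on_eps K _ _ CG (KC t) eps he) as [d Hd]. fold D in Hd.
assert (d0 := cond_pos d).
(* Half of [d] is for the angle and half for [r - 1]. The radius is chosen after [s], at the cost of
   an [eta] that is arbitrary for fixed [s] and [t]. *)
exists (pos_div_2 d). simpl. intros s Hs.
apply le_epsilon. intros eta heta.
destruct (cont_on_eps K _ _ C0 (KC s) (eta / 2) ltac:(lra)) as [d1 Hd1].
destruct (cont_on_eps K _ _ C0 (KC t) (eta / 2) ltac:(lra)) as [d2 Hd2].
destruct (approach (Rmin (d / 2) (Rmin d1 d2))) as (r & Hr & Ur).
{ repeat apply Rmin_glb_lt. lra. apply cond_pos. apply cond_pos. }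
assert (r1 : Rabs (r - 1) < d / 2). { eapply Rlt_le_trans. exact Hr. apply Rmin_l. }
assert (r2 : Rabs (r - 1) < d1). { eapply Rlt_le_trans. exact Hr. eapply Rle_trans. apply Rmin_r. apply Rmin_l. }
assert (r3 : Rabs (r - 1) < d2). { eapply Rlt_le_trans. exact Hr. eapply Rle_trans. apply Rmin_r. apply Rmin_r. }
assert (X1 := Hd1 _ (UK _ (Ur s))). rewrite <- Rd in X1. specialize (X1 r2).
assert (X2 := Hd2 _ (UK _ (Ur t))). rewrite <- Rd in X2. specialize (X2 r3).
rewrite E0 in X1, X2 by auto.
set (v := fun a => t + a * (s - t)).
set (h := fun a => (f (RtoC r * unit_exp (v a)) - RtoC (v a) * D)%C).
assert (Dv : forall a, is_derive v a (s - t)) by (intros a; unfold v; auto_derive; auto; apply Rmult_1_l).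
assert (Du : forall a, rder (fun a => unit_exp (v a)) a (RtoC (s - t) * (Ci * unit_exp (v a)))%C).
{ intros a. apply is_derive_C_R; unfold unit_exp, v; split; simpl; auto_derive; auto; ring. }
assert (Dq : forall a, rder (fun a => RtoC r * unit_exp (v a))%C a (RtoC (s - t) * (Ci * (RtoC r * unit_exp (v a))))%C).
{ intros a. eapply rder_eq. apply rder_scal. exact (Du a). ring. }
assert (Dh : forall a, rder h a (RtoC (s - t) * (Ci * (RtoC r * unit_exp (v a) * g1 (RtoC r * unit_exp (v a))) - D))%C).
{ intros a. eapply rder_eq. apply rder_minus. apply C_derive_comp_R. apply cdiff_C_derive, Hf, Ur. apply Dq.
  apply rder_mult. apply rder_RtoC. apply Dv. apply rder_const. rewrite E1 by auto. cbv beta. ring. }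
assert (Y := mean_value_C h _ 0 1 (Rabs (s - t) * eps) ltac:(lra) (fun a _ => Dh a) (fun a _ => rder_cont _ _ _ (Dh a))).
assert (Z : Cmod (h 1 - h 0)%C <= Rabs (s - t) * eps * (1 - 0)).
{ apply Y. intros a Ha. rewrite Cmod_mult, Cmod_R. apply Rmult_le_compat_l. apply Rabs_pos. apply Rlt_le.
  apply (Hd (RtoC r * unit_exp (v a))%C). apply UK, Ur.
  eapply Rle_lt_trans. apply (Cmod_triangle_minus _ (unit_exp (v a))). rewrite <- Rd.
  assert (W := unit_exp_dist (v a) t).
  assert (Rabs (v a - t) <= Rabs (s - t)).
  { unfold v. replace (t + a * (s - t) - t) with (a * (s - t)) by ring. rewrite Rabs_mult, (Rabs_pos_eq a) by lra.
    generalize (Rabs_pos (s - t)). nra. }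
  lra. }
unfold h in Z.
assert (v1 : v 1 = s). { unfold v. rewrite Rmult_1_l. apply (Rplus_minus t s). }
assert (v0 : v 0 = t). { unfold v. rewrite Rmult_0_l. apply Rplus_0_r. }
rewrite v1, v0 in Z.
replace (g0 (unit_exp s) - g0 (unit_exp t) - RtoC (s - t) * D)%C
  with ((f (RtoC r * unit_exp s) - RtoC s * D - (f (RtoC r * unit_exp t) - RtoC t * D))
    + (- (f (RtoC r * unit_exp s) - g0 (unit_exp s)) + (f (RtoC r * unit_exp t) - g0 (unit_exp t))))%C
  by (rewrite RtoC_minus; ring).
eapply Rle_trans. apply Cmod_triangle.
assert (V := Cmod_triangle (- (f (RtoC r * unit_exp s) - g0 (unit_exp s)))%C (f (RtoC r * unit_exp t) - g0 (unit_exp t))%C).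
rewrite Cmod_opp in V. lra.
Qed.

(** The angular derivative of the boundary value is [Ci] times that of [euler_op f] minus half that
    of [f]. Both functions have jets of one order less, so the induction avoids any formula for
    higher angular derivatives. *)
Lemma boundary_jets n (f g0 : C -> C) : jets U K n f -> cont_on K g0 -> (forall z, U z -> g0 z = f z) ->
  forall l, (l <= n)%nat -> exists g, circle_jet (restrict circle g0) l g.
Proof.
revert f g0. induction n as [|n IH]; intros f g0 Hj C0 E0 l Hl.
- replace l with O by lia. exists (fun t => g0 (unit_exp t)). split. now intros t _.
  intros t. intros P HP. specialize (C0 (unit_exp t) (circleK _ (circle_cis t)) P HP).
  assert (X : rcont unit_exp t) by exact (rder_cont _ _ _ (rder_cis t)).
  specialize (X _ C0). revert X. unfold filtermap, within. apply filter_imp. intros s Hs. apply Hs. apply circleK, circle_cis.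
- destruct l as [|l].
  { apply (IH f g0); auto. apply (jets_le U K (S n)); auto. lia. }
  destruct (proj2 Hj 1%nat ltac:(lia)) as (g1 & C1 & E1).
  set (ge := fun z => (z * g1 z + RtoC (1 / 2) * g0 z)%C).
  assert (Ce : cont_on K ge).
  { apply cont_on_plus. apply cont_on_mult; auto. apply cont_on_id. now apply cont_on_scal. }
  destruct (IH (euler_op f) ge) with (l := l) as [k1 K1]; auto.
  { now apply jets_euler. }
  { intros z Hz. unfold ge, euler_op. now rewrite E1, E0. }
  { lia. }
  destruct (IH f g0) with (l := l) as [k0 K0]; auto.
  { apply (jets_le U K (S n)); auto. }
  { lia. }
  eexists. apply (circle_jet_shift _ (fun z => Ci * restrict circle ge z + (- Ci * RtoC (1 / 2)) * restrict circle g0 z)%C).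
  + intros t. eapply rder_eq. apply (boundary_derivative f g0 g1 (proj1 Hj) C0 E0 C1 E1).
    unfold restrict, ge. change (proj1_sig (cis t)) with (unit_exp t). ring.
  + apply circle_jet_comb. exact K1. exact K0.
Qed.

(** The boundary values of [f] and of [euler_op f] satisfy the equation defining [Phi], and [Phi h]
    is determined by [h] through that equation. *)
Lemma boundary_compatible p (f fe : C -> C) (Phi : CpT (S p) -> CpT p) :
  (forall x : CpT (S p), circle_euler (fn x) (fn (Phi x))) -> jets U K (S p) f -> (forall z, U z -> fe z = euler_op f z) ->
  exists h : CpT (S p),
    boundary_value K (restrict U f) (fn h) /\ boundary_value K (restrict U fe) (fn (Phi h)).
Proof.
intros HP Hj Ee.
destruct (proj2 Hj 0%nat ltac:(lia)) as (g0 & C0 & E0).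
destruct (proj2 Hj 1%nat ltac:(lia)) as (g1 & C1 & E1).
destruct (circle_mem_of_jets (S p) (restrict circle g0)) as [h Hh].
{ apply (boundary_jets (S p) f g0 Hj C0 E0). }
exists h. split.
- exists g0. split; [|split]; auto.
  + intros [z Hz]. now apply E0.
  + intros z. now rewrite Hh.
- exists (fun z => z * g1 z + RtoC (1 / 2) * g0 z)%C. split; [|split].
  + apply cont_on_plus. apply cont_on_mult; auto. apply cont_on_id. now apply cont_on_scal.
  + intros [z Hz]. unfold restrict; simpl. rewrite Ee by auto. unfold euler_op. now rewrite E1, E0.
  + intros z. destruct (cis_surj z) as [t ->].
    assert (X := HP h t). rewrite Hh in X.
    assert (Y := is_derive_CR_unique _ t _ _ X (boundary_derivative f g0 g1 (proj1 Hj) C0 E0 C1 E1 t)).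
    change (proj1_sig (cis t)) with (unit_exp t). unfold restrict in Y. change (proj1_sig (cis t)) with (unit_exp t) in Y.
    assert (W : (- Ci * (Ci * (fn (Phi h) (cis t) - RtoC (1 / 2) * g0 (unit_exp t))) = - Ci * (Ci * (unit_exp t * g1 (unit_exp t))))%C) by now rewrite Y.
    rewrite !Cmult_assoc in W. replace (- Ci * Ci)%C with (RtoC 1) in W.
    2:{ transitivity (- (Ci * Ci))%C. rewrite Ci_Ci. ring. ring. }
    replace (fn (Phi h) (cis t)) with (RtoC 1 * (fn (Phi h) (cis t) - RtoC (1 / 2) * g0 (unit_exp t)) + RtoC (1 / 2) * g0 (unit_exp t))%C by ring.
    rewrite W. ring.
Qed.
End Boundary.

(** * Completeness *)

Lemma isomorphism_inv {E F : NormedModule C_AbsRing} (Phi : E -> F) : isomorphism Phi ->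
  exists Psi : F -> E, isomorphism Psi /\ (forall x, Psi (Phi x) = x) /\ forall y, Phi (Psi y) = y.
Proof.
intros (Hp & Hs & Hc & Psi & H1 & H2 & H3). exists Psi. split; auto. split; [|split; [|split]]; auto.
- intros x y. rewrite <- (H2 x), <- (H2 y) at 1. now rewrite <- Hp, H1.
- intros c x. rewrite <- (H2 x) at 1. now rewrite <- Hs, H1.
- exists Phi. auto.
Qed.

Lemma isomorphism_comp {E F G : NormedModule C_AbsRing} (Phi : E -> F) (Psi : F -> G) :
  isomorphism Phi -> isomorphism Psi -> isomorphism (fun x => Psi (Phi x)).
Proof.
intros (Hp & Hs & Hc & Phi' & H1 & H2 & H3) (Kp & Ks & Kc & Psi' & K1 & K2 & K3).
split; [|split; [|split]].
- intros x y. now rewrite Hp, Kp.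
- intros c x. now rewrite Hs, Ks.
- intros x. apply continuous_comp; auto.
- exists (fun z => Phi' (Psi' z)). split; [|split].
  + intros x. now rewrite K1, H1.
  + intros z. now rewrite H2, K2.
  + intros z. apply continuous_comp; auto.
Qed.

Lemma isomorphic_sym E F : isomorphic E F -> isomorphic F E.
Proof. intros [Phi H]. destruct (isomorphism_inv Phi H) as (Psi & HPsi & _). now exists Psi. Qed.

Lemma isomorphic_trans E F G : isomorphic E F -> isomorphic F G -> isomorphic E G.
Proof. intros [Phi H1] [Psi H2]. eexists. exact (isomorphism_comp Phi Psi H1 H2). Qed.

Lemma isomorphic_refl E : isomorphic E E.
Proof.
exists (fun x => x). split; [|split; [|split]]; auto. intros; apply continuous_id.
exists (fun x => x). repeat split; auto. intros; apply continuous_id.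
Qed.

(** By linearity, continuity at 0 is uniform continuity, so Cauchy filters are carried along [Phi];
    the limit is brought back by the continuous inverse. *)
Lemma Banach_isomorphic E F : isomorphic E F -> Banach F -> Banach E.
Proof.
intros [Phi (Hp & Hs & Hc & Psi & H1 & H2 & H3)] HB Fi PF CF.
assert (L0 : Phi zero = zero).
{ rewrite <- (scal_zero_l (zero : E)) at 1. rewrite Hs. apply (scal_zero_l (V := F)). }
assert (Lm : forall x y, Phi (minus x y) = minus (Phi x) (Phi y)).
{ intros x y. unfold minus. rewrite Hp. f_equal.
  rewrite <- (scal_opp_one y) at 1. rewrite Hs. apply (scal_opp_one (V := F)). }
destruct (HB (filtermap Phi Fi)) as [y Hy].
- now apply filtermap_proper_filter.
- intros eps.
  assert (X : locally (zero : E) (fun x => norm (Phi x) < eps)).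
  { assert (Y := Hc zero (fun v => norm v < eps)). apply Y. rewrite L0.
    apply (locally_le_locally_norm (V := F)). exists eps. intros v Hv.
    replace (norm v) with (norm (minus v zero)). exact Hv. f_equal. exact (minus_zero_r (G := F) v). }
  apply (locally_norm_le_locally (V := E)) in X. destruct X as [d Hd].
  (* In a general normed module balls and norm agree only up to [norm_factor]. *)
  destruct (CF (mkposreal _ (Rdiv_lt_0_compat _ _ (cond_pos d) (norm_factor_gt_0 (V := E))))) as [x Hx].
  exists (Phi x). unfold filtermap. revert Hx. apply filter_imp. intros w Hw.
  apply (norm_compat1 (V := F)). rewrite <- Lm. apply Hd.
  apply (Rle_lt_trans _ (norm (minus w x))).
  { apply Req_le. change (norm (minus (minus w x) zero) = norm (minus w x)). f_equal. exact (minus_zero_r (G := E) _). }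
  apply (norm_compat2 (V := E)) in Hw. simpl in Hw.
  replace (norm_factor * (d / norm_factor)) with (pos d) in Hw. exact Hw.
  field. generalize (norm_factor_gt_0 (V := E)). lra.
- exists (Psi y). intros P HP. specialize (Hy _ (H3 y P HP)).
  unfold filtermap in Hy. revert Hy. apply filter_imp. intros x. now rewrite H1.
Qed.

Lemma isomorphic_chain (A : nat -> NormedModule C_AbsRing) : (forall p, isomorphic (A (S p)) (A p)) ->
  Banach (A O) -> (forall p, Banach (A p)) /\ forall p q, isomorphic (A p) (A q).
Proof.
intros H B0.
assert (X : forall p, isomorphic (A p) (A O)).
{ induction p as [|p IH]. apply isomorphic_refl. exact (isomorphic_trans _ _ _ (H p) IH). }
split.
- intros p. exact (Banach_isomorphic _ _ (X p) B0).
- intros p q. exact (isomorphic_trans _ _ _ (X p) (isomorphic_sym _ _ (X q))).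
Qed.

(** Values at a point converge because C is complete. The auxiliary [y] may depend on the point,
    while the Cauchy condition relating [x], [x0] and [y] does not; this makes the convergence
    uniform. *)
Lemma cauchy_filter_uniform_limit J p {Y : Type} (Q : Y -> Prop) (ev : jet_space J p -> Y -> C)
  (F : (jet_space J p -> Prop) -> Prop) {PF : ProperFilter F} :
  (forall x y z, Q z -> Cmod (ev y z - ev x z)%C <= norm (minus y x)) -> cauchy F ->
  exists L : Y -> C, forall eps, 0 < eps -> F (fun x => forall z, Q z -> Cmod (ev x z - L z)%C <= eps).
Proof.
intros Hev CF.
assert (B : forall x y e, ball (M := jet_space J p) x e y -> norm (minus y x) < e) by (intros x y e H; exact H).
exists (fun z => C_complete_lim (filtermap (fun x => ev x z) F)). intros eps he.
assert (HL : forall z, Q z -> F (fun x => Cmod (ev x z - C_complete_lim (filtermap (fun x => ev x z) F))%C < eps / 4)).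
{ intros z Hz.
  assert (X := C_complete_ax1 (filtermap (fun x => ev x z) F) (filtermap_proper_filter _ _ _ F PF)).
  set (l := C_complete_lim (filtermap (fun x => ev x z) F)) in *.
  assert (Y0 : forall e : posreal, exists v : C, filtermap (fun x => ev x z) F (ball (M := C_UniformSpace) v e)).
  { intros e. destruct (CF e) as [x Hx]. exists (ev x z). unfold filtermap. revert Hx. apply filter_imp.
    intros y Hy. apply C_NormedModule_mixin_compat1. eapply Rle_lt_trans. 2: exact (B _ _ _ Hy). exact (Hev x y z Hz). }
  destruct (proj2 (locally_Cmod l (fun w => Cmod (w - l)%C < eps / 4))) as [d Hd].
  { assert (h4 : 0 < eps / 4) by lra. exists (mkposreal _ h4). auto. }
  specialize (X Y0 d). unfold filtermap in X. revert X. apply filter_imp. intros x Hx. now apply Hd. }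
assert (h4 : 0 < eps / 4) by lra.
destruct (CF (mkposreal _ h4)) as [x0 Hx0].
generalize Hx0. apply filter_imp. intros x Hx z Hz.
destruct (filter_ex _ (filter_and _ _ Hx0 (HL z Hz))) as [y [Y1 Y2]].
apply B in Hx, Y1. simpl in Hx, Y1.
assert (X1 := Hev x0 x z Hz). assert (X2 := Hev x0 y z Hz). rewrite Cmod_minus_sym in X2.
eapply Rle_trans. apply (Cmod_triangle_minus _ (ev x0 z)).
assert (X3 := Cmod_triangle_minus (ev x0 z) (ev y z) (C_complete_lim (filtermap (fun x => ev x z) F))).
lra.
Qed.

Lemma clim_uniform {T} (F : (T -> Prop) -> Prop) {FF : Filter F} (f : T -> C) (a : C) :
  (forall eps, 0 < eps -> exists (g : T -> C) b, clim F g b /\ F (fun x => Cmod (g x - f x)%C <= eps) /\ Cmod (b - a)%C <= eps) ->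
  clim F f a.
Proof.
intros H. apply clim_eps; auto. intros eps he.
destruct (H (eps / 4)) as (g & b & G1 & G2 & G3). lra.
assert (he4 : 0 < eps / 4) by lra.
generalize (filter_and _ _ G2 (proj1 (clim_eps F g b) G1 _ he4)). apply filter_imp. intros x [X1 X2].
assert (Y1 := Cmod_triangle_minus (f x) (g x) a). assert (Y2 := Cmod_triangle_minus (g x) b a).
rewrite (Cmod_minus_sym (f x) (g x)) in Y1. lra.
Qed.

Lemma filter_le_of_norm J p (F : (jet_space J p -> Prop) -> Prop) {FF : Filter F} (x : jet_space J p) :
  (forall eps, 0 < eps -> F (fun y => norm (minus y x) <= eps)) -> filter_le F (locally x).
Proof.
intros H P [d Hd]. assert (d2 : 0 < d / 2) by (generalize (cond_pos d); lra).
generalize (H _ d2). apply filter_imp. intros y Hy. apply Hd.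
change (norm (minus y x) < d). generalize (cond_pos d); lra.
Qed.

Lemma circle_Banach : Banach (CpT 0).
Proof.
intros F PF CF.
destruct (cauchy_filter_uniform_limit circle_jets 0 (fun _ => True) (fun x z => fn x z) F) as [L HL]; auto.
{ intros x y z _. replace (fn y z - fn x z)%C with (fn (minus y x : CpT 0) z). apply (fn_bound 0 (minus y x : CpT 0)).
  change (fn (minus y x : CpT 0) z) with (fn y z + - RtoC 1 * fn x z)%C. ring. }
destruct (circle_mem_of_jets 0 L) as [x Hx].
{ intros l Hl. replace l with O by lia. exists (fun t => L (cis t)). split. now intros t _.
  intros t. apply clim_uniform. apply locally_filter. intros eps he.
  destruct (filter_ex _ (HL eps he)) as [y Hy].
  exists (fun t => fn (y : CpT 0) (cis t)), (fn (y : CpT 0) (cis t)). split; [|split].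
  apply rcont_fn. apply filter_forall. intros s. now apply Hy. now apply Hy. }
exists x. apply filter_le_of_norm. apply PF. intros eps he.
generalize (HL eps he). apply filter_imp. intros y Hy.
apply (circle_norm_le 0 (minus y x : CpT 0)). intros l g t Hl [G _]. replace l with O in G by lia.
rewrite (G t I). change (fn (minus y x : CpT 0) (cis t)) with (fn (y : CpT 0) (cis t) + - RtoC 1 * fn x (cis t))%C.
rewrite Hx. replace (fn (y : CpT 0) (cis t) + - RtoC 1 * L (cis t))%C with (fn (y : CpT 0) (cis t) - L (cis t))%C by ring.
now apply Hy.
Qed.

Lemma disc_mem_jets n (x : ApD n) : jets disc closed_disc n (ext0 (fn x)).
Proof. apply (jets_iff disc closed_disc disc_open). exact (proj2_sig x). Qed.

Lemma exterior_mem_jets n (x : ApE n) : jets exterior closed_exterior n (ext0 (fn x)).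
Proof.
apply (jets_iff exterior closed_exterior exterior_open).
destruct (proj2_sig x) as [[X1 _] X2]. split. exact X1. exact X2.
Qed.

(** The limit is taken of the continuous extensions, whose sup over the closed disc is bounded by
    the norm. So the limit is continuous up to the boundary as well as holomorphic inside. *)
Lemma disc_Banach : Banach (ApD 0).
Proof.
intros F PF CF.
assert (Q : forall x : ApD 0, exists g, cont_on closed_disc g /\ forall z, disc z -> g z = ext0 (fn x) z).
{ intros x. exact (proj2 (disc_mem_jets 0 x) O (Nat.le_refl 0)). }
set (ev := fun x => proj1_sig (constructive_indefinite_description _ (Q x))).
assert (Hev : forall x, cont_on closed_disc (ev x) /\ forall z, disc z -> ev x z = ext0 (fn x) z).
{ intros x. unfold ev. now destruct constructive_indefinite_description. }
assert (Em : forall (x y : ApD 0) z, ext0 (fn (minus y x : ApD 0)) z = (ext0 (fn y) z - ext0 (fn x) z)%C).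
{ intros x y z. change (fn (minus y x : ApD 0)) with (fun z => (fn y z + - RtoC 1 * fn x z)%C).
  rewrite ext0_plus, ext0_scal. ring. }
destruct (cauchy_filter_uniform_limit disc_jets 0 closed_disc ev F) as [L HL]; auto.
{ intros x y z Hz.
  apply (cont_on_bound disc closed_disc disc_closed_disc disc_dense (fun z => ev y z + (- RtoC 1) * ev x z)%C (norm (minus y x))) in Hz.
  - replace (ev y z - ev x z)%C with (ev y z + (- RtoC 1) * ev x z)%C by ring. exact Hz.
  - apply cont_on_plus. apply Hev. apply cont_on_scal. apply Hev.
  - intros w Hw. rewrite !(proj2 (Hev _)) by auto.
    replace (ext0 (fn y) w + - RtoC 1 * ext0 (fn x) w)%C with (ext0 (fn (minus y x : ApD 0)) w) by (rewrite Em; ring).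
    apply (jet_norm_disc_ub 0 (minus y x : ApD 0) 0); auto. }
assert (CL : cont_on closed_disc L).
{ intros z Hz. apply clim_uniform. typeclasses eauto. intros eps he.
  destruct (filter_ex _ (HL eps he)) as [y Hy].
  exists (ev y), (ev y z). split; [|split]; auto. now apply (proj1 (Hev y)).
  unfold within. apply filter_forall. auto. }
assert (Hol : forall z, disc z -> cdiff L z).
{ apply (holomorphic_uniform_limit disc disc_open).
  - intros z Hz. apply (continuous_continuous_on (T := C_UniformSpace) (U := C_UniformSpace) closed_disc L). 2: exact CL.
    generalize (disc_open z Hz). apply filter_imp. apply disc_closed_disc.
  - intros eps he. destruct (filter_ex _ (HL eps he)) as [y Hy].
    exists (ext0 (fn (y : ApD 0))). split. apply (disc_mem_jets 0 y).
    intros z Hz. rewrite <- (proj2 (Hev y)) by auto. rewrite Cmod_minus_sym. apply Hy. now apply disc_closed_disc. }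
assert (JL : jets disc closed_disc 0 (ext0 (restrict disc L))).
{ apply (jets_ext disc closed_disc disc_open 0 L). intros z Hz. now rewrite ext0_restrict.
  split; auto. intros l Hl. replace l with O by lia. exists L. split; auto. }
apply (jets_iff disc closed_disc disc_open) in JL.
set (x := exist _ (restrict disc L) JL : ApD 0).
exists x. apply filter_le_of_norm. apply PF. intros eps he.
generalize (HL eps he). apply filter_imp. intros y Hy.
apply (jet_norm_disc_le 0 (minus y x : ApD 0)). intros l z Hl Hz. replace l with O by lia.
change (Cderive_n 0 (ext0 (fn (minus y x : ApD 0))) z) with (ext0 (fn (minus y x : ApD 0)) z). rewrite Em.
change (ext0 (fn x) z) with (ext0 (restrict disc L) z). rewrite ext0_restrict by auto.
rewrite <- (proj2 (Hev y)) by auto. apply Hy. now apply disc_closed_disc.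
Qed.

Lemma restrict_ext0 U (f : {z : C | U z} -> C) : restrict U (ext0 f) = f.
Proof.
apply functional_extensionality. intros [z Hz]. unfold restrict. simpl. apply ext0_in.
Qed.

Lemma Cmod_polar r t : Cmod (RtoC r * unit_exp t)%C = Rabs r.
Proof. unfold unit_exp. now rewrite Cmod_mult, Cmod_cis, Cmod_R, Rmult_1_r. Qed.

Theorem theorem9 :
  (forall p : nat, exists Phi : CpT (S p) -> CpT p,
     isomorphism Phi /\
     (exists Phi_D : ApD (S p) -> ApD p,
        isomorphism Phi_D /\
        forall f : ApD (S p), exists h : CpT (S p),
          boundary_value closed_disc (fn f) (fn h) /\
          boundary_value closed_disc (fn (Phi_D f)) (fn (Phi h))) /\
     (exists Phi_E : ApE (S p) -> ApE p,
        isomorphism Phi_E /\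
        forall f : ApE (S p), exists h : CpT (S p),
          boundary_value closed_exterior (fn f) (fn h) /\
          boundary_value closed_exterior (fn (Phi_E f)) (fn (Phi h)))) /\
  ((forall p : nat, Banach (CpT p)) /\
   (forall p q : nat, isomorphic (CpT p) (CpT q))) /\
  ((forall p : nat, Banach (ApD p)) /\
   (forall p q : nat, isomorphic (ApD p) (ApD q))).
Proof.
split; [|split].
- intros p. destruct (circle_euler_isomorphism p) as (Phi & I1 & H1).
  exists Phi. split; [|split]; auto.
  + destruct (disc_euler_isomorphism p) as (Psi & I2 & H2). exists Psi. split; auto. intros f.
    rewrite <- (restrict_ext0 disc (fn f)), <- (restrict_ext0 disc (fn (Psi f))).
    apply (boundary_compatible disc closed_disc disc_open disc_closed_disc) with (p := p); auto.
    * intros z Hz. unfold circle in Hz. unfold closed_disc. lra.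
    (* The minimum with 1/2 keeps the radius positive, so that it is its own absolute value. *)
    * intros eps he. exists (1 - Rmin (eps / 2) (1 / 2)).
      assert (X : 0 < Rmin (eps / 2) (1 / 2)) by (apply Rmin_glb_lt; lra).
      assert (X1 := Rmin_l (eps / 2) (1 / 2)). assert (X2 := Rmin_r (eps / 2) (1 / 2)). split.
      rewrite Rabs_left; lra. intros t. unfold disc. rewrite Cmod_polar, Rabs_pos_eq; lra.
    * apply disc_mem_jets.
  + destruct (exterior_euler_isomorphism p) as (Psi & I2 & H2). exists Psi. split; auto. intros f.
    rewrite <- (restrict_ext0 exterior (fn f)), <- (restrict_ext0 exterior (fn (Psi f))).
    apply (boundary_compatible exterior closed_exterior exterior_open exterior_closed_exterior) with (p := p); auto.
    * intros z Hz. unfold circle in Hz. unfold closed_exterior. lra.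
    * intros eps he. exists (1 + eps / 2). split. rewrite Rabs_pos_eq; lra.
      intros t. unfold exterior. rewrite Cmod_polar, Rabs_pos_eq; lra.
    * apply exterior_mem_jets.
- apply isomorphic_chain. 2: exact circle_Banach.
  intros p. destruct (circle_euler_isomorphism p) as (Phi & H & _). now exists Phi.
- apply isomorphic_chain. 2: exact disc_Banach.
  intros p. destruct (disc_euler_isomorphism p) as (Phi & H & _). now exists Phi.
Qed.
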